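(* Let $\mathcal{L}_0[u]=-\lambda_0\Delta u-\mathrm{tr}(\Sigma(x)\Sigma^*(x)D^2u)$, where $\lambda_0>0$ and $\Sigma:\mathbb{R}^d\to\mathbb{R}^{d\times\ell}$ satisfies $\|\Sigma(x)\|\le\sigma_0$, $\|\Sigma(x)-\Sigma(y)\|\le\sigma_1|x-y|$ for all $x,y\in\mathbb{R}^d$. Assume that $b$ is a continuous vector field such that there exist $\gamma\ge2$ and $\alpha,R>0$ with $b(t,x)\cdot x\ge\alpha|x|^\gamma$ for all $|x|\ge R$, $t>0$, and there exists $c_0>0$ with $(b(t,x)-b(t,y))\cdot(x-y)\ge-c_0|x-y|$ for all $x,y\in\mathbb{R}^d$, $t>0$. Let $u_0$ be continuous on $\mathbb{R}^d$ and let $u$ be a viscosity solution of $$\partial_tu+\mathcal{L}_0[u]+b(t,x)\cdot Du=0\ \text{ in }(0,T)\times\mathbb{R}^d,\qquad u(0,x)=u_0(x)\ \text{ in }\mathbb{R}^d,$$ such that $|u(t,x)|\le C(1+|x|)^m$ for some $m>0$ and $C>0$ (uniformly in time). Then for any $k>0$ such that $u_0\in L^\infty(\langle x\rangle^{-k})$, there exist positive constants $K,\omega>0$ (depending on $\alpha,\gamma,\lambda_0,\sigma_0,\sigma_1,c_0,d,k$) such that $$[u(t)]_{\langle x\rangle^k}\le Ke^{-\omega t}[u_0]_{\langle x\rangle^k}\qquad\text{for all }t\in(0,T).$$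
   Context: $\langle x\rangle:=\sqrt{1+|x|^2}$. $L^\infty(\langle x\rangle^{-k})$ is the space of measurable $u$ with $u\langle x\rangle^{-k}\in L^\infty(\mathbb{R}^d)$. The weighted oscillation seminorm is $[u]_{\langle x\rangle^k}:=\sup_{x,y\in\mathbb{R}^d}\frac{|u(x)-u(y)|}{\langle x\rangle^k+\langle y\rangle^k}$. Viscosity solution: $u\in C^0([0,T]\times\mathbb{R}^d)$ with $u(0,\cdot)=u_0$ such that, for every $\chi\in C^{1,2}((0,T)\times\mathbb{R}^d)$, at every global maximum (resp. minimum) point $(t_0,x_0)\in(0,T)\times\mathbb{R}^d$ of $u-\chi$ one has $\partial_t\chi+\mathcal{L}_0[\chi]+b\cdot D\chi\le0$ (resp. $\ge0$) at $(t_0,x_0)$.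
   Formalization: The constants K and ω are also allowed to depend on the radius R of the condition b·x ≥ α|x|^γ for |x| ≥ R; independence of R is false (take b = 0 on |x| ≤ R/2, Σ = 0, u₀ = x₁, k = 1 and R → ∞). *)

(* Defs.v *)
From HB Require Import structures.
From mathcomp Require Import all_boot all_order all_algebra.
From mathcomp Require Import all_classical all_reals all_analysis.
Set Implicit Arguments.
Unset Strict Implicit.
Unset Printing Implicit Defensive.
Import Order.TTheory GRing.Theory Num.Theory.
Import numFieldNormedType.Exports.
Local Open Scope classical_set_scope.
Local Open Scope ring_scope.

(* R^d is 'rV[R]_d.  The library norm `|x| on matrices is the max norm; it is
   used here only through the topology it induces, and the Euclidean norm is
   enorm. *)
Definition dot (R : realType) (d : nat) (x y : 'rV[R]_d) : R :=
  \sum_(i < d) x 0 i * y 0 i.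

Definition enorm (R : realType) (d : nat) (x : 'rV[R]_d) : R :=
  Num.sqrt (dot x x).

(* Operator norm for the Euclidean norms; v *m A^T is the row vector of A v. *)
Definition opnorm (R : realType) (d l : nat) (A : 'M[R]_(d, l)) : R :=
  sup [set enorm (v *m A^T) | v in [set v : 'rV[R]_l | enorm v <= 1]].

Definition japanese (R : realType) (d : nat) (x : 'rV[R]_d) : R :=
  Num.sqrt (1 + enorm x ^+ 2).

(* [u]_{<x>^k}, possibly +oo. *)
Definition wosc (R : realType) (d : nat) (k : R) (u : 'rV[R]_d -> R) : \bar R :=
  ereal_sup [set z | exists x y : 'rV[R]_d,
    z = (`|u x - u y| / (japanese x `^ k + japanese y `^ k))%:E].

Definition box (R : realType) (d : nat) (a b : 'rV[R]_d) : set 'rV[R]_d :=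
  [set x | forall i, a 0 i < x 0 i < b 0 i].

Definition box_volume (R : realType) (d : nat) (a b : 'rV[R]_d) : R :=
  \prod_(i < d) Num.max 0 (b 0 i - a 0 i).

Definition lebesgue_outer (R : realType) (d : nat) (E : set 'rV[R]_d) : \bar R :=
  ereal_inf [set s | exists a b : nat -> 'rV[R]_d,
    E `<=` \bigcup_n box (a n) (b n) /\
    s = (\sum_(0 <= n <oo) (box_volume (a n) (b n))%:E)%E].

(* u is Lebesgue measurable and u <x>^{-k} is essentially bounded. *)
Definition Linfty_weighted (R : realType) (d : nat) (k : R)
    (u : 'rV[R]_d -> R) : Prop :=
  (forall a : R, (@lebesgue_outer R d).-caratheodory [set x | a < u x]) /\
  (exists M : R,
     lebesgue_outer [set x | M < `|u x * japanese x `^ (- k)|] = 0%E).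

Section space_derivatives.
Context {R : realType} {d : nat}.
Implicit Types (f : 'rV[R]_d -> R) (x : 'rV[R]_d).

Definition partial (i : 'I_d) f : 'rV[R]_d -> R := 'D_(delta_mx 0 i) f.

Definition grad f x : 'rV[R]_d := \row_i partial i f x.

Definition hessian f x : 'M[R]_d := \matrix_(i, j) partial i (partial j f) x.

Definition laplacian f x : R := \sum_(i < d) partial i (partial i f) x.

End space_derivatives.

Definition L0 (R : realType) (d l : nat) (lambda0 : R)
    (Sigma : 'rV[R]_d -> 'M[R]_(d, l)) (f : 'rV[R]_d -> R) (x : 'rV[R]_d) : R :=
  - lambda0 * laplacian f x - \tr (Sigma x *m (Sigma x)^T *m hessian f x).

(* chi is a total function, of which only the values on (0,T) x R^d matter:
   this set is open, so all the derivatives below are determined by them. *)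
Definition C12 (R : realType) (d : nat) (T : R) (chi : R -> 'rV[R]_d -> R) : Prop :=
  let Q := [set p : R * 'rV[R]_d | 0 < p.1 < T] in
  [/\ {in Q, continuous (fun p => chi p.1 p.2)},
      (forall p, Q p -> derivable (chi^~ p.2) p.1 1) /\
      {in Q, continuous (fun p => derive1 (chi^~ p.2) p.1)},
      forall i : 'I_d,
        (forall p, Q p -> derivable (chi p.1) p.2 (delta_mx 0 i)) /\
        {in Q, continuous (fun p => partial i (chi p.1) p.2)} &
      forall i j : 'I_d,
        (forall p, Q p ->
           derivable (partial j (chi p.1)) p.2 (delta_mx 0 i)) /\
        {in Q, continuous (fun p => partial i (partial j (chi p.1)) p.2)}].

Definition parabolic_op (R : realType) (d l : nat) (lambda0 : R)
    (Sigma : 'rV[R]_d -> 'M[R]_(d, l)) (b : R -> 'rV[R]_d -> 'rV[R]_d)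
    (chi : R -> 'rV[R]_d -> R) (t : R) (x : 'rV[R]_d) : R :=
  derive1 (chi^~ x) t + L0 lambda0 Sigma (chi t) x + dot (b t x) (grad (chi t) x).

Definition viscosity_solution (R : realType) (d l : nat) (lambda0 : R)
    (Sigma : 'rV[R]_d -> 'M[R]_(d, l)) (b : R -> 'rV[R]_d -> 'rV[R]_d)
    (T : R) (u0 : 'rV[R]_d -> R) (u : R -> 'rV[R]_d -> R) : Prop :=
  [/\ {within `[0, T]%classic `*` [set: 'rV[R]_d],
         continuous (fun p : R * 'rV[R]_d => u p.1 p.2)},
      forall x, u 0 x = u0 x &
      forall chi, C12 T chi -> forall t0 x0, 0 < t0 < T ->
        ((forall t x, 0 < t < T ->
            u t x - chi t x <= u t0 x0 - chi t0 x0) ->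
         parabolic_op lambda0 Sigma b chi t0 x0 <= 0) /\
        ((forall t x, 0 < t < T ->
            u t0 x0 - chi t0 x0 <= u t x - chi t x) ->
         0 <= parabolic_op lambda0 Sigma b chi t0 x0)].

(* Main.v *)
(* Coupling by reflection, carried out on viscosity solutions.  Let
   [Phi(x,y) = B (1 - exp(-mu |x-y|)) + F(x) + F(y)], where [F] is a C^2 function
   comparable to [<x>^k], constant on [|x| <= r].  Consider the diffusion of the
   pair [(x,y)] in which the isotropic noises are reflected into each other across
   the hyperplane orthogonal to [x-y] and the noises of [Sigma] are driven
   synchronously.  Its generator [G] satisfies [G Phi <= - omega Phi]: far away
   because of the confining drift acting on [F], and on the remaining compact set
   because the reflected noise makes the concave function of [|x-y|] decrease.
   After doubling the variables, [u(t,x) - u(s,y) - M e^(-omega t) Phi(x,y)] can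
   therefore not have a positive maximum, so that
   [u(t,x) - u(t,y) <= M e^(-omega t) Phi(x,y)], which is the decay.

   The maximum point is exploited through a theorem on sums for linear operators
   [tr (A_i D^2 u_i)] with [A_i = P_i^T P_i], for which Alexandrov's theorem is not
   needed.  At a maximum of [u1(z1) + u2(z2) - Q(z1,z2)] the sup-convolutions of
   [u1] and [u2], pulled back by [zeta |-> zeta P_i] to the common noise space, leave
   a gap on a small sphere.  Fill it with a function [h] of constant Laplacian, whose
   boundary values are obtained by approximating with harmonic polynomials; testing
   [u1] with [h] and [u2] with [-h] shows that [h(0)] lies strictly between two
   values that coincide. *)
Require Import Defs.
From mathcomp Require Import all_boot all_order all_algebra.
From mathcomp Require Import all_classical all_reals all_analysis.
From mathcomp Require Import ring lra.
Import Order.TTheory GRing.Theory Num.Theory.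
Import numFieldNormedType.Exports.
Set Implicit Arguments.
Unset Strict Implicit.
Unset Printing Implicit Defensive.
Local Open Scope classical_set_scope.
Local Open Scope ring_scope.

(** * Euclidean geometry of row vectors *)

(** Separate times for the two particles make time a mere coordinate: in [R^(1+d)] the equation is
    degenerate elliptic, with drift 1 and no noise in the time direction. The theorem on sums is
    therefore purely elliptic, and its degeneracy is removed by feeding both particles a small
    common noise of variance [kappa].

    Boundedness and Lipschitz continuity of [Sigma] together bound the trace of its squared
    increment by a multiple of [|x-y|], not of [|x-y|^2]. Like the one-sided bound on [b], this
    pushes [|x-y|] apart at bounded speed, and a concave profile with large [mu] outweighs any
    bounded speed. The exponent [gamma >= 2] makes the confinement at least linear, hence the loss
    on [F] proportional to [F] and the rate exponential.

    The kink of [|x-y|] is harmless: a positive maximum cannot sit at [x = y]. Since [u] may grow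
    faster than [<x>^k], a penalty of order [eps <x>^(m+1)] confines the maximum; [eps] is chosen
    after the point to be contradicted, so [m] and [C] do not enter the constants. *)

Section Euclid.
Context {R : realType}.

Section Dot.
Context {n : nat}.
Implicit Types (x y z : 'rV[R]_n) (a : R).

Lemma dotC x y : dot x y = dot y x.
Proof. by apply: eq_bigr => i _; rewrite mulrC. Qed.

Lemma dotDl x y z : dot (x + y) z = dot x z + dot y z.
Proof. by rewrite -big_split; apply: eq_bigr => i _; rewrite mxE mulrDl. Qed.

Lemma dotZl a x y : dot (a *: x) y = a * dot x y.
Proof. by rewrite mulr_sumr; apply: eq_bigr => i _; rewrite mxE mulrA. Qed.

Lemma dotNl x y : dot (- x) y = - dot x y.
Proof. by rewrite -scaleN1r dotZl mulN1r. Qed.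

Lemma dotBl x y z : dot (x - y) z = dot x z - dot y z.
Proof. by rewrite dotDl dotNl. Qed.

Lemma dot0l x : dot 0 x = 0.
Proof. by rewrite -(scale0r 0) dotZl mul0r. Qed.

Lemma dotDr x y z : dot z (x + y) = dot z x + dot z y.
Proof. by rewrite dotC dotDl !(dotC z). Qed.

Lemma dotZr a x y : dot x (a *: y) = a * dot x y.
Proof. by rewrite dotC dotZl dotC. Qed.

Lemma dotNr x y : dot x (- y) = - dot x y.
Proof. by rewrite dotC dotNl dotC. Qed.

Lemma dotBr x y z : dot z (x - y) = dot z x - dot z y.
Proof. by rewrite dotDr dotNr. Qed.

Lemma dot0r x : dot x 0 = 0.
Proof. by rewrite dotC dot0l. Qed.

Lemma dot_ge0 x : 0 <= dot x x.
Proof. by apply: sumr_ge0 => i _; rewrite -expr2 sqr_ge0. Qed.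

Lemma dot_eq0 x : dot x x = 0 -> x = 0.
Proof.
move=> /eqP; rewrite psumr_eq0 => [/allP h|i _]; last by rewrite -expr2 sqr_ge0.
apply/rowP => i; have := h i (mem_index_enum i).
by rewrite /= -expr2 sqrf_eq0 mxE => /eqP.
Qed.

Lemma dotE x y : dot x y = (x *m y^T) 0 0.
Proof. by rewrite mxE; apply: eq_bigr => i _; rewrite mxE. Qed.

Lemma enorm_ge0 x : 0 <= enorm x.
Proof. exact: sqrtr_ge0. Qed.

Lemma sqr_enorm x : enorm x ^+ 2 = dot x x.
Proof. by rewrite sqr_sqrtr// dot_ge0. Qed.

Lemma enorm0 : enorm (0 : 'rV[R]_n) = 0.
Proof. by rewrite /enorm dot0l sqrtr0. Qed.

Lemma enorm_eq0 x : enorm x = 0 -> x = 0.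
Proof. by move=> h; apply: dot_eq0; rewrite -sqr_enorm h expr0n. Qed.

Lemma enormN x : enorm (- x) = enorm x.
Proof. by rewrite /enorm dotNl dotNr opprK. Qed.

Lemma enormZ a x : enorm (a *: x) = `|a| * enorm x.
Proof.
by rewrite /enorm dotZl dotZr mulrA -expr2 sqrtrM ?sqr_ge0// sqrtr_sqr.
Qed.

Lemma enorm_distC x y : enorm (x - y) = enorm (y - x).
Proof. by rewrite -enormN opprB. Qed.

Lemma dot_le_enorm x y : `|dot x y| <= enorm x * enorm y.
Proof.
rewrite -(ler_sqr (x := `|_|)) ?nnegrE ?mulr_ge0 ?enorm_ge0//.
rewrite real_normK ?num_real// exprMn !sqr_enorm.
have [/dot_eq0 ->|y0] := eqVneq (dot y y) 0; first by rewrite !dot0r mulr0 expr0n.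
have yp : 0 < dot y y by rewrite lt_neqAle eq_sym y0 dot_ge0.
have := dot_ge0 (dot y y *: x - dot x y *: y).
rewrite dotBl !dotBr !dotZl !dotZr (dotC y x).
set a := dot x x; set b := dot y y; set c := dot x y => h.
have : 0 <= b * (a * b - c ^+ 2).
  by apply: le_trans h _; rewrite le_eqVlt; apply/orP; left; apply/eqP; ring.
by rewrite pmulr_rge0// subr_ge0.
Qed.

Lemma dot_le x y : dot x y <= enorm x * enorm y.
Proof. exact: le_trans (ler_norm _) (dot_le_enorm _ _). Qed.

Lemma enormD x y : enorm (x + y) <= enorm x + enorm y.
Proof.
rewrite -ler_sqr ?nnegrE ?addr_ge0 ?enorm_ge0//.
rewrite sqr_enorm sqrrD !sqr_enorm dotDl !dotDr (dotC y x).
have := dot_le x y; lra.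
Qed.

Lemma enorm_le_subD x y : enorm x <= enorm (x - y) + enorm y.
Proof. by rewrite -{1}(subrK y x) enormD. Qed.

Lemma coord_le_enorm x i : `|x 0 i| <= enorm x.
Proof.
rewrite -ler_sqr ?nnegrE ?enorm_ge0// sqr_enorm real_normK ?num_real//.
rewrite /dot (bigD1 i)//= -expr2 lerDl.
by apply: sumr_ge0 => j _; rewrite -expr2 sqr_ge0.
Qed.

Lemma enorm_le_sum x : enorm x <= \sum_i `|x 0 i|.
Proof.
rewrite -ler_sqr ?nnegrE ?enorm_ge0 ?sumr_ge0// sqr_enorm.
rewrite expr2 mulr_suml; apply: ler_sum => i _.
rewrite (le_trans (ler_norm _))// normrM ler_wpM2l//.
by rewrite (bigD1 i)//= lerDl sumr_ge0.
Qed.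

Lemma dot_small_eq0 x : (forall e, 0 < e -> dot x x <= e) -> x = 0.
Proof.
move=> h; apply: dot_eq0; apply/eqP; rewrite eq_le dot_ge0 andbT.
by apply/ler_addgt0Pl => e /h; rewrite addr0.
Qed.

End Dot.

Lemma dot_mulmx m n (x : 'rV[R]_m) (A : 'M[R]_(m, n)) (y : 'rV[R]_n) :
  dot (x *m A) y = dot x (y *m A^T).
Proof. by rewrite !dotE trmx_mul trmxK mulmxA. Qed.

Lemma dot_row_mx m n (x x' : 'rV[R]_m) (y y' : 'rV[R]_n) :
  dot (row_mx x y) (row_mx x' y') = dot x x' + dot y y'.
Proof. by rewrite !dotE tr_row_mx mul_row_col mxE. Qed.

Lemma mulmx_bounded m n (A : 'M[R]_(m, n)) :
  exists2 C, 0 < C & forall x, enorm (x *m A) <= C * enorm x.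
Proof.
exists (1 + \sum_j \sum_i `|A i j|) => [|x].
  by rewrite ltr_wpDr// sumr_ge0// => j _; rewrite sumr_ge0.
apply: le_trans (enorm_le_sum _) _.
rewrite mulrDl mul1r ler_wpDl ?enorm_ge0// mulr_suml ler_sum// => j _.
rewrite mxE (le_trans (ler_norm_sum _ _ _))// mulr_suml ler_sum// => i _.
by rewrite normrM mulrC ler_wpM2l// coord_le_enorm.
Qed.

Lemma quad_bounded n (A : 'M[R]_n) :
  exists2 C, 0 < C & forall x, `|dot (x *m A) x| <= C * dot x x.
Proof.
have [C C0 h] := mulmx_bounded A; exists C => // x.
rewrite (le_trans (dot_le_enorm _ _))// -sqr_enorm expr2 mulrA.
by rewrite ler_wpM2r ?enorm_ge0.
Qed.

Lemma dot_delta n (A : 'M[R]_n) i j :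
  dot (delta_mx 0 i *m A) (delta_mx 0 j) = A i j.
Proof.
rewrite -rowE /dot (bigD1 j)//= big1 => [|k kj]; rewrite !mxE eqxx.
  by rewrite eqxx mulr1 addr0.
by rewrite (negbTE kj) mulr0.
Qed.

Lemma trace_dot n (A : 'M[R]_n) :
  \tr A = \sum_i dot (delta_mx 0 i *m A) (delta_mx 0 i).
Proof. by apply: eq_bigr => i _; rewrite dot_delta. Qed.

Lemma trace_congr m n (P : 'M[R]_(m, n)) (X : 'M[R]_n) :
  \tr (P *m X *m P^T) = \sum_k dot (row k P *m X) (row k P).
Proof.
rewrite trace_dot; apply: eq_bigr => k _.
by rewrite !rowE !mulmxA dot_mulmx trmxK.
Qed.

Lemma dot_mulmx_sym n (X : 'M[R]_n) (x y : 'rV[R]_n) :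
  X^T = X -> dot (x *m X) y = dot (y *m X) x.
Proof. by move=> sX; rewrite dot_mulmx sX dotC. Qed.

End Euclid.

(** * Second-order jets *)

Section LittleO.
Context {R : realType} {n : nat}.
Implicit Types (r : 'rV[R]_n -> R) (w : 'rV[R]_n).

Definition o2 r := forall e : R, 0 < e ->
  exists2 de : R, 0 < de & forall w, enorm w <= de -> `|r w| <= e * dot w w.

Lemma o2_ext r r' : (forall w, r w = r' w) -> o2 r -> o2 r'.
Proof.
by move=> h hr e /hr[de de0 H]; exists de => // w /H; rewrite h.
Qed.

Lemma o2_0 : o2 (fun=> 0).
Proof. by move=> e e0; exists 1 => // w _; rewrite normr0 mulr_ge0 ?dot_ge0 ?ltW. Qed.

Lemma o2D r r' : o2 r -> o2 r' -> o2 (fun w => r w + r' w).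
Proof.
move=> hr hr' e e0; have e20 : 0 < e / 2 by lra.
have [d1 d10 h1] := hr _ e20; have [d2 d20 h2] := hr' _ e20.
exists (Num.min d1 d2) => [|w]; first by rewrite lt_min d10.
rewrite le_min => /andP[/h1 ? /h2 ?]; apply: le_trans (ler_normD _ _) _.
by rewrite (splitr e) mulrDl lerD.
Qed.

Lemma o2Z a r : o2 r -> o2 (fun w => a * r w).
Proof.
move=> hr e e0; have a0 : 0 < `|a| + 1 by rewrite ltr_wpDl.
have [d1 d10 h1] := hr _ (divr_gt0 e0 a0); exists d1 => // w /h1.
rewrite mulrAC ler_pdivlMr// => h; rewrite normrM (le_trans _ h)// mulrC.
by rewrite ler_wpM2l// lerDl.
Qed.

Lemma o2_cube r C de : 0 < de ->
  (forall w, enorm w <= de -> `|r w| <= C * enorm w ^+ 3) -> o2 r.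
Proof.
move=> d0 h e e0; have C0 : 0 < `|C| + 1 by rewrite ltr_wpDl.
exists (Num.min de (e / (`|C| + 1))) => [|w]; first by rewrite lt_min d0 divr_gt0.
rewrite le_min => /andP[/h{}h]; rewrite ler_pdivlMr// => w1.
apply: le_trans h _; rewrite -sqr_enorm exprS mulrA ler_wpM2r ?sqr_ge0//.
apply: le_trans w1; rewrite mulrC ler_wpM2l ?enorm_ge0//.
by have := ler_norm C; lra.
Qed.

End LittleO.

Section Jets.
Context {R : realType}.

Section OneVariable.
Implicit Types (f g df : R -> R) (s : R).

(** Peano form of the second-order expansion: a statement at a single point, stable under
    composition without derivatives in a neighbourhood. *)
Definition jet1 g s (g1 g2 : R) := forall e : R, 0 < e -> exists2 de : R, 0 < de &
  forall h : R, `|h| <= de -> `|g (s + h) - g s - g1 * h - g2 * h ^+ 2 / 2| <= e * h ^+ 2.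

Lemma jet1_affine a b s : jet1 (fun x => a * x + b) s a 0.
Proof.
move=> e e0; exists 1 => // h _.
by rewrite /= (_ : _ - _ = 0) ?normr0 ?(mulr_ge0 (ltW e0) (sqr_ge0 h))//; field.
Qed.

Lemma jet1_sqr s : jet1 (fun x => x ^+ 2) s (2 * s) 2.
Proof.
move=> e e0; exists 1 => // h _.
by rewrite /= (_ : _ - _ = 0) ?normr0 ?(mulr_ge0 (ltW e0) (sqr_ge0 h))//; field.
Qed.

(* Taylor-Young at order two, from the mean value theorem for
   [y |-> f y - f' s (y - s) - f'' s (y - s)^2 / 2]. *)
Lemma jet1_derive f df (f2 s rho : R) : 0 < rho ->
  (forall y, `|y - s| < rho -> is_derive y 1 f (df y)) ->
  is_derive s 1 df f2 -> jet1 f s (df s) f2.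
Proof.
move=> rho0 hf hdf e e0.
have [d0 d00 hd] : exists2 de : R, 0 < de & forall h : R, `|h| <= de ->
    `|df (s + h) - df s - f2 * h| <= e * `|h|.
  have [/derivable_nbhsP/eqaddoP/(_ _ e0)/nbhs_ballP[de /= de0 H] E] := hdf.
  exists (de / 2) => [|k kd]; first by lra.
  have kb : ball 0 de k by rewrite /ball/= sub0r normrN (le_lt_trans kd)//; lra.
  have := H _ kb; rewrite E; apply: le_trans; rewrite le_eqVlt; apply/orP; left.
  apply/eqP; congr `|_|; rewrite !fctE /= /GRing.scale/= mulr1 (addrC k).
  by ring.
pose m := Num.min d0 (rho / 2).
have m0 : 0 < m by rewrite lt_min d00/=; lra.
exists m => // h hm.
have hm1 : `|h| <= d0 by rewrite (le_trans hm)// ge_min lexx.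
have hm2 : `|h| < rho.
  by rewrite (le_lt_trans hm)// gt_min; apply/orP; right; lra.
pose g y := f y - df s * (y - s) - f2 / 2 * (y - s) ^+ 2.
pose dg y := df y - df s - f2 * (y - s).
have Dg y : `|y - s| < rho -> is_derive y 1 g (dg y).
  move=> ys; have := hf _ ys => ?.
  rewrite /g; apply: is_derive_eq; rewrite /dg.
  rewrite /GRing.scale/= ?subr0 ?mulr1. by field.
have key c : `|c - s| <= `|h| -> `|dg c| <= e * `|h|.
  move=> cs; have := hd (c - s) (le_trans cs hm1).
  rewrite (addrC s) subrK => /le_trans; apply; exact: ler_wpM2l (ltW e0) _ _ cs.
suff [c cs E] : exists2 c, `|c - s| <= `|h| & g (s + h) - g s = dg c * h.
  have -> : f (s + h) - f s - df s * h - f2 * h ^+ 2 / 2 = g (s + h) - g s.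
    by rewrite /g (addrC s h) addrK subrr; field.
  rewrite E normrM (le_trans (ler_wpM2r (normr_ge0 _) (key c cs)))//.
  by rewrite -mulrA -expr2 real_normK ?num_real.
have [h0|h0] := leP 0 h.
  have sh : s <= s + h by lra.
  have [||c /[!in_itv]/= /andP[c1 c2] E] := @MVT_segment R g dg s (s + h) sh.
  - move=> x /[!in_itv]/= /andP[x1 x2]; apply: Dg.
    by move: hm2; rewrite !ger0_norm//; lra.
  - apply: derivable_within_continuous => x /[!in_itv]/= /andP[x1 x2].
    apply: ex_derive; apply: Dg.
    by move: hm2; rewrite !ger0_norm//; lra.
  exists c; last by rewrite E; ring.
  by rewrite !ger0_norm//; lra.
have sh : s + h <= s by lra.
have [||c /[!in_itv]/= /andP[c1 c2] E] := @MVT_segment R g dg (s + h) s sh.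
- move=> x /[!in_itv]/= /andP[x1 x2]; apply: Dg.
  by move: hm2; rewrite !ler0_norm//; lra.
- apply: derivable_within_continuous => x /[!in_itv]/= /andP[x1 x2].
  apply: ex_derive; apply: Dg.
  by move: hm2; rewrite !ler0_norm//; lra.
exists c; last by rewrite -opprB E; ring.
by rewrite !ler0_norm//; lra.
Qed.

Lemma jet1_expR a s :
  jet1 (fun x => expR (a * x)) s (a * expR (a * s)) (a ^+ 2 * expR (a * s)).
Proof.
have D (y : R) : is_derive y (1 : R) (fun x : R => expR (a * x)) (a * expR (a * y)).
  have L : is_derive y (1 : R) (fun x : R => a * x) a.
    by apply: is_derive_eq; rewrite /GRing.scale/= mulr1.
  have := @is_derive1_comp _ expR (fun x : R => a * x) y _ _ (is_derive_expR _) L.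
  by rewrite mulrC.
have D2 : is_derive s (1 : R) (fun x : R => a * expR (a * x)) (a ^+ 2 * expR (a * s)).
  by have Ds := D s; apply: is_derive_eq; rewrite /GRing.scale/= mulrA.
by apply: (jet1_derive ltr01 _ D2) => y _; exact: D.
Qed.

Lemma jet1_powR a s : 0 < s ->
  jet1 (fun x => x `^ a) s (a * s `^ (a - 1)) (a * (a - 1) * s `^ (a - 2)).
Proof.
move=> s0.
have D2 : is_derive s (1 : R) (fun x : R => a * x `^ (a - 1))
    (a * (a - 1) * s `^ (a - 2)).
  have Ds := is_derive1_powR (a - 1) s0; apply: is_derive_eq.
  rewrite /GRing.scale/= -mulrA; congr (_ * (_ * (_ `^ _))); lra.
apply: (jet1_derive s0 _ D2) => y ys; apply: is_derive1_powR.
by rewrite ltNge; apply/negP => y0; move: ys; rewrite ler0_norm; lra.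
Qed.

(** The cube is the least integer power whose positive part is twice differentiable at 0. In all
    four sign cases the remainder is at most [|h|^3], so [de := e] works. *)
Lemma jet1_cube_pos s : jet1 (fun x => Num.max x 0 ^+ 3) s
  (3 * Num.max s 0 ^+ 2) (6 * Num.max s 0).
Proof.
move=> e e0; exists e => // h he.
suff: `|Num.max (s + h) 0 ^+ 3 - Num.max s 0 ^+ 3 - 3 * Num.max s 0 ^+ 2 * h
        - 6 * Num.max s 0 * h ^+ 2 / 2| <= `|h| ^+ 3.
  by move/le_trans; apply; rewrite -(real_normK (num_real h)) exprS ler_wpM2r ?sqr_ge0.
have pow3 (x y : R) : 0 <= x -> x <= y -> x ^+ 3 <= y ^+ 3.
  by move=> x0 xy; rewrite lerXn2r ?nnegrE// (le_trans x0).
have [s0|s0] := leP s 0.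
  rewrite (expr0n _ 3)/= (expr0n _ 2)/= !mulr0 !mul0r !subr0.
  have [sh|sh] := leP (s + h) 0; first by rewrite expr0n/= normr0 exprn_ge0.
  rewrite (ger0_norm (exprn_ge0 _ (ltW sh))); apply: pow3; first exact: ltW.
  by rewrite (le_trans _ (ler_norm _))//; lra.
have [sh|sh] := leP (s + h) 0; last first.
  rewrite (_ : _ - _ = h ^+ 3); first by rewrite normrX.
  by field.
have h0 : h < 0 by lra.
rewrite (_ : _ - _ = h ^+ 3 - (s + h) ^+ 3); last by rewrite expr0n/=; field.
have -> : `|h| ^+ 3 = - h ^+ 3 by rewrite ltr0_norm//; ring.
rewrite ler0_norm ?subr_le0.
  have : 0 <= (- (s + h)) ^+ 3 by rewrite exprn_ge0//; lra.
  by rewrite exprNn; lra.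
rewrite -lerN2 -(_ : (- (s + h)) ^+ 3 = - (s + h) ^+ 3); last by ring.
rewrite -(_ : (- h) ^+ 3 = - h ^+ 3); last by ring.
by apply: pow3; lra.
Qed.

End OneVariable.
End Jets.

Section Jets.
Context {R : realType}.

Section Jet.
Context {n : nat}.
Implicit Types (f g : 'rV[R]_n -> R) (x p w : 'rV[R]_n) (X : 'M[R]_n).

Definition taylor_rem f x p X w :=
  f (x + w) - f x - dot p w - dot (w *m X) w / 2.

(** Symmetry is imposed because the expansion only determines the symmetric part of [X]. *)
Definition jet f x p X := X^T = X /\ o2 (taylor_rem f x p X).

Lemma jet_ext f g x p X : (forall y, f y = g y) -> jet f x p X -> jet g x p X.
Proof.
move=> fg [sX h]; split=> //; apply: o2_ext h => w.
by rewrite /taylor_rem !fg.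
Qed.

Lemma jet_affine a c x : jet (fun y => dot a y + c) x a 0.
Proof.
split; first by rewrite trmx0.
apply: o2_ext o2_0 => w; rewrite /taylor_rem mulmx0 dot0l dotDr; ring.
Qed.

Lemma jet_cst (c : R) x : jet (fun=> c) x 0 0.
Proof.
by apply: jet_ext (jet_affine 0 c x) => y; rewrite dot0l add0r.
Qed.

Lemma jetD f g x p q X Y : jet f x p X -> jet g x q Y ->
  jet (fun y => f y + g y) x (p + q) (X + Y).
Proof.
move=> [sX hf] [sY hg]; split; first by rewrite linearD/= sX sY.
apply: o2_ext (o2D hf hg) => w.
by rewrite /taylor_rem dotDl mulmxDr dotDl; ring.
Qed.

Lemma jetZ f (a : R) x p X : jet f x p X ->
  jet (fun y => a * f y) x (a *: p) (a *: X).
Proof.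
move=> [sX hf]; split; first by rewrite linearZ/= sX.
apply: o2_ext (o2Z a hf) => w.
by rewrite /taylor_rem dotZl -scalemxAr dotZl; ring.
Qed.

Lemma jet_quad (A : 'M[R]_n) x : A^T = A ->
  jet (fun y => dot (y *m A) y / 2) x (x *m A) A.
Proof.
move=> sA; split=> //; apply: o2_ext o2_0 => w.
rewrite /taylor_rem mulmxDl !(dotDl, dotDr) (dot_mulmx_sym w x sA).
by field.
Qed.

Lemma jet_lip f x p X : jet f x p X -> exists2 C : R, 0 < C &
  exists2 de : R, 0 < de & forall w, enorm w <= de ->
    `|f (x + w) - f x| <= C * enorm w /\
    `|f (x + w) - f x - dot p w| <= C * enorm w ^+ 2.
Proof.
move=> [_ h]; have [d0 d00 hd] := h _ ltr01.
have [C C0 hC] := quad_bounded X.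
exists (enorm p + C + 1); first by rewrite ltr_wpDl// addr_ge0 ?enorm_ge0// ltW.
exists (Num.min d0 1) => [|w]; first by rewrite lt_min d00/=.
rewrite le_min => /andP[wd w1].
have w0 := enorm_ge0 w; have p0 := enorm_ge0 p.
have H : `|f (x + w) - f x - dot p w| <= (C + 1) * enorm w ^+ 2.
  have := hd _ wd; rewrite /taylor_rem mul1r -sqr_enorm => h1.
  have := hC w; rewrite -sqr_enorm => h2.
  have -> : f (x + w) - f x - dot p w =
    (f (x + w) - f x - dot p w - dot (w *m X) w / 2) + dot (w *m X) w / 2 by ring.
  apply: le_trans (ler_normD _ _) _.
  rewrite mulrDl mul1r addrC lerD// normrM (_ : `|2^-1| = 2^-1); last first.
    by rewrite ger0_norm.
  by have := normr_ge0 (dot (w *m X) w); lra.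
split; last first.
  apply: le_trans H _; rewrite ler_wpM2r ?sqr_ge0//; lra.
have -> : f (x + w) - f x = (f (x + w) - f x - dot p w) + dot p w by ring.
apply: le_trans (ler_normD _ _) _; apply: le_trans (lerD H (dot_le_enorm _ _)) _.
have h4 : enorm w ^+ 2 <= enorm w by rewrite expr2 ler_piMr.
have C1 : 0 <= C + 1 by lra.
have := ler_wpM2l C1 h4; lra.
Qed.

Lemma jet_comp f x p X (g : R -> R) (g1 g2 : R) :
  jet f x p X -> jet1 g (f x) g1 g2 ->
  jet (fun y => g (f y)) x (g1 *: p) (g1 *: X + g2 *: (p^T *m p)).
Proof.
move=> jf jg; have [C C0 [d0 d00 hC]] := jet_lip jf.
have [sX hf] := jf; split.
  by rewrite linearD/= !linearZ/= trmx_mul trmxK sX.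
pose D w := f (x + w) - f x.
have Q w : dot (w *m (g1 *: X + g2 *: (p^T *m p))) w =
    g1 * dot (w *m X) w + g2 * (dot p w) ^+ 2.
  rewrite mulmxDr -!scalemxAr dotDl !dotZl; congr (_ + _ * _).
  rewrite mulmxA [w *m p^T]mx11_scalar mul_scalar_mx dotZl -dotE.
  by rewrite (dotC w p) expr2.
(* Three errors: the remainder of [f]; the replacement of [D^2] by [(p . w)^2], which is cubic in
   [w]; and the remainder of [g], which is small against [D^2 <= C^2 |w|^2]. *)
apply: (@o2_ext _ _ (fun w => g1 * taylor_rem f x p X w +
   (g2 / 2 * ((D w) ^+ 2 - (dot p w) ^+ 2) +
   (g (f x + D w) - g (f x) - g1 * D w - g2 * D w ^+ 2 / 2)))).
  move=> w; rewrite (_ : f x + D w = f (x + w)); last by rewrite /D addrC subrK.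
  by rewrite /taylor_rem Q dotZl /D; field.
apply: o2D; first exact: o2Z.
apply: o2D.
  apply: o2Z; apply: (@o2_cube _ _ _ (C * (C + enorm p)) d0) => // w /hC[h1 h2].
  have h3 : `|D w + dot p w| <= (C + enorm p) * enorm w.
    rewrite mulrDl (le_trans (ler_normD _ _))// lerD//; exact: dot_le_enorm.
  have -> : C * (C + enorm p) * enorm w ^+ 3 =
    (C * enorm w ^+ 2) * ((C + enorm p) * enorm w) by ring.
  by rewrite subr_sqr normrM ler_pM.
move=> e e0; have e1 : 0 < e / C ^+ 2 by rewrite divr_gt0// exprn_gt0.
have [d1 d10 h1] := jg _ e1.
exists (Num.min d0 (d1 / C)) => [|w]; first by rewrite lt_min d00 divr_gt0.
rewrite le_min => /andP[/hC[h2 _] wd].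
have h3 : `|D w| <= d1.
  by apply: le_trans h2 _; rewrite mulrC -ler_pdivlMr.
apply: le_trans (h1 _ h3) _.
rewrite mulrAC ler_pdivrMr ?exprn_gt0// -mulrA ler_pM2l// -sqr_enorm -exprMn.
rewrite -real_normK ?num_real// ler_sqr ?nnegrE ?mulr_ge0 ?enorm_ge0 ?(ltW C0)//.
by rewrite mulrC.
Qed.

(* [f g = ((f + g)^2 - (f - g)^2) / 4] reduces products to compositions. *)
Lemma jetM f g x p q X Y : jet f x p X -> jet g x q Y ->
  jet (fun y => f y * g y) x (g x *: p + f x *: q)
    (g x *: X + f x *: Y + (p^T *m q + q^T *m p)).
Proof.
move=> hf hg.
have h1 := jet_comp (jetD hf hg) (jet1_sqr _).
have h2 := jet_comp (jetD hf (jetZ (-1) hg)) (jet1_sqr _).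
have := jetZ (4^-1) (jetD h1 (jetZ (-1) h2)).
have -> : 4^-1 *: (2 * (f x + g x) *: (p + q) +
    -1 *: (2 * (f x + -1 * g x) *: (p + -1 *: q))) = g x *: p + f x *: q.
  by apply/rowP => i; rewrite !mxE; field.
have -> : 4^-1 *: (2 * (f x + g x) *: (X + Y) + 2 *: ((p + q)^T *m (p + q)) +
   -1 *: (2 * (f x + -1 * g x) *: (X + -1 *: Y) +
     2 *: ((p + -1 *: q)^T *m (p + -1 *: q)))) =
   g x *: X + f x *: Y + (p^T *m q + q^T *m p).
  apply/matrixP => i j; rewrite !mxE !big_ord1 !mxE; by field.
by apply: jet_ext => y; field.
Qed.

End Jet.
End Jets.

(** * Functions with constant Laplacian and prescribed values on spheres *)

Section Harmonic.
Context {R : realType} {n : nat}.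
Implicit Types (f h : 'rV[R]_n -> R) (x a : 'rV[R]_n).

(** The Laplacian is read off a pointwise expansion, which is all that touching from above uses. *)
Definition has_laplacian h f :=
  forall x, exists p X, jet h x p X /\ \tr X = f x.

Lemma has_laplacian_ext h h' f f' : (forall x, h x = h' x) ->
  (forall x, f x = f' x) -> has_laplacian h f -> has_laplacian h' f'.
Proof.
move=> e e' H x; have [p [X [j t]]] := H x.
by exists p, X; rewrite -e'; split=> //; apply: jet_ext j.
Qed.

Lemma has_laplacianD h h' f f' : has_laplacian h f -> has_laplacian h' f' ->
  has_laplacian (fun x => h x + h' x) (fun x => f x + f' x).
Proof.
move=> H H' x; have [p [X [j t]]] := H x; have [q [Y [j' t']]] := H' x.
by exists (p + q), (X + Y); rewrite linearD/= t t'; split=> //; apply: jetD.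
Qed.

Lemma has_laplacianZ (c : R) h f : has_laplacian h f ->
  has_laplacian (fun x => c * h x) (fun x => c * f x).
Proof.
move=> H x; have [p [X [j t]]] := H x.
by exists (c *: p), (c *: X); rewrite linearZ/= t; split=> //; apply: jetZ.
Qed.

Lemma has_laplacian_cst (c : R) : has_laplacian (fun=> c) (fun=> 0).
Proof. by move=> x; exists 0, 0; rewrite mxtrace0; split=> //; exact: jet_cst. Qed.

Lemma has_laplacian_sum (I : Type) (s : seq I) (F G : I -> 'rV[R]_n -> R) :
  (forall i, has_laplacian (F i) (G i)) ->
  has_laplacian (fun x => \sum_(i <- s) F i x) (fun x => \sum_(i <- s) G i x).
Proof.
move=> H; elim: s => [|i s IH].
  apply: has_laplacian_ext (has_laplacian_cst 0) => x; by rewrite big_nil.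
by apply: has_laplacian_ext (has_laplacianD (H i) IH) => x; rewrite big_cons.
Qed.

Lemma trace_outer (p q : 'rV[R]_n) : \tr (p^T *m q) = dot q p.
Proof. by rewrite mxtrace_mulC trace_mx11 dotE. Qed.

Lemma jet1_exprn m (s : R) :
  jet1 (fun y : R => y ^+ m) s (m%:R * s ^+ m.-1) (m%:R * (m.-1%:R * s ^+ m.-2)).
Proof.
have D (k : nat) (y : R) : is_derive y (1 : R) (fun x : R => x ^+ k) (k%:R * y ^+ k.-1).
  apply: DeriveDef; first exact: exprn_derivable.
  by rewrite exp_derive /GRing.scale/= mulr1.
have D2 : is_derive s (1 : R) (fun x : R => m%:R * x ^+ m.-1)
    (m%:R * (m.-1%:R * s ^+ m.-2)).
  by have Ds := D m.-1 s; apply: is_derive_eq.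
by apply: (jet1_derive ltr01 _ D2) => y _; exact: D.
Qed.

Lemma jet_sqnorm x : jet (fun y => dot y y) x (2 *: x) 2%:M.
Proof.
have := jet_quad x (tr_scalar_mx n 2); rewrite mul_mx_scalar.
by apply: jet_ext => y; rewrite mul_mx_scalar dotZl mulrAC divff ?mul1r.
Qed.

(** The family is stable under the Laplacian: [2j (n + 2j - 2)] comes from [|x|^(2j)], the extra
    [4jm] from the cross term of the two gradients. *)
Lemma laplacian_monomial a j m :
  has_laplacian (fun x => dot x x ^+ j * dot a x ^+ m)
    (fun x => 2 * j%:R * (n%:R + 2 * j%:R - 2 + 2 * m%:R) *
                (dot x x ^+ j.-1 * dot a x ^+ m) +
              m%:R * m.-1%:R * dot a a * (dot x x ^+ j * dot a x ^+ m.-2)).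
Proof.
move=> x.
have h1 := jet_comp (jet_sqnorm x) (jet1_exprn j _).
have jl : jet (dot a) x a 0.
  by apply: jet_ext (jet_affine a 0 x) => y; rewrite addr0.
have h2 := jet_comp jl (jet1_exprn m _).
do 2 eexists; split; first exact: (jetM h1 h2).
rewrite !(mxtraceD, mxtraceZ, trace_outer, mxtrace0, mxtrace_scalar, dotZl, dotZr).
rewrite (dotC x a); set s := dot x x; set l := dot a x.
(* Exponents truncated by [.-1] and [.-2] do no harm: their coefficients vanish exactly in those
   cases. *)
have E1 : j%:R * (j.-1%:R * s ^+ j.-2) * s = j%:R * (j%:R - 1) * s ^+ j.-1.
  case: (j) => [|[|k]]; rewrite ?mul0r ?subrr ?mulr0 ?mul0r//=.
  have -> : k.+2%:R - 1 = k.+1%:R :> R by rewrite -natr1 addrK.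
  by rewrite exprSr !mulrA.
have E2 : m%:R * l ^+ m.-1 * l = m%:R * l ^+ m.
  by case: (m) => [|k]; rewrite ?mul0r//= -mulrA -exprSr.
rewrite -(mulr_natr _ n).
rewrite [LHS](_ : _ = 2 * n%:R * j%:R * s ^+ j.-1 * l ^+ m
    + 4 * l ^+ m * (j%:R * (j.-1%:R * s ^+ j.-2) * s)
    + 4 * (j%:R * s ^+ j.-1) * (m%:R * l ^+ m.-1 * l)
    + m%:R * m.-1%:R * dot a a * (s ^+ j * l ^+ m.-2)); last by ring.
by rewrite E1 E2; ring.
Qed.

(* Coefficients of the zonal harmonic [\sum_j c_j |x|^(2j) (a . x)^(m - 2j)]:
   the recursion cancels its Laplacian term by term. *)
Fixpoint zonal_coef a m j : R :=
  if j is j'.+1 then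
    - zonal_coef a m j' * ((m - j'.*2)%:R * (m - j'.*2).-1%:R * dot a a) /
      (2 * j'.+1%:R * (n%:R + 2 * j'.+1%:R - 2 + 2 * (m - j'.+1.*2)%:R))
  else 1.

Lemma zonal_harmonic a m : (0 < n)%N ->
  has_laplacian (fun x => \sum_(j < m./2.+1)
    zonal_coef a m j * (dot x x ^+ j * dot a x ^+ (m - j.*2))) (fun=> 0).
Proof.
move=> n0.
pose A j : R := 2 * j%:R * (n%:R + 2 * j%:R - 2 + 2 * (m - j.*2)%:R).
pose B j : R := (m - j.*2)%:R * (m - j.*2).-1%:R * dot a a.
pose c := zonal_coef a m.
have H := @has_laplacian_sum _ (index_enum 'I_m./2.+1) _ _
  (fun j => has_laplacianZ (c j) (laplacian_monomial a j (m - j.*2))).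
apply: has_laplacian_ext H => // x.
set s := dot x x; set l := dot a x.
rewrite [LHS](_ : _ = \sum_(j < m./2.+1) (c j * A j * (s ^+ j.-1 * l ^+ (m - j.*2)))
    + \sum_(j < m./2.+1) (c j * B j * (s ^+ j * l ^+ (m - j.*2).-2))); last first.
  by rewrite -big_split; apply: eq_bigr => j _; rewrite /A /B /=; ring.
(* After a shift of index the sums cancel term by term. The two ends vanish: [A 0] has the factor 0,
   and at [j = m./2] the exponent [m - 2j] is 0 or 1. *)
rewrite big_ord_recl [X in _ + X]big_ord_recr /= /A /B mulr0 mul0r mulr0 mul0r add0r.
have -> : (m - m./2.*2)%:R * (m - m./2.*2).-1%:R = 0 :> R.
  rewrite -{1 3}(odd_double_half m) addnK; case: (odd m); by rewrite ?mulr0 ?mul0r.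
rewrite mul0r mulr0 mul0r addr0 -big_split big1// => j _ /=.
rewrite /bump/= add1n (_ : (m - j.+1.*2)%N = (m - j.*2).-2); last first.
  by rewrite doubleS -!subn1 -!subnDA; congr (_ - _)%N; rewrite !addnA !addn1.
have D0 : 2 * j.+1%:R * (n%:R + 2 * j.+1%:R - 2 + 2 * (m - j.*2).-2%:R) != 0 :> R.
  rewrite lt0r_neq0// mulr_gt0//.
  have : 1 <= n%:R :> R by rewrite ler1n.
  have : 1 <= j.+1%:R :> R by rewrite ler1n.
  have : 0 <= (m - j.*2).-2%:R :> R by [].
  lra.
rewrite -mulrDl {1}/c /=.
rewrite (_ : (m - (j.*2).+2)%N = (m - j.*2).-2); last first.
  by rewrite -!subn1 -!subnDA; congr (_ - _)%N; rewrite !addnA !addn1.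
by rewrite divfK// mulNr addNr mul0r.
Qed.

(** On the sphere the zonal harmonic is [(a . x)^m] plus lower powers with coefficients
    [c_j rho^(2j)]; by induction these have harmonic extensions, which are subtracted. *)
Lemma harmonic_ridge_power a m (rho : R) : (0 < n)%N ->
  exists h, has_laplacian h (fun=> 0) /\
    forall x, dot x x = rho ^+ 2 -> h x = dot a x ^+ m.
Proof.
move=> n0; elim/ltn_ind: m => m IH.
(* Made vacuous for [j >= m./2], so that [choice] applies over all of [nat]. *)
have H (j : nat) : exists h, has_laplacian h (fun=> 0) /\ ((j < m./2)%N ->
    forall x, dot x x = rho ^+ 2 -> h x = dot a x ^+ (m - j.+1.*2)).
  have [jm|jm] := boolP (j < m./2)%N; last first.
    by exists (fun=> 0); split=> //; exact: has_laplacian_cst.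
  have [|h [h1 h2]] := IH (m - j.+1.*2)%N; last by exists h.
  have : (j.+1.*2 <= m)%N by rewrite -[m]odd_double_half (leq_trans _ (leq_addl _ _))// leq_double.
  by rewrite doubleS => jm2; rewrite ltn_subrL/= (leq_trans _ jm2).
have [hf hfP] := choice H.
pose c := zonal_coef a m.
exists (fun x => \sum_(j < m./2.+1)
    c j * (dot x x ^+ j * dot a x ^+ (m - j.*2)) +
  \sum_(j < m./2) (- (c j.+1 * (rho ^+ 2) ^+ j.+1)) * hf j x).
split=> [|x xr].
  have H1 := @has_laplacian_sum _ (index_enum 'I_m./2) _ _
    (fun j => has_laplacianZ (- (c j.+1 * (rho ^+ 2) ^+ j.+1)) (proj1 (hfP j))).
  apply: has_laplacian_ext (has_laplacianD (zonal_harmonic a m n0) H1) => // x.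
  by rewrite add0r big1// => j _; rewrite mulr0.
rewrite big_ord_recl/= expr0 !mul1r subn0 -addrA -big_split/= big1 ?addr0// => j _.
rewrite (proj2 (hfP j) (ltn_ord j) x xr) xr /bump/= add1n.
by ring.
Qed.

Lemma harmonic_ridge_poly a (q : {poly R}) (rho : R) : (0 < n)%N ->
  exists h, has_laplacian h (fun=> 0) /\
    forall x, dot x x = rho ^+ 2 -> h x = q.[dot a x].
Proof.
move=> n0; have [hf hfP] := choice (fun m => harmonic_ridge_power a m rho n0).
exists (fun x => \sum_(i < size q) q`_i * hf i x); split=> [|x xr].
  have H := @has_laplacian_sum _ (index_enum 'I_(size q)) _ _
    (fun i => has_laplacianZ q`_i (proj1 (hfP i))).
  by apply: has_laplacian_ext H => // x; rewrite big1// => i _; rewrite mulr0.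
rewrite horner_coef; apply: eq_bigr => i _.
by rewrite (proj2 (hfP i) x xr).
Qed.

End Harmonic.

(** * Bernstein approximation of Lipschitz functions on [0, 1] *)

Section Bernstein.
Context {R : realType}.

(* The Bernstein basis, through its recurrence rather than its closed form. *)
Fixpoint bern (N k : nat) : {poly R} :=
  if N is N'.+1 then
    'X * (if k is k'.+1 then bern N' k' else 0) + (1 - 'X) * bern N' k
  else (k == 0%N)%:R.

Lemma bern_gt N k : (N < k)%N -> bern N k = 0.
Proof.
elim: N k => [|N IH] [|k]//= Nk.
by rewrite !IH ?mulr0 ?addr0// ltnW.
Qed.

Lemma bernS N (y : R) (f : nat -> R) :
  \sum_(k < N.+2) (bern N.+1 k).[y] * f k =
  y * \sum_(k < N.+1) (bern N k).[y] * f k.+1 +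
  (1 - y) * \sum_(k < N.+1) (bern N k).[y] * f k.
Proof.
transitivity (\sum_(k < N.+2) (y * (if (k : nat) is k'.+1 then bern N k' else 0 : {poly R}).[y] * f k
    + (1 - y) * ((bern N k).[y] * f k))).
  apply: eq_bigr => k _; by rewrite /= !hornerE /= mulrDl.
rewrite big_split/=; congr (_ + _).
  rewrite big_ord_recl/= horner0 mulr0 mul0r add0r mulr_sumr.
  by apply: eq_bigr => k _; rewrite mulrA.
rewrite -mulr_sumr big_ord_recr/= bern_gt// horner0 mul0r addr0.
by [].
Qed.

Lemma bern_ge0 N k (y : R) : 0 <= y <= 1 -> 0 <= (bern N k).[y].
Proof.
move=> /andP[y0 y1]; elim: N k => [|N IH] [|k] /=; rewrite ?hornerE//.
  by rewrite mulr_ge0// ?IH//; lra.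
by rewrite addr_ge0// mulr_ge0// ?IH//; lra.
Qed.

Lemma bern_sum N (y : R) : \sum_(k < N.+1) (bern N k).[y] = 1.
Proof.
elim: N => [|N IH]; first by rewrite big_ord1/= hornerE.
have := bernS N y (fun=> 1); under eq_bigr do rewrite mulr1.
by move=> ->; under eq_bigr do rewrite mulr1; rewrite IH; ring.
Qed.

(** The centre is free because the recurrence shifts it to [c - 1]; [c := N y] gives the variance of
    the binomial law. *)
Lemma bern_var N (y c : R) :
  \sum_(k < N.+1) (bern N k).[y] * (k%:R - c) ^+ 2 =
  N%:R * (y * (1 - y)) + (N%:R * y - c) ^+ 2.
Proof.
elim: N c => [|N IH] c.
  by rewrite big_ord1/= -polyC1 hornerC; ring.
rewrite (bernS N y (fun k => (k%:R - c) ^+ 2)) IH.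
rewrite (eq_bigr (fun k : 'I_N.+1 => (bern N k).[y] * (k%:R - (c - 1)) ^+ 2)).
  by rewrite IH -natr1; ring.
by move=> k _; rewrite -natr1; congr (_ * _ ^+ 2); ring.
Qed.

Lemma bern_var_le N (y : R) : (0 < N)%N -> 0 <= y <= 1 ->
  \sum_(k < N.+1) (bern N k).[y] * (y - k%:R / N%:R) ^+ 2 <= N%:R^-1.
Proof.
move=> N0 /andP[y0 y1]; have N0' : 0 < N%:R :> R by rewrite ltr0n.
rewrite (eq_bigr (fun k : 'I_N.+1 => (N%:R^-1) ^+ 2 *
   ((bern N k).[y] * (k%:R - N%:R * y) ^+ 2))); last first.
  by move=> k _; field; rewrite gt_eqF.
rewrite -mulr_sumr bern_var subrr expr0n/= addr0.
rewrite expr2 -mulrA ler_piMr ?invr_ge0 ?(ltW N0')// mulKf ?gt_eqF//.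
by apply: le_trans (_ : y * 1 <= _); [rewrite ler_wpM2l//; lra|lra].
Qed.

(** Chebyshev's argument for abstract weights, with [d] a squared distance of small mean; it serves
    in one variable and in several. *)
Lemma weighted_mean_approx (I : finType) (w F d : I -> R) (f e C V : R) :
  (forall i, 0 <= w i) -> \sum_i w i = 1 -> 0 <= C ->
  (forall i, `|f - F i| <= e + C * d i) -> \sum_i w i * d i <= V ->
  `|f - \sum_i w i * F i| <= e + C * V.
Proof.
move=> w0 w1 C0 h hV.
have -> : f - \sum_i w i * F i = \sum_i w i * (f - F i).
  by under [RHS]eq_bigr do rewrite mulrBr; rewrite sumrB -mulr_suml w1 mul1r.
apply: le_trans (ler_norm_sum _ _ _) _.
apply: (@le_trans _ _ (\sum_i w i * (e + C * d i))).
  by apply: ler_sum => i _; rewrite normrM (ger0_norm (w0 i)) ler_wpM2l.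
under eq_bigr do rewrite mulrDr mulrCA.
by rewrite big_split/= -mulr_suml w1 mul1r -mulr_sumr lerD2l ler_wpM2l.
Qed.

Lemma expR_lip (M a b : R) : a <= M -> b <= M ->
  `|expR a - expR b| <= expR M * `|a - b|.
Proof.
wlog ba : a b / b <= a => [H aM bM|aM bM].
  have [/H->//|/ltW /H h] := leP b a.
  by rewrite distrC (distrC a) h.
rewrite !ger0_norm ?subr_ge0 ?ler_expR//.
have := expR_ge1Dx (b - a); rewrite expRB ler_pdivlMr ?expR_gt0// => h.
apply: (@le_trans _ _ (expR a * (a - b))); first lra.
by rewrite ler_wpM2r ?subr_ge0 ?ler_expR.
Qed.

Lemma ln_lip (m u v : R) : 0 < m -> m <= u -> m <= v ->
  `|ln u - ln v| <= `|u - v| / m.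
Proof.
move=> m0; wlog vu : u v / v <= u => [H mu mv|mu mv].
  have [/H->//|/ltW /H h] := leP v u.
  by rewrite distrC (distrC u) h.
have v0 : 0 < v by lra.
have u0 : 0 < u by lra.
rewrite !ger0_norm ?subr_ge0 ?ler_ln ?posrE//.
rewrite -ln_div ?posrE// ler_pdivlMr//.
have uv0 : 0 < u / v by rewrite divr_gt0.
have h : ln (u / v) <= u / v - 1.
  have E : 1 + (u / v - 1) = u / v by ring.
  by rewrite -{1}E le_ln1Dx//; lra.
have -> : u - v = (u / v - 1) * v by field; rewrite gt_eqF.
rewrite ler_pM ?(ltW m0)// ln_ge0// ler_pdivlMr ?mul1r//.
Qed.

Lemma bern_approx (g : R -> R) (L e : R) : 0 < L -> 0 < e ->
  (forall y z, 0 <= y <= 1 -> 0 <= z <= 1 -> `|g y - g z| <= L * `|y - z|) ->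
  exists q : {poly R}, forall y, 0 <= y <= 1 -> `|g y - q.[y]| <= e.
Proof.
(* Young's inequality [L t <= e/2 + C t^2] turns the Lipschitz bound into a variance bound; [N] then
   makes [C / N <= e/2]. *)
move=> L0 e0 hg; pose C := L ^+ 2 / (2 * e).
have C0 : 0 < C by rewrite divr_gt0 ?exprn_gt0//; lra.
pose N := (Num.Def.trunc (C / (e / 2))).+1.
exists (\sum_(k < N.+1) g (k%:R / N%:R) *: bern N k) => y y01.
have -> : (\sum_(k < N.+1) g (k%:R / N%:R) *: bern N k).[y] =
    \sum_(k < N.+1) (bern N k).[y] * g (k%:R / N%:R).
  by rewrite horner_sum; apply: eq_bigr => k _; rewrite hornerZ mulrC.
have N0 : 0 < N%:R :> R by rewrite ltr0n.
have CN : C * N%:R^-1 <= e / 2.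
  rewrite ler_pdivrMr// mulrC -ler_pdivrMr; last lra.
  exact: ltW (Num.Theory.truncnS_gt _).
have -> : e = e / 2 + e / 2 by lra.
apply: le_trans (_ : e / 2 + C * N%:R^-1 <= _); last by rewrite lerD2l.
apply: (@weighted_mean_approx _ _ _ (fun k : 'I_N.+1 => (y - k%:R / N%:R) ^+ 2)).
- by move=> i; exact: bern_ge0.
- exact: bern_sum.
- exact: ltW.
- move=> i; have i01 : 0 <= (i%:R / N%:R : R) <= 1.
    by rewrite divr_ge0//= ler_pdivrMr// mul1r ler_nat -ltnS ltn_ord.
  apply: le_trans (hg _ _ y01 i01) _; rewrite -[_ ^+ 2]real_normK ?num_real//.
  set t := `|_|; rewrite -subr_ge0.
  have -> : e / 2 + C * t ^+ 2 - L * t = (e - L * t) ^+ 2 / (2 * e).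
    by rewrite /C; field; rewrite gt_eqF.
  by rewrite divr_ge0 ?sqr_ge0//; lra.
- exact: bern_var_le.
Qed.

End Bernstein.

(** * Approximate Dirichlet problem on a sphere *)

Section Dirichlet.
Context {R : realType} {n : nat}.
Implicit Types (f h : 'rV[R]_n -> R) (x y a : 'rV[R]_n) (rho : R).

Lemma dot_deltal x i : dot (delta_mx 0 i) x = x 0 i.
Proof.
rewrite /dot (bigD1 i)//= big1 => [|j ji]; rewrite !mxE eqxx.
  by rewrite eqxx mul1r addr0.
by rewrite (negbTE ji) mul0r.
Qed.

Definition harmonic_approx rho f := forall e : R, 0 < e ->
  exists h, has_laplacian h (fun=> 0) /\
    forall x, dot x x = rho ^+ 2 -> `|h x - f x| <= e.

Lemma harmonic_approxD rho f g :
  harmonic_approx rho f -> harmonic_approx rho g ->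
  harmonic_approx rho (fun x => f x + g x).
Proof.
move=> hf hg e e0; have e20 : 0 < e / 2 by lra.
have [h1 [l1 H1]] := hf _ e20; have [h2 [l2 H2]] := hg _ e20.
exists (fun x => h1 x + h2 x); split=> [|x xr].
  by apply: has_laplacian_ext (has_laplacianD l1 l2) => // x; rewrite addr0.
rewrite (_ : _ - _ = (h1 x - f x) + (h2 x - g x)); last by ring.
rewrite (le_trans (ler_normD _ _))// (splitr e) lerD ?H1 ?H2//.
Qed.

Lemma harmonic_approxZ (c : R) rho f :
  harmonic_approx rho f -> harmonic_approx rho (fun x => c * f x).
Proof.
move=> hf e e0; have c0 : 0 < `|c| + 1 by rewrite ltr_wpDl.
have [h1 [l1 H1]] := hf _ (divr_gt0 e0 c0).
exists (fun x => c * h1 x); split=> [|x xr].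
  by apply: has_laplacian_ext (has_laplacianZ c l1) => // x; rewrite mulr0.
rewrite -mulrBr normrM; apply: (@le_trans _ _ ((`|c| + 1) * (e / (`|c| + 1)))).
  by rewrite ler_pM ?H1// lerDl.
by rewrite mulrC divfK// gt_eqF.
Qed.

(** An exponential is a function of [a . x] alone, hence a limit of polynomials in [a . x] on
    [[-L, L]]. The [+ 1] in [L] keeps the rescaling to [0, 1] defined when [a = 0]. *)
Lemma harmonic_approx_exp rho a : (0 < n)%N -> 0 < rho ->
  harmonic_approx rho (fun x => expR (dot a x)).
Proof.
move=> n0 r0 e e0; pose L := enorm a * rho + 1.
have L0 : 0 < L by rewrite ltr_wpDl// mulr_ge0 ?enorm_ge0 ?ltW.
have LL0 : 0 < expR L * (2 * L) by rewrite mulr_gt0 ?expR_gt0//; lra.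
have [|q hq] := @bern_approx R (fun y : R => expR (L * (2 * y - 1))) _ _ LL0 e0.
  move=> y z /andP[y0 y1] /andP[z0 z1].
  apply: le_trans (@expR_lip R L _ _ _ _) _.
  - by rewrite ger_pMr//; lra.
  - by rewrite ger_pMr//; lra.
  rewrite -mulrBr (_ : 2 * y - 1 - (2 * z - 1) = 2 * (y - z)); last by ring.
  by rewrite !normrM (ger0_norm (ltW L0)) ger0_norm//; lra.
have [h [l H]] := harmonic_ridge_poly a
  (q \Po ((2 * L)^-1 *: 'X + (2^-1)%:P)) rho n0.
exists h; split=> // x xr; rewrite H// distrC horner_comp !hornerE.
have xl : `|dot a x| <= L.
  apply: le_trans (dot_le_enorm _ _) _.
  by rewrite {2}/enorm xr sqrtr_sqr (ger0_norm (ltW r0)) /L lerDl.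
move: xl; rewrite ler_norml => /andP[x1 x2].
have E : dot a x = L * (2 * ((2 * L)^-1 * dot a x + 2^-1) - 1).
  by field; rewrite gt_eqF.
rewrite {1}E; apply: hq.
have -> : (2 * L)^-1 * dot a x + 2^-1 = (dot a x + L) / (2 * L).
  by field; rewrite gt_eqF.
rewrite divr_ge0 ?ler_pdivrMr /=; lra.
Qed.

(** Harmonic approximation is linear but not multiplicative. Exponentials bridge the gap: the
    product of two of them is again a function of a single linear form, so this algebra contains all
    polynomials in the [exp (x i)]. *)
Definition exp_sum f := exists s : seq (R * 'rV[R]_n),
  forall x, f x = \sum_(p <- s) p.1 * expR (dot p.2 x).

Lemma exp_sum_ext f g : (forall x, f x = g x) -> exp_sum f -> exp_sum g.
Proof. by move=> fg [s h]; exists s => x; rewrite -fg. Qed.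

Lemma exp_sum1 (c : R) a : exp_sum (fun x => c * expR (dot a x)).
Proof. by exists [:: (c, a)] => x; rewrite big_seq1. Qed.

Lemma exp_sum_cst (c : R) : exp_sum (fun=> c).
Proof.
by apply: exp_sum_ext (exp_sum1 c 0) => x; rewrite dot0l expR0 mulr1.
Qed.

Lemma exp_sumD f g : exp_sum f -> exp_sum g -> exp_sum (fun x => f x + g x).
Proof. by move=> [s hs] [t ht]; exists (s ++ t) => x; rewrite big_cat hs ht. Qed.

Lemma exp_sumM f g : exp_sum f -> exp_sum g -> exp_sum (fun x => f x * g x).
Proof.
move=> [s hs] [t ht].
exists [seq (p.1 * q.1, p.2 + q.2) | p <- s, q <- t] => x.
rewrite hs ht big_allpairs_dep mulr_suml; apply: eq_bigr => p _.
rewrite mulr_sumr; apply: eq_bigr => q _ /=.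
by rewrite dotDl expRD; ring.
Qed.

Lemma exp_sum_sum (I : Type) (s : seq I) (F : I -> 'rV[R]_n -> R) :
  (forall i, exp_sum (F i)) -> exp_sum (fun x => \sum_(i <- s) F i x).
Proof.
move=> h; elim: s => [|i s IH].
  by apply: exp_sum_ext (exp_sum_cst 0) => x; rewrite big_nil.
by apply: exp_sum_ext (exp_sumD (h i) IH) => x; rewrite big_cons.
Qed.

Lemma exp_sum_prod (I : Type) (s : seq I) (F : I -> 'rV[R]_n -> R) :
  (forall i, exp_sum (F i)) -> exp_sum (fun x => \prod_(i <- s) F i x).
Proof.
move=> h; elim: s => [|i s IH].
  by apply: exp_sum_ext (exp_sum_cst 1) => x; rewrite big_nil.
by apply: exp_sum_ext (exp_sumM (h i) IH) => x; rewrite big_cons.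
Qed.

Lemma exp_sum_horner (q : {poly R}) f : exp_sum f ->
  exp_sum (fun x => q.[f x]).
Proof.
move=> hf; elim/poly_ind: q => [|q c IH].
  by apply: exp_sum_ext (exp_sum_cst 0) => x; rewrite horner0.
apply: exp_sum_ext (exp_sumD (exp_sumM IH hf) (exp_sum_cst c)) => x.
by rewrite hornerMXaddC.
Qed.

Lemma harmonic_approx_exp_sum rho f : (0 < n)%N -> 0 < rho -> exp_sum f ->
  harmonic_approx rho f.
Proof.
move=> n0 r0 [s hs].
suff H : harmonic_approx rho (fun x => \sum_(p <- s) p.1 * expR (dot p.2 x)).
  by move=> e /H[h [l h2]]; exists h; split=> // x; rewrite hs; exact: h2.
elim: s {hs} => [|p s IH].
  move=> e e0; exists (fun=> 0); split; first exact: has_laplacian_cst.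
  by move=> x _; rewrite big_nil subrr normr0 ltW.
move=> e e0; have [h [l H]] := harmonic_approxD
  (harmonic_approxZ p.1 (harmonic_approx_exp p.2 n0 r0)) IH e0.
by exists h; split=> // x xr; rewrite big_cons H.
Qed.

(* Bernstein approximation in the variables [exp (x i - rho)]. *)
Lemma exp_sum_dense rho (L e : R) f : 0 < rho -> 0 < L -> 0 < e ->
  (forall x y, (forall i, `|x 0 i| <= rho) -> (forall i, `|y 0 i| <= rho) ->
     `|f x - f y| <= L * enorm (x - y)) ->
  exists2 g, exp_sum g &
    forall x, (forall i, `|x 0 i| <= rho) -> `|f x - g x| <= e.
Proof.
move=> r0 L0 e0 hf.
(* On the cube [exp (x i - rho)] ranges over [[1/K, 1]], where [ln] has Lipschitz constant [K];
   hence the factor [K^2] in [C]. *)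
pose K := expR (2 * rho); have K0 : 0 < K := expR_gt0 _.
pose C := L ^+ 2 / e * K ^+ 2.
have C0 : 0 < C by rewrite mulr_gt0 ?divr_gt0 ?exprn_gt0.
pose N := (Num.Def.trunc (C * n%:R / (e / 2))).+1.
have N0 : 0 < N%:R :> R by rewrite ltr0n.
have CN : C * (n%:R / N%:R) <= e / 2.
  rewrite mulrA ler_pdivrMr// [e / 2 * _]mulrC -ler_pdivrMr; last lra.
  exact: ltW (Num.Theory.truncnS_gt _).
pose A := {ffun 'I_n -> 'I_N.+1}.
(* Nodes below [1/K] are moved up to [1/K]: their logarithm then gives a point of the cube, and they
   only get closer to [yc x i]. *)
pose m (k : 'I_N.+1) : R := Num.max (k%:R / N%:R) (K^-1).
pose nu (al : A) : 'rV[R]_n := \row_i (rho + ln (m (al i))).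
pose yc (x : 'rV[R]_n) (i : 'I_n) : R := expR (x 0 i - rho).
pose w x (al : A) := \prod_i (bern N (al i)).[yc x i].
exists (fun x : 'rV[R]_n => \sum_al w x al * f (nu al)).
  apply: exp_sum_sum => al; apply: exp_sumM (exp_sum_cst _).
  apply: exp_sum_prod => i; apply: exp_sum_horner.
  apply: exp_sum_ext (exp_sum1 (expR (- rho)) (delta_mx 0 i)) => x.
  rewrite /yc addrC expRD; congr (_ * expR _).
  by rewrite dot_deltal.
move=> x xr.
have y1 i : K^-1 <= yc x i <= 1.
  have := xr i; rewrite ler_norml => /andP[x1 x2].
  by rewrite -expR0 -expRN /yc !ler_expR; lra.
have y01 i : 0 <= yc x i <= 1.
  by have /andP[h ->] := y1 i; rewrite (le_trans _ h)// invr_ge0 ltW.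
have m1 k : K^-1 <= m k <= 1.
  rewrite le_max lexx orbT ge_max ler_pdivrMr// mul1r ler_nat -ltnS ltn_ord/=.
  by rewrite invf_le1// -expR0 ler_expR; lra.
have Ki0 : 0 < K^-1 by rewrite invr_gt0.
have nur al i : `|nu al 0 i| <= rho.
  rewrite mxE; have /andP[h1 h2] := m1 (al i).
  have l1 : ln (m (al i)) <= 0 by rewrite ln_le0.
  have l2 : - (2 * rho) <= ln (m (al i)).
    by rewrite -[leLHS]expRK expRN ler_ln// posrE// (lt_le_trans Ki0).
  by rewrite ler_norml; lra.
have coord al i : `|(x - nu al) 0 i| <= K * `|yc x i - (al i)%:R / N%:R|.
  have -> : (x - nu al) 0 i = ln (yc x i) - ln (m (al i)).
    by rewrite /yc expRK !mxE; ring.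
  have /andP[h1 h2] := m1 (al i); have /andP[h3 h4] := y1 i.
  apply: le_trans (ln_lip Ki0 h3 h1) _; rewrite invrK mulrC ler_wpM2l ?(ltW K0)//.
  rewrite /m; have [h|h] := leP ((al i)%:R / N%:R) K^-1; last by [].
  rewrite !ger0_norm ?subr_ge0//; last by rewrite (le_trans h).
  by rewrite lerB.
have -> : e = e / 2 + e / 2 by lra.
apply: le_trans (_ : e / 2 + C * (n%:R / N%:R) <= _); last by rewrite lerD2l.
apply: (@weighted_mean_approx _ _ _ _
  (fun al : A => \sum_i (yc x i - (al i)%:R / N%:R) ^+ 2)).
- by move=> al; apply: prodr_ge0 => i _; exact: bern_ge0.
- rewrite -(bigA_distr_bigA (fun (i : 'I_n) (k : 'I_N.+1) => (bern N k).[yc x i])) big1// => i _.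
  exact: bern_sum.
- exact: ltW.
- move=> al; apply: le_trans (hf _ _ xr (nur al)) _.
  apply: (@le_trans _ _ (e / 2 + L ^+ 2 / e * dot (x - nu al) (x - nu al))).
    rewrite -sqr_enorm; set t := enorm _; rewrite -subr_ge0.
    have -> : e / 2 + L ^+ 2 / e * t ^+ 2 - L * t =
        ((e / 2 - L * t) ^+ 2 + e ^+ 2 / 4) / e by field; rewrite gt_eqF.
    by rewrite divr_ge0 ?(ltW e0)// addr_ge0 ?sqr_ge0// divr_ge0 ?sqr_ge0.
  rewrite lerD2l /C -[leRHS]mulrA ler_wpM2l ?divr_ge0 ?sqr_ge0 ?(ltW e0)//.
  rewrite mulr_sumr ler_sum// => i _.
  rewrite -expr2 -real_normK ?num_real// -[X in _ * X]real_normK ?num_real//.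
  by rewrite -exprMn ler_sqr ?nnegrE ?mulr_ge0 ?(ltW K0).
under eq_bigr do rewrite mulr_sumr.
rewrite exchange_big/=.
apply: (@le_trans _ _ (\sum_(i < n) N%:R^-1)); last first.
  by rewrite sumr_const card_ord mulr_natl.
apply: ler_sum => i _; apply: le_trans (bern_var_le _ (y01 i)) => //.
(* The second moment in coordinate [i] under the product weights factors into one-variable sums, all
   equal to 1 except the [i]-th. *)
pose F j (k : 'I_N.+1) := (bern N k).[yc x j] *
  (if j == i then (yc x i - k%:R / N%:R) ^+ 2 else 1).
rewrite (eq_bigr (fun al : A => \prod_j F j (al j))).
  rewrite -(bigA_distr_bigA F) (bigD1 i)//= [X in _ * X]big1 ?mulr1.
    by rewrite /F eqxx.
  move=> j ji; rewrite /F (negbTE ji); under eq_bigr do rewrite mulr1.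
  exact: bern_sum.
move=> al _; rewrite /F big_split/=; congr (_ * _).
by rewrite (bigD1 i)//= eqxx big1 ?mulr1// => j /negbTE ->.
Qed.

(** Adding [theta / (2n) * (|x|^2 - rho^2)] to a harmonic approximant changes the Laplacian to
    [theta] and nothing on the sphere. The data is Lipschitz on the circumscribed cube, where the
    Bernstein argument lives. *)
Lemma dirichlet_approx rho (theta L e : R) f : (0 < n)%N ->
  0 < rho -> 0 < L -> 0 < e ->
  (forall x y, (forall i, `|x 0 i| <= rho) -> (forall i, `|y 0 i| <= rho) ->
     `|f x - f y| <= L * enorm (x - y)) ->
  exists2 h, has_laplacian h (fun=> theta) &
    forall x, enorm x = rho -> `|h x - f x| <= e.
Proof.
move=> n0 r0 L0 e0 hf; have e20 : 0 < e / 2 by lra.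
have [g gs hg] := exp_sum_dense r0 L0 e20 hf.
have [h [lh hh]] := harmonic_approx_exp_sum n0 r0 gs e20.
have n0' : n%:R != 0 :> R by rewrite pnatr_eq0 -lt0n.
have lq : has_laplacian (fun x => dot x x) (fun=> 2 * n%:R).
  move=> x; exists (2 *: x), 2%:M; split; first exact: jet_sqnorm.
  by rewrite mxtrace_scalar mulr_natr.
exists (fun x => h x + theta / (2 * n%:R) * (dot x x + - rho ^+ 2)) => [|x xr].
  have := has_laplacianD lh (has_laplacianZ (theta / (2 * n%:R))
    (has_laplacianD lq (has_laplacian_cst (- rho ^+ 2)))).
  by apply: has_laplacian_ext => // x; field.
have xr2 : dot x x = rho ^+ 2 by rewrite -xr sqr_enorm.
rewrite xr2 subrr mulr0 addr0.
have -> : h x - f x = (h x - g x) - (f x - g x) by ring.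
rewrite (le_trans (ler_normB _ _))// (splitr e) lerD ?hh// hg// => i.
by rewrite -xr coord_le_enorm.
Qed.

End Dirichlet.

(** * Continuity and compactness *)

Section EuclideanTopology.
Context {R : realType}.

(** Passage from the max-norm balls of the topology to Euclidean ones. *)
Lemma nbhs_enormP n (x : 'rV[R]_n) (A : set 'rV[R]_n) :
  nbhs x A <-> exists2 e : R, 0 < e & forall y, enorm (y - x) <= e -> A y.
Proof.
split=> [/nbhs_ballP[e /= e0 h]|[e e0 h]].
  exists (e / 2) => [|y yx]; first by lra.
  apply: h; split=> // i j; rewrite /ball/= (ord1 i) distrC.
  have := coord_le_enorm (y - x) j; rewrite !mxE => /le_lt_trans; apply; lra.
have n0 : 0 < n%:R + 1 :> R by rewrite ltr_wpDl.
apply/nbhs_ballP; exists (e / (n%:R + 1)) => /=; first by rewrite divr_gt0.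
move=> y [_ yx]; apply: h; apply: le_trans (enorm_le_sum _) _.
apply: (@le_trans _ _ (\sum_(i < n) e / (n%:R + 1))).
  apply: ler_sum => i _; rewrite !mxE distrC; apply: ltW; exact: yx.
rewrite sumr_const card_ord -mulrnAl ler_pdivrMr// -mulr_natr; lra.
Qed.

Lemma continuous_enormP n (f : 'rV[R]_n -> R) x :
  {for x, continuous f} <-> forall e : R, 0 < e -> exists2 de : R, 0 < de &
    forall y, enorm (y - x) <= de -> `|f y - f x| <= e.
Proof.
split=> [cf e e0|h].
  have /cvgrPdist_le/(_ _ e0)/nbhs_enormP[de d0 h] : f y @[y --> x] --> f x := cf.
  by exists de => // y yx; rewrite distrC h.
have FF : Filter (nbhs x) := nbhs_filter x.
suff : f y @[y --> x] --> f x by [].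
apply/cvgrPdist_le => e e0; have [de d0 H] := h _ e0.
by apply/nbhs_enormP; exists de => // y yx; rewrite distrC H.
Qed.

Section RealValued.
Context {T : topologicalType}.
Implicit Types f g : T -> R.

Lemma continuous_addr f g :
  continuous f -> continuous g -> continuous (fun x => f x + g x).
Proof. by move=> cf cg x; apply: (@continuousD R R T); [exact: cf|exact: cg]. Qed.

Lemma continuous_oppr f : continuous f -> continuous (fun x => - f x).
Proof. by move=> cf x; apply: (@continuousN R R T); exact: cf. Qed.

Lemma continuous_subr f g :
  continuous f -> continuous g -> continuous (fun x => f x - g x).
Proof. by move=> cf cg; apply: continuous_addr => //; exact: continuous_oppr. Qed.

Lemma continuous_mulr f g :
  continuous f -> continuous g -> continuous (fun x => f x * g x).
Proof. by move=> cf cg x; apply: (@continuousM R T); [exact: cf|exact: cg]. Qed.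

Lemma continuous_scaler (a : R) f :
  continuous f -> continuous (fun x => a * f x).
Proof. by move=> cf; apply: continuous_mulr => // x; exact: cst_continuous. Qed.

Lemma continuous_compr (U : topologicalType) (f : T -> U) (g : U -> R) :
  continuous f -> continuous g -> continuous (fun x => g (f x)).
Proof. by move=> cf cg x; apply: continuous_comp; [exact: cf|exact: cg]. Qed.

End RealValued.

Lemma continuous_rV (T : topologicalType) n (f : T -> 'rV[R]_n) :
  (forall i, continuous (fun x => f x 0 i)) -> continuous f.
Proof.
move=> h x A /nbhs_ballP[e /= e0 hA].
have H : \forall y \near x, forall i, ball (f x 0 i) e (f y 0 i).
  by apply: filter_forall => i; exact: (h i x _ (nbhsx_ballx (f x 0 i) e e0)).
by apply: filterS H => y hy; apply: hA; split=> // i j; rewrite (ord1 i).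
Qed.

Lemma continuous_sumr (T : topologicalType) (I : Type) (s : seq I)
    (F : I -> T -> R) :
  (forall i, continuous (F i)) -> continuous (fun x => \sum_(i <- s) F i x).
Proof.
move=> h; elim: s => [|i s IH] x.
  under [X in continuous_at x X]eq_fun do rewrite big_nil.
  exact: cst_continuous.
under [X in continuous_at x X]eq_fun do rewrite big_cons.
by apply: continuousD; [exact: h|exact: IH].
Qed.

Lemma continuous_dot (T : topologicalType) n (f g : T -> 'rV[R]_n) :
  continuous f -> continuous g -> continuous (fun x => dot (f x) (g x)).
Proof.
move=> cf cg; apply: continuous_sumr => i x; apply: continuousM.
  exact: (continuous_comp (cf x) (@coord_continuous _ _ _ 0 i _)).
exact: (continuous_comp (cg x) (@coord_continuous _ _ _ 0 i _)).
Qed.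

Lemma continuous_mulmx m n (A : 'M[R]_(m, n)) :
  continuous (fun x : 'rV[R]_m => x *m A).
Proof.
apply: continuous_rV => i x.
under [X in continuous_at x X]eq_fun do rewrite mxE.
move: x; apply: continuous_sumr => j x; apply: continuousM;
  [exact: coord_continuous | exact: cst_continuous].
Qed.

Lemma continuous_sqnorm (T : topologicalType) n (f : T -> 'rV[R]_n) :
  continuous f -> continuous (fun x => dot (f x) (f x)).
Proof. by move=> cf; exact: continuous_dot. Qed.

Lemma closed_sublevel (T : topologicalType) (f : T -> R) (M : R) :
  continuous f -> closed [set x | f x <= M].
Proof.
by move=> cf; apply: (@preimage_closed _ _ f [set x | x <= M]) => //; exact: closed_le.
Qed.

Lemma max_closed_bounded n (S : set 'rV[R]_n) (M : R) (f : 'rV[R]_n -> R) :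
  closed S -> (forall x, S x -> enorm x <= M) -> S !=set0 -> continuous f ->
  exists2 c, S c & forall x, S x -> f x <= f c.
Proof.
move=> cS bS S0 cf.
have [|||c] := @EVT_max_rV R n f S; last 1 first.
- by move=> /set_mem Sc h; exists c => // x Sx; apply: h; rewrite inE.
- by [].
- apply: bounded_closed_compact cS; exists M; split; first exact: num_real.
  move=> M' MM' x /bS xM; rewrite /= /Num.norm/= mx_normrE.
  apply: bigmax_le => [|[i j] _] /=.
    by apply: le_trans (ltW MM'); apply: le_trans xM; exact: enorm_ge0.
  by rewrite (ord1 i) (le_trans (coord_le_enorm _ _))// (le_trans xM)// ltW.
- exact: continuous_subspaceT.
Qed.

Lemma dot_le_sqr n (x : 'rV[R]_n) (M : R) : 0 <= M ->
  (dot x x <= M ^+ 2) = (enorm x <= M).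
Proof. by move=> M0; rewrite -sqr_enorm ler_sqr ?nnegrE ?enorm_ge0. Qed.

(* The set of pairs in the ball at which [f] varies by at least [e] is compact,
   and [enorm (x - y)] has a positive minimum on it. *)
Lemma uniform_continuity n (f : 'rV[R]_n -> R) (M e : R) : 0 < M -> 0 < e ->
  continuous f -> exists2 de : R, 0 < de & forall x y,
    enorm x <= M -> enorm y <= M -> enorm (x - y) < de -> `|f x - f y| < e.
Proof.
move=> M0 e0 cf.
pose p1 (z : 'rV[R]_(n + n)) := z *m col_mx 1%:M 0.
pose p2 (z : 'rV[R]_(n + n)) := z *m col_mx 0 1%:M.
have c1 : continuous p1 by exact: continuous_mulmx.
have c2 : continuous p2 by exact: continuous_mulmx.
have E1 x y : p1 (row_mx x y) = x.
  by rewrite /p1 mul_row_col mulmx1 mulmx0 addr0.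
have E2 x y : p2 (row_mx x y) = y.
  by rewrite /p2 mul_row_col mulmx1 mulmx0 add0r.
pose S := [set z | dot (p1 z) (p1 z) <= M ^+ 2] `&`
  [set z | dot (p2 z) (p2 z) <= M ^+ 2] `&`
  [set z | e <= `|f (p1 z) - f (p2 z)|].
have c3 : continuous (fun z => `|f (p1 z) - f (p2 z)|).
  apply: (@continuous_compr _ R _ Num.norm); last exact: (@norm_continuous R R).
  by apply: continuous_subr; exact: continuous_compr.
have cS : closed S.
  apply: closedI; first apply: closedI.
  - exact: closed_sublevel (continuous_sqnorm c1).
  - exact: closed_sublevel (continuous_sqnorm c2).
  - by apply: (@preimage_closed _ _ _ [set y | e <= y]) => // z _; exact: c3.
have bS z : S z -> enorm z <= 2 * M.
  move=> [[h1 h2] _]; rewrite -dot_le_sqr; last lra.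
  have zE : z = row_mx (p1 z) (p2 z).
    by rewrite -[z]hsubmxK E1 E2.
  rewrite zE dot_row_mx (le_trans (lerD h1 h2))//.
  have := sqr_ge0 M; lra.
have [S0|S0] := pselect (S !=set0); last first.
  exists 1 => // x y xM yM _; rewrite ltNge; apply/negP => h; apply: S0.
  exists (row_mx x y); split; last by rewrite /= E1 E2.
  by split; rewrite /= ?E1 ?E2 dot_le_sqr// ltW.
have cd : continuous (fun z => - dot (p1 z - p2 z) (p1 z - p2 z)).
  apply: continuous_oppr; apply: continuous_sqnorm => z.
  by apply: continuousB; [exact: c1|exact: c2].
have [z [[h1 h2] h3] hz] := max_closed_bounded cS bS S0 cd.
have zd : 0 < enorm (p1 z - p2 z).
  rewrite lt_neqAle enorm_ge0 andbT eq_sym; apply/eqP => /enorm_eq0/eqP.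
  rewrite subr_eq0 => /eqP zz; move: h3; rewrite /= zz subrr normr0; lra.
exists (enorm (p1 z - p2 z)) => // x y xM yM xy.
rewrite ltNge; apply/negP => h.
have /hz : S (row_mx x y).
  split; last by rewrite /= E1 E2.
  by split; rewrite /= ?E1 ?E2 dot_le_sqr// ltW.
rewrite E1 E2 lerN2 -!sqr_enorm ler_sqr ?nnegrE ?enorm_ge0// leNgt xy//.
Qed.

End EuclideanTopology.

(** * The theorem on sums *)

Section Comparison.
Context {R : realType}.

Lemma dot_sqrB n (x y : 'rV[R]_n) :
  dot (x - y) (x - y) = dot x x - 2 * dot x y + dot y y.
Proof. by rewrite !(dotBl, dotBr) (dotC y); ring. Qed.

(** The second-order superjet of [u] at [x]. *)
Definition ujet n (u : 'rV[R]_n -> R) x p (X : 'M[R]_n) := X^T = X /\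
  forall e : R, 0 < e -> exists2 de : R, 0 < de & forall w, enorm w <= de ->
    u (x + w) <= u x + dot p w + dot (w *m X) w / 2 + e * dot w w.

Lemma jet_ujet n (u : 'rV[R]_n -> R) x p X : jet u x p X -> ujet u x p X.
Proof.
move=> [sX h]; split=> // e /h[de de0 H]; exists de => // w /H.
by rewrite /taylor_rem ler_norml => /andP[_]; lra.
Qed.

Lemma jet_continuous n (u : 'rV[R]_n -> R) :
  (forall x, exists p X, jet u x p X) -> continuous u.
Proof.
move=> h x; apply/continuous_enormP => e e0.
have [p [X /jet_lip[C C0 [de de0 H]]]] := h x.
exists (Num.min de (e / C)) => [|y]; first by rewrite lt_min de0 divr_gt0.
rewrite le_min ler_pdivlMr// mulrC => /andP[/H[h1 _] yx].
by move: h1; rewrite (addrC x) subrK => /le_trans; apply.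
Qed.

(** Test along [t v], divide by [t] and let [t] tend to 0; the choice [v = - a] kills the
    first-order part. *)
Lemma nonneg_second_order n (a : 'rV[R]_n) (M : 'M[R]_n) :
  (forall e : R, 0 < e -> exists2 de : R, 0 < de & forall v, enorm v <= de ->
    0 <= dot a v + dot (v *m M) v / 2 + e * dot v v) ->
  a = 0 /\ forall v, 0 <= dot (v *m M) v.
Proof.
move=> H.
have scale e v : 0 < e -> exists2 t0 : R, 0 < t0 & forall t, 0 < t -> t <= t0 ->
    0 <= dot a v + t * (dot (v *m M) v / 2 + e * dot v v).
  move=> e0; have [de de0 h] := H _ e0.
  have v0 : 0 < enorm v + 1 by rewrite ltr_wpDl ?enorm_ge0.
  exists (de / (enorm v + 1)) => [|t t0]; first by rewrite divr_gt0.
  rewrite ler_pdivlMr// => tde.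
  have : enorm (t *: v) <= de.
    rewrite enormZ gtr0_norm// (le_trans _ tde)// ler_wpM2l ?(ltW t0)//; lra.
  move/h; rewrite -scalemxAl !dotZl !dotZr.
  have -> : t * dot a v + t * (t * dot (v *m M) v) / 2 + e * (t * (t * dot v v))
    = t * (dot a v + t * (dot (v *m M) v / 2 + e * dot v v)) by ring.
  by rewrite pmulr_rge0.
have a0 : a = 0.
  apply: dot_small_eq0 => e e0.
  have [t0 t00 h] := scale 1 (- a) ltr01.
  set B := dot (- a *m M) (- a) / 2 + 1 * dot (- a) (- a) in h.
  have B0 : 0 < `|B| + 1 by rewrite ltr_wpDl.
  pose t := Num.min t0 (e / (`|B| + 1)).
  have tt0 : t <= t0 by rewrite ge_min lexx.
  have t1 : 0 < t by rewrite lt_min t00 divr_gt0.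
  have := h _ t1 tt0; rewrite dotNr => h1.
  have : t * B <= e.
    apply: le_trans (_ : t * (`|B| + 1) <= e).
      by rewrite ler_wpM2l ?(ltW t1)//; have := ler_norm B; lra.
    by rewrite -ler_pdivlMr// ge_min lexx orbT.
  lra.
split=> // v; apply/ler_addgt0Pl => e e0; rewrite -[leLHS]addr0.
have v0 : 0 < 2 * (dot v v + 1) by have := dot_ge0 v; lra.
have [t0 t00 h] := scale (e / (2 * (dot v v + 1))) v (divr_gt0 e0 v0).
have := h _ t00 (lexx _); rewrite a0 dot0l add0r pmulr_rge0// => h1.
have : e / (2 * (dot v v + 1)) * dot v v <= e / 2.
  rewrite mulrAC ler_pdivrMr//; have := dot_ge0 v; nra.
lra.
Qed.

(** The jet of [h] becomes a superjet of [u] through the pseudo-inverse [Rm] of [P], since a joint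
    displacement [(w, w *m Rm)] leaves the penalty unchanged. The trace lost on the way is that of
    [H] on the kernel of [v |-> v *m P], where [H] is nonnegative. *)
Lemma touching_jet D N (u : 'rV[R]_D -> R) (h : 'rV[R]_N -> R)
    (P : 'M[R]_(N, D)) (lam d0 : R) z1 (zeta1 : 'rV[R]_N) g (H : 'M[R]_N) :
  0 < d0 -> 0 < lam -> P^T *m P \in unitmx -> jet h zeta1 g H ->
  (forall w v, enorm w <= d0 -> enorm v <= d0 ->
     u (z1 + w) - lam / 2 * dot (z1 + w - (zeta1 + v) *m P) (z1 + w - (zeta1 + v) *m P)
       - h (zeta1 + v) <=
     u z1 - lam / 2 * dot (z1 - zeta1 *m P) (z1 - zeta1 *m P) - h zeta1) ->
  exists X, [/\ ujet u z1 (lam *: (z1 - zeta1 *m P)) X,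
    forall w, - lam * dot w w <= dot (w *m X) w &
    \tr (P^T *m P *m X) <= \tr H].
Proof.
move=> d00 lam0 uA jh touch.
set A := P^T *m P; set y := z1 - zeta1 *m P.
have sA : A^T = A by rewrite /A trmx_mul trmxK.
have sAi : (invmx A)^T = invmx A by rewrite trmx_inv sA.
have [sH hH] := jh.
(* Moving [zeta] alone gives the value of [g] and the lower bound [- lam P P^T] on [H]. *)
have [|ag Hge] := @nonneg_second_order _ (g - lam *: (y *m P^T)) (H + lam *: (P *m P^T)).
  move=> e /hH[de de0 hde]; exists (Num.min de d0) => [|v].
    by rewrite lt_min de0.
  rewrite le_min => /andP[/hde h1 vd0].
  have := touch 0 v _ vd0; rewrite enorm0 addr0 => /(_ (ltW d00)).
  have -> : z1 - (zeta1 + v) *m P = y - v *m P.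
    by rewrite mulmxDl opprD addrA.
  have -> : dot (y - v *m P) (y - v *m P) =
      dot y y - 2 * dot y (v *m P) + dot (v *m P) (v *m P).
    exact: dot_sqrB.
  have -> : dot (g - lam *: (y *m P^T)) v = dot g v - lam * dot y (v *m P).
    by rewrite dotBl dotZl (dot_mulmx y) trmxK.
  have -> : dot (v *m (H + lam *: (P *m P^T))) v =
      dot (v *m H) v + lam * dot (v *m P) (v *m P).
    by rewrite mulmxDr dotDl -scalemxAr dotZl mulmxA (dot_mulmx (v *m P)) trmxK.
  move: h1; rewrite /taylor_rem ler_norml => /andP[_ h1]; lra.
have {ag}gE : g = lam *: (y *m P^T) by apply/eqP; rewrite -subr_eq0 ag.
have Hk v : - lam * dot (v *m P) (v *m P) <= dot (v *m H) v.
  have := Hge v; rewrite mulmxDr dotDl -scalemxAr dotZl mulmxA.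
  rewrite (dot_mulmx (v *m P)) trmxK; lra.
have [Rm RmE] : exists Rm, Rm = invmx A *m P^T by eexists.
have RP : Rm *m P = 1%:M by rewrite RmE -mulmxA mulVmx.
have RPt : P^T *m Rm^T = 1%:M by rewrite -trmx_mul RP trmx1.
have XE w : dot (w *m (Rm *m H *m Rm^T)) w = dot (w *m Rm *m H) (w *m Rm).
  by rewrite !mulmxA dot_mulmx trmxK.
exists (Rm *m H *m Rm^T); split.
- split; first by rewrite trmx_mul trmxK (trmx_mul Rm H) sH mulmxA.
  have [C C0 hC] := mulmx_bounded Rm.
  move=> e e0; have e1 : 0 < e / C ^+ 2 by rewrite divr_gt0// exprn_gt0.
  have [de de0 hde] := hH _ e1.
  exists (Num.min d0 (Num.min (d0 / C) (de / C))) => [|w].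
    by rewrite !lt_min d00 !divr_gt0//.
  rewrite !le_min !ler_pdivlMr// !(mulrC _ C) => /and3P[w1 w2 w3].
  (* As [Rm *m P = 1], the vector [z - zeta *m P] keeps its value [y] along this displacement. *)
  have := touch w (w *m Rm) w1 (le_trans (hC w) w2).
  have -> : z1 + w - (zeta1 + w *m Rm) *m P = y.
    rewrite mulmxDl -mulmxA RP mulmx1 /y.
    by rewrite opprD addrACA subrr addr0.
  have := hde (w *m Rm) (le_trans (hC w) w3).
  rewrite /taylor_rem ler_norml => /andP[_].
  rewrite XE.
  have -> : dot g (w *m Rm) = dot (lam *: y) w.
    by rewrite gE !dotZl dot_mulmx trmxK -mulmxA RP mulmx1.
  have : e / C ^+ 2 * dot (w *m Rm) (w *m Rm) <= e * dot w w.
    rewrite mulrAC ler_pdivrMr ?exprn_gt0// -mulrA ler_pM2l// -!sqr_enorm -exprMn.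
    by rewrite ler_sqr ?nnegrE ?mulr_ge0 ?enorm_ge0 ?(ltW C0)// mulrC.
  lra.
- by move=> w; have := Hk (w *m Rm); rewrite XE -mulmxA RP mulmx1.
(* The orthogonal projection onto the kernel of [v |-> v *m P]: the discrepancy of traces is
   [\tr (Q *m H)]. *)
- pose Q := 1%:M - P *m Rm.
  have sQ : Q^T = Q.
    by rewrite /Q linearB/= trmx1 RmE mulmxA !trmx_mul trmxK sAi mulmxA.
  have QP : Q *m P = 0 by rewrite mulmxBl mul1mx -mulmxA RP mulmx1 subrr.
  have QQ : Q *m Q = Q by rewrite {2}/Q mulmxBr mulmx1 mulmxA QP mul0mx subr0.
  have -> : \tr (A *m (Rm *m H *m Rm^T)) = \tr (P *m Rm *m H).
    have AR : A *m Rm = P^T by rewrite RmE mulmxA mulmxV// mul1mx.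
    have PR : Rm^T *m P^T = P *m Rm.
      by rewrite -trmx_mul RmE mulmxA !trmx_mul trmxK sAi mulmxA.
    have -> : A *m (Rm *m H *m Rm^T) = P^T *m (H *m Rm^T) by rewrite !mulmxA AR.
    by rewrite mxtrace_mulC -(mulmxA H) PR mxtrace_mulC.
  rewrite -subr_ge0 -raddfB/= -[X in X - _]mul1mx -mulmxBl -/Q -QQ -mulmxA.
  rewrite mxtrace_mulC -{2}sQ trace_congr sumr_ge0// => k _.
  apply: le_trans (Hk (row k Q)).
  by rewrite -row_mul QP row0 dot0l mulr0.
Qed.

End Comparison.

Section ViscosityComparison.
Context {R : realType}.

Lemma psd_entry n (S : 'M[R]_n) i j : S^T = S ->
  (forall w, 0 <= dot (w *m S) w) -> `|S i j| <= \tr S.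
Proof.
move=> sS psd.
have dg k : 0 <= S k k by rewrite -dot_delta.
have dgle k : S k k <= \tr S.
  by rewrite /mxtrace (bigD1 k)//= lerDl sumr_ge0.
have sij : S j i = S i j by rewrite -{1}sS mxE.
have h1 := psd (delta_mx 0 i + delta_mx 0 j).
have h2 := psd (delta_mx 0 i - delta_mx 0 j).
move: h1; rewrite mulmxDl dotDl !dotDr !dot_delta sij.
move: h2; rewrite mulmxBl dotBl !dotBr !dot_delta sij.
by have := dgle i; have := dgle j; rewrite ler_norml; lra.
Qed.

Lemma trace_gram_ge0 m n (P : 'M[R]_(m, n)) (S : 'M[R]_n) :
  (forall w, 0 <= dot (w *m S) w) -> 0 <= \tr (P^T *m P *m S).
Proof.
by move=> psd; rewrite -mulmxA mxtrace_mulC trace_congr sumr_ge0.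
Qed.

Lemma gram_unitmx n m (A : 'M[R]_n) (P : 'M[R]_(m, n)) (kappa : R) :
  0 < kappa -> A = kappa%:M + P^T *m P -> A \in unitmx.
Proof.
move=> k0 AE; rewrite -row_free_unit -kermx_eq0.
apply/eqP/row_matrixP => i; rewrite row0; set v := row i _.
have vA : v *m A = 0 by rewrite /v -row_mul mulmx_ker row0.
have : dot (v *m A) v = 0 by rewrite vA dot0l.
rewrite AE mulmxDr mul_mx_scalar dotDl dotZl mulmxA (dot_mulmx (v *m P^T)) => h.
apply: dot_eq0; apply/eqP; rewrite eq_le dot_ge0 andbT -(pmulr_rle0 _ k0).
have := dot_ge0 (v *m P^T); lra.
Qed.

(** [X + lam] is positive semidefinite, so its entries are bounded by its trace, which the summand
    [kappa] of the diffusion controls. This bound on all of [X] makes freezing the coefficients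
    possible; removing [kappa] from the trace costs [kappa * D * lam]. *)
Lemma frozen_trace_bounds D N0 (X : 'M[R]_D) (P0 : 'M[R]_(N0, D))
    (lam kappa theta : R) :
  X^T = X -> 0 < lam -> 0 < kappa ->
  (forall w, - lam * dot w w <= dot (w *m X) w) ->
  \tr ((kappa%:M + P0^T *m P0) *m X) <= theta ->
  \tr (P0^T *m P0 *m X) <= theta + kappa * D%:R * lam /\
  forall i j, `|X i j| <=
    `|(theta + lam * \tr (kappa%:M + P0^T *m P0)) / kappa| + lam.
Proof.
move=> sX lam0 kappa0 Xlow trX.
set T := (theta + lam * \tr (kappa%:M + P0^T *m P0)) / kappa.
pose S1 := X + lam%:M.
have S1psd w : 0 <= dot (w *m S1) w.
  rewrite mulmxDr mul_mx_scalar dotDl dotZl -lerBlDr sub0r -mulNr; exact: Xlow.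
have trS1 : \tr S1 = \tr X + lam * D%:R.
  by rewrite mxtraceD mxtrace_scalar mulr_natr.
have trS1ge : 0 <= \tr S1 by rewrite trace_dot sumr_ge0.
have E : \tr ((kappa%:M + P0^T *m P0) *m X) =
    kappa * \tr X + \tr (P0^T *m P0 *m X).
  by rewrite mulmxDl mxtraceD mul_scalar_mx mxtraceZ.
split.
  move: trX trS1ge; rewrite E trS1; move: (\tr X) (\tr _) => a b h1 h2.
  have := ler_wpM2l (ltW kappa0) h2; lra.
have trS1le : \tr S1 <= T.
  rewrite ler_pdivlMr// mulrC.
  have h1 := trace_gram_ge0 P0 S1psd.
  have : kappa * \tr S1 + \tr (P0^T *m P0 *m S1) =
      \tr ((kappa%:M + P0^T *m P0) *m X) + lam * \tr (kappa%:M + P0^T *m P0).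
    rewrite -mxtraceZ -mul_scalar_mx -mxtraceD -mulmxDl /S1 mulmxDr mxtraceD.
    by rewrite mul_mx_scalar mxtraceZ.
  move: h1 trX; move: (\tr _) (\tr _) (\tr _) (kappa * _) => a b c d'.
  lra.
move=> i j; have sS1 : S1^T = S1 by rewrite linearD/= sX tr_scalar_mx.
have h1 := le_trans (psd_entry i j sS1 S1psd) trS1le.
have -> : X i j = S1 i j - lam *+ (i == j) by rewrite !mxE addrK.
apply: le_trans (ler_normB _ _) _; apply: lerD.
  exact: le_trans h1 (ler_norm _).
by case: (i == j); rewrite ?mulr1n ?mulr0n ?normr0 ?(ltW lam0)// gtr0_norm.
Qed.

Lemma trace_perturb_le D (A B X : 'M[R]_D) (e M : R) :
  (forall i j, `|A i j - B i j| <= e) -> (forall i j, `|X i j| <= M) ->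
  \tr (A *m X) <= \tr (B *m X) + D%:R ^+ 2 * M * e.
Proof.
move=> hA hX; rewrite -lerBlDl -raddfB/= -mulmxBl.
apply: (@le_trans _ _ (\sum_(i < D) \sum_(j < D) e * M)).
  apply: ler_sum => i _; rewrite mxE; apply: ler_sum => j _.
  by rewrite !mxE (le_trans (ler_norm _))// normrM ler_pM.
rewrite !sumr_const !card_ord.
have -> : (e * M) *+ D *+ D = D%:R ^+ 2 * M * e.
  by rewrite -mulrnA -[LHS]mulr_natr natrM; ring.
by [].
Qed.

Lemma share_le (x y : R) : 0 <= y -> 0 < x -> y * (x / (4 * (y + 1))) <= x / 4.
Proof.
move=> y0 x0; rewrite mulrA ler_pdivrMr ?mulr_gt0 ?ltr_wpDl//.
have -> : x / 4 * (4 * (y + 1)) = x * y + x by field.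
by rewrite mulrC lerDl ltW.
Qed.

(** If [h 0 <= 0], the maximum of [u - penalty - h] is nonnegative, hence interior in [zeta], and
    [touching_jet] applies there. The Hessian bound depends only on [theta], [lam], [kappa] and the
    diffusion at 0, so one radius [rb] serves every [h]. *)
Lemma viscosity_comparison D N N0 (u : 'rV[R]_D -> R)
    (beta : 'rV[R]_D -> 'rV[R]_D) (A : 'rV[R]_D -> 'M[R]_D) (p1 : 'rV[R]_D)
    (P : 'M[R]_(N, D)) (P0 : 'M[R]_(N0, D)) (rho0 q lam kappa theta : R) :
  continuous u -> u 0 = 0 -> 0 < rho0 -> 0 <= q -> 0 < lam -> 4 * q <= lam ->
  0 < kappa ->
  (forall z, enorm z <= rho0 -> u z <= q / 2 * dot z z) ->
  (forall z p X, enorm z < rho0 -> ujet u z p X ->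
     dot (beta z) (p1 + p) <= \tr (A z *m X)) ->
  (forall e : R, 0 < e -> exists2 de : R, 0 < de &
     forall z, enorm z <= de -> enorm (beta z - beta 0) <= e) ->
  (forall e : R, 0 < e -> exists2 de : R, 0 < de &
     forall z, enorm z <= de -> forall i j, `|A z i j - A 0 i j| <= e) ->
  A 0 = P0^T *m P0 -> P^T *m P = kappa%:M + A 0 ->
  theta + kappa * D%:R * lam < dot (beta 0) p1 ->
  exists2 rb : R, 0 < rb & forall (rho : R) (h : 'rV[R]_N -> R),
    0 < rho -> rho <= rb -> has_laplacian h (fun=> theta) ->
    (forall zeta z, enorm zeta = rho -> enorm z <= rho0 ->
       u z - lam / 2 * dot (z - zeta *m P) (z - zeta *m P) < h zeta) ->
    0 < h 0.
Proof.
move=> cu u0 rho00 q0 lam0 qlam kappa0 hq vis cbeta cA A0 PP gap.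
have [C C0 hC] := mulmx_bounded P.
set eta := dot (beta 0) p1 - (theta + kappa * D%:R * lam).
have eta0 : 0 < eta by rewrite subr_gt0.
pose T := (theta + lam * \tr (kappa%:M + A 0)) / kappa.
pose M0 := `|T| + lam; have M00 : 0 < M0 by rewrite ltr_wpDl.
have D0 : 0 <= D%:R :> R by [].
have DM0 : 0 < D%:R ^+ 2 * M0 + 1 by rewrite ltr_wpDl// mulr_ge0 ?exprn_ge0// ltW.
have [dA dA0 hA] := cA (eta / (4 * (D%:R ^+ 2 * M0 + 1))) (divr_gt0 eta0
  (mulr_gt0 (ltr0n _ 4) DM0)).
have p10 : 0 < enorm p1 + 1 by rewrite ltr_wpDl ?enorm_ge0.
have eb0 : 0 < Num.min 1 (eta / (4 * (enorm p1 + 1))).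
  by rewrite lt_min ltr01 divr_gt0// mulr_gt0.
have [db db0 hb] := cbeta _ eb0.
pose K := enorm (beta 0) + 1.
have K0 : 0 < K by rewrite ltr_wpDl ?enorm_ge0.
(* With [|z1| <= 3 C rho], the first two bounds freeze the diffusion and [beta] at 0, the third
   keeps [z1] interior, and the fourth makes the contribution of [p = lam (z1 - xi)] small. The
   three errors are [eta / 4] each. *)
pose rb := Num.min (Num.min (dA / (3 * C)) (db / (3 * C)))
  (Num.min (rho0 / (4 * C)) (eta / (8 * K * lam * C))).
exists rb; first by rewrite !lt_min !divr_gt0// ?mulr_gt0.
move=> rho h rho1; rewrite !le_min => /andP[/andP[r1 r2] /andP[r3 r4]] lh hbd.
rewrite ltNge; apply/negP => h0.
have {}r1 : 3 * C * rho <= dA by rewrite mulrC -ler_pdivlMr// mulr_gt0.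
have {}r2 : 3 * C * rho <= db by rewrite mulrC -ler_pdivlMr// mulr_gt0.
have {}r3 : 4 * C * rho <= rho0 by rewrite mulrC -ler_pdivlMr// mulr_gt0.
have {}r4 : 8 * K * lam * C * rho <= eta.
  by rewrite mulrC -ler_pdivlMr// !mulr_gt0.
have ch : continuous h.
  by apply: jet_continuous => x; have [p [X [j _]]] := lh x; exists p, X.
pose pz (x : 'rV[R]_(D + N)) := x *m col_mx 1%:M 0.
pose pt (x : 'rV[R]_(D + N)) := x *m col_mx 0 1%:M.
have E1 x y : pz (row_mx x y) = x.
  by rewrite /pz mul_row_col mulmx1 mulmx0 addr0.
have E2 x y : pt (row_mx x y) = y.
  by rewrite /pt mul_row_col mulmx1 mulmx0 add0r.
have c1 : continuous pz by exact: continuous_mulmx.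
have c2 : continuous pt by exact: continuous_mulmx.
pose G z zeta := u z - lam / 2 * dot (z - zeta *m P) (z - zeta *m P) - h zeta.
have cG : continuous (fun x => G (pz x) (pt x)).
  apply: continuous_subr; last exact: continuous_compr.
  apply: continuous_subr; first exact: continuous_compr.
  apply: continuous_scaler; apply: continuous_sqnorm => x.
  apply: continuousB; first exact: c1.
  have c3 : continuous (fun x => pt x *m P).
    by move=> y; exact: (continuous_comp (c2 y) (@continuous_mulmx _ _ _ P _)).
  exact: c3.
pose S := [set x | dot (pz x) (pz x) <= rho0 ^+ 2] `&`
  [set x | dot (pt x) (pt x) <= rho ^+ 2].
have cS : closed S.
  apply: closedI.
    exact: (closed_sublevel (continuous_sqnorm c1)).
  exact: (closed_sublevel (continuous_sqnorm c2)).
have bS x : S x -> enorm x <= rho0 + rho.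
  move=> [h1 h2]; rewrite -dot_le_sqr; last lra.
  have -> : x = row_mx (pz x) (pt x) by rewrite -[x]hsubmxK E1 E2.
  rewrite dot_row_mx (le_trans (lerD h1 h2))// sqrrD.
  have : 0 <= rho0 * rho by rewrite mulr_ge0// ltW.
  lra.
have S0 : S !=set0.
  exists 0; split; rewrite /= /pz /pt !mul0mx dot0l sqr_ge0//.
have [x [Sx1 Sx2] maxx] := max_closed_bounded cS bS S0 cG.
move: Sx1 Sx2 maxx; rewrite /= !dot_le_sqr ?(ltW rho00) ?(ltW rho1)//.
set z1 := pz x; set zeta1 := pt x => z1r zeta1r maxx.
have {}maxx z zeta : enorm z <= rho0 -> enorm zeta <= rho ->
    G z zeta <= G z1 zeta1.
  move=> zr zetar; have := maxx (row_mx z zeta); rewrite E1 E2; apply.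
  by split; rewrite /= ?E1 ?E2 dot_le_sqr// ltW.
have G0 : 0 <= G z1 zeta1.
  apply: le_trans (maxx 0 0 _ _); rewrite ?enorm0 ?(ltW rho00) ?(ltW rho1)//.
  by rewrite /G u0 mul0mx subr0 dot0l mulr0 subr0 sub0r oppr_ge0.
have zeta1lt : enorm zeta1 < rho.
  rewrite lt_neqAle zeta1r andbT; apply/eqP => e.
  by have := hbd _ _ e z1r; move: G0; rewrite /G; lra.
set xi := zeta1 *m P.
have xib : enorm xi <= C * rho.
  by apply: le_trans (hC _) _; rewrite ler_wpM2l ?(ltW C0).
(* Comparison of the maximum with [(0, zeta1)]; the hypothesis [4 q <= lam] absorbs the quadratic
   growth of [u]. *)
have z1xi : enorm (z1 - xi) <= 2 * enorm xi.
  have := maxx 0 zeta1 _ zeta1r; rewrite enorm0 (ltW rho00) => /(_ isT).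
  rewrite /G u0 -/xi (_ : dot (0 - xi) (0 - xi) = dot xi xi); last first.
    by rewrite sub0r dotNl dotNr opprK.
  have uz := hq _ z1r.
  have sq : dot z1 z1 <= 2 * dot (z1 - xi) (z1 - xi) + 2 * dot xi xi.
    have := dot_ge0 (z1 - xi - xi); rewrite dot_sqrB.
    have -> : dot z1 z1 = dot (z1 - xi) (z1 - xi) + 2 * dot (z1 - xi) xi + dot xi xi.
      by rewrite dot_sqrB dotBl; ring.
    lra.
  have xi2 : 0 <= 2 * enorm xi by rewrite mulr_ge0 ?enorm_ge0.
  move=> H; rewrite -(ler_sqr (x := enorm _)) ?nnegrE ?enorm_ge0 ?xi2//; move: H.
  rewrite exprMn !sqr_enorm.
  set a := dot (z1 - xi) (z1 - xi) in sq *; set b := dot xi xi in sq *.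
  have a0 : 0 <= a := dot_ge0 _.
  have b0 : 0 <= b := dot_ge0 _.
  move=> H; have H1 : q / 2 * dot z1 z1 <= q * (a + b).
    by have := ler_wpM2l q0 sq; lra.
  have H2 : 4 * (q * (a + b)) <= lam * (a + b).
    by rewrite mulrA ler_wpM2r// addr_ge0.
  have : lam * (a - 3 * b) <= 0 by lra.
  by rewrite pmulr_rle0//; lra.
have z1b : enorm z1 <= 3 * C * rho.
  have := enorm_le_subD z1 xi; lra.
have z1lt : enorm z1 < rho0.
  apply: le_lt_trans z1b _; apply: lt_le_trans r3.
  by rewrite ltr_pM2r// ltr_pM2r// ltr_nat.
have [g [H [jh trH]]] := lh zeta1.
have AE : P^T *m P = kappa%:M + P0^T *m P0 by rewrite PP A0.
pose d0 := Num.min (rho0 - enorm z1) (rho - enorm zeta1).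
have d00 : 0 < d0 by rewrite lt_min !subr_gt0 z1lt.
have [|X [uX Xlow trX]] := touching_jet d00 lam0 (gram_unitmx kappa0 AE) jh
    (u := u) (z1 := z1).
  move=> w v; rewrite !le_min => /andP[w1 _] /andP[_ v1].
  apply: maxx; first by have := enormD z1 w; lra.
  by have := enormD zeta1 v; lra.
have [sX _] := uX.
have {vis}vis := vis _ _ _ z1lt uX.
rewrite AE trH in trX.
have [trA Xij] := frozen_trace_bounds sX lam0 kappa0 Xlow trX.
rewrite -A0 in trA Xij.
have trAz : \tr (A z1 *m X) <= \tr (A 0 *m X) + eta / 4.
  apply: le_trans (trace_perturb_le (hA _ (le_trans z1b r1)) Xij) _.
  have y0 : 0 <= D%:R ^+ 2 * M0 by rewrite mulr_ge0 ?exprn_ge0// ltW.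
  by rewrite lerD2l; exact: share_le y0 eta0.
set p := lam *: (z1 - xi) in vis.
have pb : enorm p <= 2 * lam * C * rho.
  rewrite enormZ gtr0_norm//.
  have -> : 2 * lam * C * rho = lam * (2 * (C * rho)) by ring.
  rewrite ler_wpM2l ?(ltW lam0)//; lra.
have z1db : enorm z1 <= db by rewrite (le_trans z1b).
have := hb _ z1db; rewrite le_min => /andP[b1 b2].
have bz : enorm (beta z1) <= K.
  by have := enorm_le_subD (beta z1) (beta 0); rewrite /K; lra.
have h1 : - (eta / 4) <= dot (beta z1) p.
  have := dot_le_enorm (beta z1) p; rewrite ler_norml => /andP[h1 _].
  apply: le_trans h1; rewrite lerN2.
  apply: le_trans (_ : K * (2 * lam * C * rho) <= _).
    by rewrite ler_pM ?enorm_ge0.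
  have -> : K * (2 * lam * C * rho) = 8 * K * lam * C * rho / 4 by field.
  by rewrite ler_wpM2r.
have h2 : - (eta / 4) <= dot (beta z1 - beta 0) p1.
  have := dot_le_enorm (beta z1 - beta 0) p1; rewrite ler_norml => /andP[h2 _].
  apply: le_trans h2; rewrite lerN2.
  apply: le_trans (share_le (enorm_ge0 p1) eta0).
  by rewrite mulrC ler_wpM2l ?enorm_ge0.
move: vis h2; rewrite dotDr dotBl /eta; rewrite /eta in h1 trAz eta0.
lra.
Qed.

End ViscosityComparison.

(** * Sup-convolutions on a ball *)

Section SupConvolution.
Context {R : realType}.

Lemma dot_quadD n (X : 'M[R]_n) x y : X^T = X ->
  dot ((x + y) *m X) (x + y) =
  dot (x *m X) x + 2 * dot (x *m X) y + dot (y *m X) y.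
Proof.
by move=> sX; rewrite mulmxDl dotDl !dotDr (dot_mulmx_sym y x sX); ring.
Qed.

Lemma supconv_exists n (u : 'rV[R]_n -> R) (rho lam : R) :
  0 < rho -> continuous u ->
  exists U : 'rV[R]_n -> R, forall xi,
    (exists2 z, enorm z <= rho & U xi = u z - lam / 2 * dot (z - xi) (z - xi)) /\
    forall z, enorm z <= rho -> u z - lam / 2 * dot (z - xi) (z - xi) <= U xi.
Proof.
move=> r0 cu; pose PP (xi : 'rV[R]_n) (y : R) :=
  (exists2 z, enorm z <= rho & y = u z - lam / 2 * dot (z - xi) (z - xi)) /\
    forall z, enorm z <= rho -> u z - lam / 2 * dot (z - xi) (z - xi) <= y.
suff /choice[U hU] : forall xi, exists y, PP xi y by exists U.
move=> xi.
have cf : continuous (fun z => u z - lam / 2 * dot (z - xi) (z - xi)).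
  apply: continuous_subr => //; apply: continuous_scaler.
  apply: continuous_sqnorm => z; apply: continuousB; first exact: cvg_id.
  exact: cst_continuous.
have [||||c cr h] := @max_closed_bounded R n [set z | dot z z <= rho ^+ 2] rho
  (fun z => u z - lam / 2 * dot (z - xi) (z - xi)) => //.
- by apply: (@closed_sublevel R _ (fun z => dot z z)); apply: continuous_sqnorm => z; exact: cvg_id.
- by move=> z /=; rewrite dot_le_sqr// ltW.
- by exists 0; rewrite /= dot0l sqr_ge0.
exists (u c - lam / 2 * dot (c - xi) (c - xi)); split.
  by exists c => //; rewrite -dot_le_sqr// ltW.
by move=> z zr; apply: h; rewrite /= dot_le_sqr// ltW.
Qed.

(** Supplies the Lipschitz boundary data for [dirichlet_approx]; [u] itself is merely continuous. *)
Lemma supconv_lip n (u U : 'rV[R]_n -> R) (rho lam K : R) : 0 <= lam ->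
  (forall xi, (exists2 z, enorm z <= rho &
      U xi = u z - lam / 2 * dot (z - xi) (z - xi)) /\
    forall z, enorm z <= rho -> u z - lam / 2 * dot (z - xi) (z - xi) <= U xi) ->
  forall x y, enorm x <= K -> enorm y <= K ->
    `|U x - U y| <= lam * (rho + K) * enorm (x - y).
Proof.
move=> lam0 hU.
have H x y : enorm x <= K -> enorm y <= K ->
    U x - U y <= lam * (rho + K) * enorm (x - y).
  move=> xK yK; have [[z zr ->] _] := hU x; have [_ /(_ z zr)] := hU y.
  have : dot (z - y) (z - y) - dot (z - x) (z - x) <=
      2 * (rho + K) * enorm (x - y).
    have -> : dot (z - y) (z - y) - dot (z - x) (z - x) =
        dot (x - y) (2 *: z - x - y).
      by rewrite !dot_sqrB !(dotBl, dotBr, dotZr, dotZl) (dotC x z) (dotC x y) (dotC y z); ring.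
    apply: le_trans (dot_le _ _) _; rewrite mulrC ler_wpM2r ?enorm_ge0//.
    rewrite (_ : 2 *: z - x - y = (z - x) + (z - y)); last first.
      by apply/rowP => i; rewrite !mxE; ring.
    have := enormD (z - x) (z - y); have := enormD z (- x).
    have := enormD z (- y); rewrite !enormN; lra.
  move=> h1 h2; have := ler_wpM2l lam0 h1; lra.
move=> x y xK yK; rewrite ler_norml H// andbT.
by have := H _ _ yK xK; rewrite enorm_distC; lra.
Qed.

(* Completing the square in [z - xi]. *)
Lemma quad_supconv_le n (Q : 'M[R]_n) (q lam : R) : Q^T = Q -> q < lam ->
  (forall w, dot (w *m Q) w <= q * dot w w) ->
  forall z xi, dot (z *m Q) z / 2 - lam / 2 * dot (z - xi) (z - xi) <=
    dot (xi *m (Q + (lam - q)^-1 *: (Q *m Q))) xi / 2.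
Proof.
move=> sQ qlam hq z xi.
have -> : dot (xi *m (Q + (lam - q)^-1 *: (Q *m Q))) xi =
    dot (xi *m Q) xi + (lam - q)^-1 * dot (xi *m Q) (xi *m Q).
  by rewrite mulmxDr dotDl -scalemxAr dotZl mulmxA (dot_mulmx (xi *m Q)) sQ.
have [w wE] : exists w, w = z - xi by eexists.
rewrite -wE; have -> : z = xi + w by rewrite wE addrC subrK.
rewrite dot_quadD//.
set v := xi *m Q; have d0 : 0 < lam - q by rewrite subr_gt0.
have := hq w; have := dot_ge0 (v - (lam - q) *: w).
rewrite dot_sqrB !dotZr dotZl => h1 h2.
have : dot v w <= (lam - q)^-1 * dot v v / 2 + (lam - q) * dot w w / 2.
  have -> : (lam - q)^-1 * dot v v / 2 + (lam - q) * dot w w / 2 =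
    (dot v v + (lam - q) * ((lam - q) * dot w w)) / (2 * (lam - q)).
    by field; rewrite gt_eqF.
  by rewrite ler_pdivlMr ?mulr_gt0//; lra.
lra.
Qed.

End SupConvolution.

(** * Theorem on sums under a quadratic majorant *)

Section TheoremOnSums.
Context {R : realType}.

Lemma trace_col_mx_congr m1 m2 n (A : 'M[R]_(m1, n)) (B : 'M[R]_(m2, n)) X :
  \tr (col_mx A B *m X *m (col_mx A B)^T) =
  \tr (A *m X *m A^T) + \tr (B *m X *m B^T).
Proof. by rewrite mul_col_mx tr_col_mx mul_col_row mxtrace_block. Qed.

Lemma enorm_row_mx m n (x : 'rV[R]_m) (y : 'rV[R]_n) :
  enorm (row_mx x y) <= enorm x + enorm y.
Proof.
rewrite -ler_sqr ?nnegrE ?addr_ge0 ?enorm_ge0// sqr_enorm dot_row_mx sqrrD.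
rewrite !sqr_enorm; have : 0 <= enorm x * enorm y by rewrite mulr_ge0 ?enorm_ge0.
lra.
Qed.

(* A function with constant Laplacian strictly between the two sup-convolutions
   on a small sphere separates them at the centre, where they touch. *)
Lemma separation_absurd D N (v1 v2 : 'rV[R]_D -> R) (Pt1 Pt2 : 'M[R]_(N, D))
    (Q : 'M[R]_(D + D)) (rho0 lam eta theta : R) :
  (0 < N)%N -> Q^T = Q -> 0 < rho0 -> 0 < lam -> 0 < eta ->
  continuous v1 -> continuous v2 ->
  (forall z1 z2 xi1 xi2, enorm z1 <= rho0 -> enorm z2 <= rho0 ->
     (v1 z1 - lam / 2 * dot (z1 - xi1) (z1 - xi1)) +
     (v2 z2 - lam / 2 * dot (z2 - xi2) (z2 - xi2)) <=
     dot (row_mx xi1 xi2 *m Q) (row_mx xi1 xi2) / 2) ->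
  (exists2 rb : R, 0 < rb & forall (rho : R) (h : 'rV[R]_N -> R),
    0 < rho -> rho <= rb -> has_laplacian h (fun=> theta) ->
    (forall zeta z, enorm zeta = rho -> enorm z <= rho0 ->
      v1 z - lam / 2 * dot (z - zeta *m Pt1) (z - zeta *m Pt1) < h zeta) ->
    0 < h 0) ->
  (exists2 rb : R, 0 < rb & forall (rho : R) (h : 'rV[R]_N -> R),
    0 < rho -> rho <= rb -> has_laplacian h
      (fun=> \tr (row_mx Pt1 Pt2 *m Q *m (row_mx Pt1 Pt2)^T + (2 * eta)%:M) - theta) ->
    (forall zeta z, enorm zeta = rho -> enorm z <= rho0 ->
      v2 z - lam / 2 * dot (z - zeta *m Pt2) (z - zeta *m Pt2) < h zeta) ->
    0 < h 0) -> False.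
Proof.
move=> N0 sQ rho00 lam0 eta0 cv1 cv2 hQ [rb1 rb10 C1] [rb2 rb20 C2].
set M := row_mx Pt1 Pt2 *m Q *m (row_mx Pt1 Pt2)^T + (2 * eta)%:M in C2.
have sM : M^T = M.
  by rewrite linearD/= !trmx_mul trmxK sQ mulmxA tr_scalar_mx.
pose m (zeta : 'rV[R]_N) := dot (zeta *m M) zeta / 2.
have mE zeta : m zeta = dot (row_mx (zeta *m Pt1) (zeta *m Pt2) *m Q)
    (row_mx (zeta *m Pt1) (zeta *m Pt2)) / 2 + eta * dot zeta zeta.
  rewrite /m /M mulmxDr mul_mx_scalar dotDl dotZl -mul_mx_row.
  rewrite !mulmxA (dot_mulmx (zeta *m _ *m Q)) trmxK; by field.
have lapm : has_laplacian m (fun=> \tr M).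
  by move=> x; exists (x *m M), M; split=> //; exact: jet_quad.
pose rho := Num.min rb1 rb2.
have rho1 : 0 < rho by rewrite lt_min rb10.
have [U1 hU1] := supconv_exists lam rho00 cv1.
have [U2 hU2] := supconv_exists lam rho00 cv2.
have U12 zeta : U1 (zeta *m Pt1) + U2 (zeta *m Pt2) <= m zeta - eta * dot zeta zeta.
  have [[z1 z1r ->] _] := hU1 (zeta *m Pt1).
  have [[z2 z2r ->] _] := hU2 (zeta *m Pt2).
  by rewrite mE addrK; exact: hQ.
pose f zeta := (U1 (zeta *m Pt1) - U2 (zeta *m Pt2) + m zeta) / 2.
have [L L0 fL] : exists2 L : R, 0 < L & forall x y : 'rV[R]_N,
    (forall i, `|x 0 i| <= rho) -> (forall i, `|y 0 i| <= rho) ->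
    `|f x - f y| <= L * enorm (x - y).
  have [K1 K10 hK1] := mulmx_bounded Pt1.
  have [K2 K20 hK2] := mulmx_bounded Pt2.
  have [K3 K30 hK3] := mulmx_bounded M.
  pose B := N%:R * rho.
  have bB (x : 'rV[R]_N) : (forall i, `|x 0 i| <= rho) -> enorm x <= B.
    move=> h; apply: le_trans (enorm_le_sum _) _.
    apply: le_trans (ler_sum _ (fun i _ => h i)) _.
    by rewrite sumr_const card_ord /B mulr_natl.
  have B0 : 0 <= B by rewrite mulr_ge0// ltW.
  pose L1 := lam * (rho0 + K1 * B) * K1; pose L2 := lam * (rho0 + K2 * B) * K2.
  pose L3 := K3 * B.
  have A10 : 0 <= rho0 + K1 * B := addr_ge0 (ltW rho00) (mulr_ge0 (ltW K10) B0).
  have L10 : 0 <= L1 := mulr_ge0 (mulr_ge0 (ltW lam0) A10) (ltW K10).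
  have A20 : 0 <= rho0 + K2 * B := addr_ge0 (ltW rho00) (mulr_ge0 (ltW K20) B0).
  have L20 : 0 <= L2 := mulr_ge0 (mulr_ge0 (ltW lam0) A20) (ltW K20).
  have L30 : 0 <= L3 by rewrite mulr_ge0// ltW.
  exists (L1 + L2 + L3 + 1) => [|x y /bB xB /bB yB]; first by lra.
  have kb (K : R) (P : 'M[R]_(N, D)) : 0 < K -> (forall x, enorm (x *m P) <= K * enorm x) ->
      forall x, enorm x <= B -> enorm (x *m P) <= K * B.
    by move=> K0 hK z zB; rewrite (le_trans (hK z))// ler_wpM2l// ltW.
  have h1 : `|U1 (x *m Pt1) - U1 (y *m Pt1)| <= L1 * enorm (x - y).
    apply: le_trans (supconv_lip (ltW lam0) hU1 (kb _ _ K10 hK1 _ xB) (kb _ _ K10 hK1 _ yB)) _.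
    rewrite -mulmxBl /L1 -[leRHS]mulrA.
    exact: ler_wpM2l (mulr_ge0 (ltW lam0) A10) _ _ (hK1 _).
  have h2 : `|U2 (x *m Pt2) - U2 (y *m Pt2)| <= L2 * enorm (x - y).
    apply: le_trans (supconv_lip (ltW lam0) hU2 (kb _ _ K20 hK2 _ xB) (kb _ _ K20 hK2 _ yB)) _.
    rewrite -mulmxBl /L2 -[leRHS]mulrA.
    exact: ler_wpM2l (mulr_ge0 (ltW lam0) A20) _ _ (hK2 _).
  have h3 : `|m x - m y| <= L3 * enorm (x - y).
    have -> : m x - m y = dot ((x + y) *m M) (x - y) / 2.
      rewrite /m mulmxDl dotDl !dotBr (dot_mulmx_sym x y sM); ring.
    rewrite normrM [`|2^-1|]ger0_norm// ler_pdivrMr//.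
    apply: le_trans (dot_le_enorm _ _) _.
    rewrite mulrAC ler_wpM2r ?enorm_ge0//.
    apply: le_trans (hK3 _) _; rewrite /L3 -mulrA ler_wpM2l ?(ltW K30)//.
    by have := enormD x y; lra.
  have -> : f x - f y = ((U1 (x *m Pt1) - U1 (y *m Pt1)) -
      (U2 (x *m Pt2) - U2 (y *m Pt2)) + (m x - m y)) / 2 by rewrite /f; field.
  rewrite normrM [`|2^-1|]ger0_norm// ler_pdivrMr//.
  apply: le_trans (ler_normD _ _) _; apply: le_trans (lerD (ler_normB _ _) (lexx _)) _.
  apply: le_trans (lerD (lerD h1 h2) h3) _.
  by have := enorm_ge0 (x - y); move: (enorm _) => e e0; nra.
have er0 : 0 < eta * rho ^+ 2 / 4 by rewrite divr_gt0// mulr_gt0// exprn_gt0.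
have [h lh hf] := dirichlet_approx theta N0 rho1 L0 er0 fL.
have gap zeta : enorm zeta = rho -> U1 (zeta *m Pt1) < h zeta /\
    U2 (zeta *m Pt2) < m zeta - h zeta.
  move=> zr; have := hf _ zr; have := U12 zeta; rewrite -sqr_enorm zr /f.
  rewrite ler_norml => h1 /andP[h2 h3]; split; lra.
have h1 : 0 < h 0.
  apply: (C1 rho) => //; first by rewrite ge_min lexx.
  move=> zeta z /gap[g1 _] zr; apply: le_lt_trans g1.
  by have [_] := hU1 (zeta *m Pt1); exact.
have : 0 < m 0 - h 0.
  apply: (C2 rho (fun z => m z - h z)) => //.
  - by rewrite ge_min lexx orbT.
  - apply: has_laplacian_ext (has_laplacianD lapm (has_laplacianZ (-1) lh)) => x;
    by rewrite mulN1r.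
  - move=> zeta z /gap[_ g2] zr; apply: le_lt_trans g2.
    by have [_] := hU2 (zeta *m Pt2); exact.
by rewrite /m mul0mx dot0l mul0r sub0r oppr_gt0 ltNge (ltW h1).
Qed.

(** A violation [E] of the inequality is spent in eighths: on completing the square, on the
    regularising noise, on the strictness [eta], and on the choice of [theta]. *)
Lemma theorem_on_sums_quad D n (v1 v2 : 'rV[R]_D -> R)
    (beta1 beta2 : 'rV[R]_D -> 'rV[R]_D) (A1 A2 : 'rV[R]_D -> 'M[R]_D)
    (p1 p2 : 'rV[R]_D) (P1 P2 : 'M[R]_(n, D)) (Q : 'M[R]_(D + D)) (rho0 : R) :
  (0 < D)%N -> Q^T = Q -> 0 < rho0 ->
  continuous v1 -> continuous v2 -> v1 0 = 0 -> v2 0 = 0 ->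
  (forall z1 z2, enorm z1 <= rho0 -> enorm z2 <= rho0 ->
     v1 z1 + v2 z2 <= dot (row_mx z1 z2 *m Q) (row_mx z1 z2) / 2) ->
  (forall z p X, enorm z < rho0 -> ujet v1 z p X ->
     dot (beta1 z) (p1 + p) <= \tr (A1 z *m X)) ->
  (forall z p X, enorm z < rho0 -> ujet v2 z p X ->
     dot (beta2 z) (p2 + p) <= \tr (A2 z *m X)) ->
  (forall e : R, 0 < e -> exists2 de : R, 0 < de &
     forall z, enorm z <= de -> enorm (beta1 z - beta1 0) <= e) ->
  (forall e : R, 0 < e -> exists2 de : R, 0 < de &
     forall z, enorm z <= de -> enorm (beta2 z - beta2 0) <= e) ->
  (forall e : R, 0 < e -> exists2 de : R, 0 < de &
     forall z, enorm z <= de -> forall i j, `|A1 z i j - A1 0 i j| <= e) ->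
  (forall e : R, 0 < e -> exists2 de : R, 0 < de &
     forall z, enorm z <= de -> forall i j, `|A2 z i j - A2 0 i j| <= e) ->
  A1 0 = P1^T *m P1 -> A2 0 = P2^T *m P2 ->
  dot (beta1 0) p1 + dot (beta2 0) p2 <=
    \tr (row_mx P1 P2 *m Q *m (row_mx P1 P2)^T).
Proof.
move=> D0 sQ rho00 cv1 cv2 v10 v20 hQ vis1 vis2 cb1 cb2 cA1 cA2 E1 E2.
rewrite leNgt; apply/negP => gap.
pose G := row_mx P1 P2; pose J : 'M[R]_(D, D + D) := row_mx 1%:M 1%:M.
set b1 := dot (beta1 0) p1 in gap; set b2 := dot (beta2 0) p2 in gap.
set S := \tr _ in gap.
pose E := b1 + b2 - S; have E0 : 0 < E by rewrite subr_gt0.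
have [q q0 hq] := quad_bounded Q.
have hq' w : dot (w *m Q) w <= q * dot w w := le_trans (ler_norm _) (hq w).
pose tQQ := \tr (G *m (Q *m Q) *m G^T).
(* Large enough for [quad_supconv_le] and [viscosity_comparison], and for the correction
   [(lam - q)^-1 Q^2] to cost at most [E / 8]. *)
pose lam := 4 * q + 1 + 8 * `|tQQ| / E.
have tQQE : 0 <= 8 * `|tQQ| / E by rewrite divr_ge0 ?mulr_ge0// ltW.
have lam0 : 0 < lam by rewrite /lam; lra.
have lamq : 4 * q <= lam by rewrite /lam; lra.
have qlam : q < lam by rewrite /lam; lra.
pose Q' := Q + (lam - q)^-1 *: (Q *m Q).
have sQ' : Q'^T = Q' by rewrite linearD/= linearZ/= trmx_mul sQ.
have trQ' : \tr (G *m Q' *m G^T) <= S + E / 8.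
  rewrite /Q' mulmxDr mulmxDl mxtraceD -scalemxAr -scalemxAl mxtraceZ lerD2l.
  rewrite mulrC ler_pdivrMr ?subr_gt0// -/tQQ.
  have h1 := ler_norm tQQ.
  have : E / 8 * (8 * `|tQQ| / E) <= E / 8 * (lam - q).
    by rewrite ler_wpM2l ?divr_ge0 ?(ltW E0)//; rewrite /lam; lra.
  have -> : E / 8 * (8 * `|tQQ| / E) = `|tQQ| by field; rewrite gt_eqF.
  exact: le_trans.
pose tJ := `|\tr (J *m Q' *m J^T)|.
pose Kd := 2 * D%:R * lam + tJ + 1.
have DR0 : 0 < D%:R :> R by rewrite ltr0n.
have Kd0 : 0 < Kd.
  have : 0 < 2 * D%:R * lam by rewrite !mulr_gt0.
  by have := normr_ge0 (\tr (J *m Q' *m J^T)); rewrite /Kd /tJ; lra.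
pose kappa := E / (8 * Kd).
have kappa0 : 0 < kappa by rewrite divr_gt0// mulr_gt0.
have kappaKd : kappa * Kd = E / 8 by rewrite /kappa; field; rewrite gt_eqF.
(* Both factors receive the same block [sk%:M]: the Gram matrices gain [kappa], and this common
   noise adds only [kappa] times the trace along [J] to the total. *)
pose sk := Num.sqrt kappa.
have sk2 : sk * sk = kappa by rewrite -expr2 sqr_sqrtr// ltW.
pose Pt1 := col_mx sk%:M P1 : 'M[R]_(D + n, D).
pose Pt2 := col_mx sk%:M P2 : 'M[R]_(D + n, D).
have PP1 : Pt1^T *m Pt1 = kappa%:M + A1 0.
  by rewrite tr_col_mx mul_row_col tr_scalar_mx -scalar_mxM sk2 E1.
have PP2 : Pt2^T *m Pt2 = kappa%:M + A2 0.
  by rewrite tr_col_mx mul_row_col tr_scalar_mx -scalar_mxM sk2 E2.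
pose Gt := row_mx Pt1 Pt2.
have GtE : Gt = col_mx (sk *: J) G.
  rewrite /Gt /Pt1 /Pt2 -block_mxEh block_mxEv; congr (col_mx _ _).
  by rewrite /J scale_row_mx !scalemx1.
pose N := (D + n)%N.
pose eta := E / (16 * (N%:R + 1)).
have N0 : 0 <= N%:R :> R by [].
have eta0 : 0 < eta by rewrite divr_gt0// mulr_gt0// ltr_wpDl.
have etaN : 2 * eta * N%:R <= E / 8.
  have N1 : 0 < N%:R + 1 :> R by rewrite ltr_wpDl.
  have -> : 2 * eta * N%:R = E / 8 * (N%:R / (N%:R + 1)).
    by rewrite /eta; field; rewrite gt_eqF.
  by rewrite ler_piMr ?divr_ge0 ?(ltW E0)// ler_pdivrMr// mul1r lerDl.
pose M := Gt *m Q' *m Gt^T + (2 * eta)%:M.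
have sM : M^T = M.
  by rewrite linearD/= !trmx_mul trmxK sQ' mulmxA tr_scalar_mx.
have trM : \tr M <= S + E / 8 + kappa * tJ + E / 8.
  rewrite mxtraceD mxtrace_scalar -[X in _ + X]mulr_natr; apply: lerD => //.
  rewrite GtE trace_col_mx_congr addrC; apply: lerD => //.
  rewrite linearZ/= -scalemxAr -!scalemxAl scalerA sk2 mxtraceZ.
  by rewrite ler_wpM2l ?(ltW kappa0)// ler_norm.
(* The Laplacian [\tr M] is shared out: [theta] lies just below what the first inequality tolerates,
   and the rest remains below [b2]. *)
pose theta := b1 - kappa * D%:R * lam - E / 8.
have gap1 : theta + kappa * D%:R * lam < b1 by rewrite /theta; lra.
have gap2 : (\tr M - theta) + kappa * D%:R * lam < b2.
  have : 2 * (kappa * D%:R * lam) + kappa * tJ + kappa = E / 8.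
    by rewrite -kappaKd /Kd; ring.
  have h := trM; rewrite /theta; rewrite /E in h *.
  lra.
have hq1 z : enorm z <= rho0 -> v1 z <= q / 2 * dot z z.
  move=> zr; have := hQ z 0 zr; rewrite enorm0 (ltW rho00) v20 addr0 => /(_ isT) h.
  have := hq' (row_mx z 0); rewrite dot_row_mx dot0l addr0; lra.
have hq2 z : enorm z <= rho0 -> v2 z <= q / 2 * dot z z.
  move=> zr; have := hQ 0 z; rewrite enorm0 (ltW rho00) v10 add0r => /(_ isT zr) h.
  have := hq' (row_mx 0 z); rewrite dot_row_mx dot0l add0r; lra.
have N00 : (0 < N)%N by rewrite addn_gt0 D0.
apply: (@separation_absurd D N v1 v2 Pt1 Pt2 Q' rho0 lam eta theta) => //.
- move=> z1 z2 xi1 xi2 z1r z2r.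
  have := quad_supconv_le sQ qlam hq' (row_mx z1 z2) (row_mx xi1 xi2).
  rewrite opp_row_mx add_row_mx dot_row_mx; have := hQ _ _ z1r z2r; lra.
- exact: (viscosity_comparison cv1 v10 rho00 (ltW q0) lam0 lamq kappa0 hq1 vis1
    cb1 cA1 E1 PP1 gap1).
- exact: (viscosity_comparison cv2 v20 rho00 (ltW q0) lam0 lamq kappa0 hq2 vis2
    cb2 cA2 E2 PP2 gap2).
Qed.

End TheoremOnSums.

Section TheoremOnSumsJet.
Context {R : realType}.

Lemma ujet_translate n (u : 'rV[R]_n -> R) x0 c p0 z p X :
  ujet (fun w => u (x0 + w) - c - dot p0 w) z p X -> ujet u (x0 + z) (p0 + p) X.
Proof.
move=> [sX h]; split=> // e /h[de de0 H]; exists de => // w /H.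
by rewrite !addrA dotDr !dotDl -!addrA; lra.
Qed.

(** Translation to the origin, subtraction of the linear part and enlarging [X] by [2 e'] reduce to
    a quadratic majorant. The conclusion is already traced; the common noise space [n] is where a
    coupling enters, through the choice of the factors [P1], [P2]. *)
Theorem theorem_on_sums D n (u1 u2 : 'rV[R]_D -> R)
    (beta1 beta2 : 'rV[R]_D -> 'rV[R]_D) (A1 A2 : 'rV[R]_D -> 'M[R]_D)
    (x1 x2 p1 p2 : 'rV[R]_D) (P1 P2 : 'M[R]_(n, D)) (X : 'M[R]_(D + D))
    (F : 'rV[R]_(D + D) -> R) (r0 : R) :
  (0 < D)%N -> 0 < r0 -> continuous u1 -> continuous u2 ->
  ujet F (row_mx x1 x2) (row_mx p1 p2) X ->
  (forall w1 w2, enorm w1 <= r0 -> enorm w2 <= r0 ->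
     u1 (x1 + w1) + u2 (x2 + w2) - F (row_mx (x1 + w1) (x2 + w2)) <=
     u1 x1 + u2 x2 - F (row_mx x1 x2)) ->
  (forall z p Y, enorm (z - x1) < r0 -> ujet u1 z p Y ->
     dot (beta1 z) p <= \tr (A1 z *m Y)) ->
  (forall z p Y, enorm (z - x2) < r0 -> ujet u2 z p Y ->
     dot (beta2 z) p <= \tr (A2 z *m Y)) ->
  (forall e : R, 0 < e -> exists2 de : R, 0 < de &
     forall z, enorm (z - x1) <= de -> enorm (beta1 z - beta1 x1) <= e) ->
  (forall e : R, 0 < e -> exists2 de : R, 0 < de &
     forall z, enorm (z - x2) <= de -> enorm (beta2 z - beta2 x2) <= e) ->
  (forall e : R, 0 < e -> exists2 de : R, 0 < de &
     forall z, enorm (z - x1) <= de -> forall i j, `|A1 z i j - A1 x1 i j| <= e) ->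
  (forall e : R, 0 < e -> exists2 de : R, 0 < de &
     forall z, enorm (z - x2) <= de -> forall i j, `|A2 z i j - A2 x2 i j| <= e) ->
  A1 x1 = P1^T *m P1 -> A2 x2 = P2^T *m P2 ->
  dot (beta1 x1) p1 + dot (beta2 x2) p2 <=
    \tr (row_mx P1 P2 *m X *m (row_mx P1 P2)^T).
Proof.
move=> D0 r00 cu1 cu2 [sX hF] hmax vis1 vis2 cb1 cb2 cA1 cA2 E1 E2.
set G := row_mx P1 P2.
apply/ler_addgt0Pl => e e0.
pose t := `|\tr (G *m G^T)| + 1.
have t0 : 0 < t by rewrite ltr_wpDl.
pose e' := e / (2 * t).
have e'0 : 0 < e' by rewrite divr_gt0// mulr_gt0.
have [de de0 hde] := hF _ e'0.
pose rho0 := Num.min r0 (de / 2).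
have rho00 : 0 < rho0 by rewrite lt_min r00/= divr_gt0.
pose v u x p (w : 'rV[R]_D) : R := u (x + w) - u x - dot p w.
have cv u x p : continuous u -> continuous (v u x p).
  move=> cu; apply: continuous_subr.
    apply: continuous_subr; last by move=> ?; exact: cst_continuous.
    apply: continuous_compr => // w; apply: continuousD; last exact: cvg_id.
    exact: cst_continuous.
  by apply: continuous_dot => w; [exact: cst_continuous|exact: cvg_id].
have v0 u x p : v u x p 0 = 0 by rewrite /v addr0 subrr dot0r subr0.
have sQ : (X + (2 * e')%:M)^T = X + (2 * e')%:M by rewrite linearD/= sX tr_scalar_mx.
have bnd z x : enorm z < rho0 -> enorm (x + z - x) < r0.
  by rewrite addrAC subrr add0r => /lt_le_trans; apply; rewrite ge_min lexx.
have := @theorem_on_sums_quad R D n (v u1 x1 p1) (v u2 x2 p2)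
  (fun z => beta1 (x1 + z)) (fun z => beta2 (x2 + z))
  (fun z => A1 (x1 + z)) (fun z => A2 (x2 + z)) p1 p2 P1 P2 _ rho0 D0 sQ rho00
  (cv _ _ _ cu1) (cv _ _ _ cu2) (v0 _ _ _) (v0 _ _ _).
rewrite !addr0 => H; apply: le_trans (H _ _ _ _ _ _ _ E1 E2) _.
- move=> z1 z2; rewrite !le_min => /andP[z11 z12] /andP[z21 z22].
  have zz : enorm (row_mx z1 z2) <= de.
    by apply: le_trans (enorm_row_mx _ _) _; lra.
  have := hmax _ _ z11 z21; have := hde _ zz.
  rewrite add_row_mx (dot_row_mx p1) /v mulmxDr mul_mx_scalar dotDl dotZl; lra.
- by move=> z p Y zr /ujet_translate; apply: vis1; exact: bnd.
- by move=> z p Y zr /ujet_translate; apply: vis2; exact: bnd.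
- move=> d /cb1[k k0 h]; exists k => // z zk; apply: h.
  by rewrite addrAC subrr add0r.
- move=> d /cb2[k k0 h]; exists k => // z zk; apply: h.
  by rewrite addrAC subrr add0r.
- move=> d /cA1[k k0 h]; exists k => // z zk; apply: h.
  by rewrite addrAC subrr add0r.
- move=> d /cA2[k k0 h]; exists k => // z zk; apply: h.
  by rewrite addrAC subrr add0r.
rewrite mulmxDr mulmxDl mxtraceD mul_mx_scalar -scalemxAl mxtraceZ -/G.
rewrite addrC lerD2r.
have -> : e = 2 * e' * t by rewrite /e'; field; rewrite gt_eqF.
apply: ler_wpM2l; first by rewrite mulr_ge0// ltW.
by rewrite /t; have := ler_norm (\tr (G *m G^T)); lra.
Qed.

End TheoremOnSumsJet.

(** * Viscosity inequalities for jets *)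

Section TestFunctions.
Context {R : realType} {d : nat}.
Implicit Types (f : R -> 'rV[R]_d -> R) (t : R) (x : 'rV[R]_d).

Lemma is_derive_affine (V : normedModType R) (f : V -> R) (x v : V) (c : R) :
  (forall h, f (h *: v + x) - f x = h * c) -> is_derive x v f c.
Proof.
move=> H.
have cv : h^-1 *: ((f \o shift x) (h *: v) - f x) @[h --> 0^'] --> c.
  apply: cvg_near_cst; near=> h.
  have h0 : h != 0 by near: h; exact: nbhs_dnbhs_neq.
  by rewrite /= H /GRing.scale/= mulKf.
apply: DeriveDef; first by apply/cvg_ex; exists c.
exact: cvg_lim.
Unshelve. all: by end_near. Qed.

Definition jointly_continuous f := continuous (fun p : R * 'rV[R]_d => f p.1 p.2).

(** A global strengthening of [C12] carrying the derivatives as data, so that test functions can be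
    built by sums and products. *)
Definition smooth12 f ft (fi : 'I_d -> R -> 'rV[R]_d -> R)
    (fij : 'I_d -> 'I_d -> R -> 'rV[R]_d -> R) :=
  [/\ forall t x, is_derive t 1 (f^~ x) (ft t x),
      forall i t x, is_derive x (delta_mx 0 i) (f t) (fi i t x),
      forall i j t x, is_derive x (delta_mx 0 i) (fi j t) (fij i j t x) &
      [/\ jointly_continuous f, jointly_continuous ft,
          forall i, jointly_continuous (fi i) &
          forall i j, jointly_continuous (fij i j)]].

Lemma smooth12_C12 T f ft fi fij : smooth12 f ft fi fij -> C12 T f.
Proof.
move=> [ht hx hxx [cf ct cx cxx]].
have pE j t : partial j (f t) = fi j t.
  by apply/funext => x; have [_ <-] := hx j t x.
split.
- by move=> p _; exact: cf.
- split=> [p _|p _]; first by have [] := ht p.1 p.2.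
  rewrite (_ : (fun p => _) = (fun p => ft p.1 p.2)); first exact: ct.
  by apply/funext => q; rewrite derive1E; have [_ <-] := ht q.1 q.2.
- move=> i; split=> [p _|p _]; first by have [] := hx i p.1 p.2.
  rewrite (_ : (fun p => _) = (fun p => fi i p.1 p.2)); first exact: cx.
  by apply/funext => q; rewrite pE.
- move=> i j; split=> [p _|p _].
    by rewrite pE; have [] := hxx i j p.1 p.2.
  rewrite (_ : (fun p => _) = (fun p => fij i j p.1 p.2)); first exact: cxx.
  by apply/funext => q; rewrite pE /partial; have [_ <-] := hxx i j q.1 q.2.
Qed.

Lemma smooth12_op l lambda0 (Sigma : 'rV[R]_d -> 'M[R]_(d, l)) b f ft fi fij t x :
  smooth12 f ft fi fij ->
  parabolic_op lambda0 Sigma b f t x = ft t x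
    - lambda0 * (\sum_i fij i i t x)
    - \tr (Sigma x *m (Sigma x)^T *m \matrix_(i, j) fij i j t x)
    + dot (b t x) (\row_i fi i t x).
Proof.
move=> [ht hx hxx _].
have pE j : partial j (f t) = fi j t.
  by apply/funext => y; have [_ <-] := hx j t y.
have ppE i j : partial i (partial j (f t)) x = fij i j t x.
  by rewrite pE /partial; have [_ <-] := hxx i j t x.
rewrite /parabolic_op /L0 /laplacian derive1E.
have [_ ->] := ht t x.
have -> : hessian (f t) x = \matrix_(i, j) fij i j t x.
  by apply/matrixP => i j; rewrite !mxE ppE.
have -> : grad (f t) x = \row_i fi i t x by apply/rowP => i; rewrite !mxE pE.
under eq_bigr do rewrite ppE.
by rewrite mulNr addrA.
Qed.

Lemma smooth12_cst (c : R) : smooth12 (fun _ _ => c) (fun _ _ => 0)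
  (fun _ _ _ => 0) (fun _ _ _ _ => 0).
Proof.
split=> [t x|i t x|i j t x|]; try exact: is_derive_cst.
by split=> *; exact: cst_continuous.
Qed.

Lemma smooth12D f ft fi fij (g : R -> 'rV[R]_d -> R) gt gi gij :
  smooth12 f ft fi fij -> smooth12 g gt gi gij ->
  smooth12 (fun t x => f t x + g t x) (fun t x => ft t x + gt t x)
    (fun i t x => fi i t x + gi i t x) (fun i j t x => fij i j t x + gij i j t x).
Proof.
move=> [ht hx hxx [cf ct cx cxx]] [kt kx kxx [cg dt dx dxx]].
split=> [t x|i t x|i j t x|].
- exact: (is_deriveD (ht t x) (kt t x)).
- exact: (is_deriveD (hx i t x) (kx i t x)).
- exact: (is_deriveD (hxx i j t x) (kxx i j t x)).
- by split=> *; apply: continuous_addr => //; [exact: cx|exact: dx|exact: cxx|exact: dxx].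
Qed.

Lemma smooth12M f ft fi fij (g : R -> 'rV[R]_d -> R) gt gi gij :
  smooth12 f ft fi fij -> smooth12 g gt gi gij ->
  smooth12 (fun t x => f t x * g t x)
    (fun t x => f t x * gt t x + g t x * ft t x)
    (fun i t x => f t x * gi i t x + g t x * fi i t x)
    (fun i j t x => (f t x * gij i j t x + gi j t x * fi i t x) +
                    (g t x * fij i j t x + fi j t x * gi i t x)).
Proof.
move=> [ht hx hxx [cf ct cx cxx]] [kt kx kxx [cg dt dx dxx]].
split=> [t x|i t x|i j t x|].
- exact: (is_deriveM (ht t x) (kt t x)).
- exact: (is_deriveM (hx i t x) (kx i t x)).
- exact: (is_deriveD (is_deriveM (hx i t x) (kxx i j t x))
    (is_deriveM (kx i t x) (hxx i j t x))).
- split=> [||i|i j].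
  + exact: continuous_mulr cf cg.
  + exact: continuous_addr (continuous_mulr cf dt) (continuous_mulr cg ct).
  + exact: continuous_addr (continuous_mulr cf (dx i)) (continuous_mulr cg (cx i)).
  + exact: continuous_addr
      (continuous_addr (continuous_mulr cf (dxx i j)) (continuous_mulr (dx j) (cx i)))
      (continuous_addr (continuous_mulr cg (cxx i j)) (continuous_mulr (cx j) (dx i))).
Qed.

Lemma smooth12_time (c : R) : smooth12 (fun t _ => t - c) (fun _ _ => 1)
  (fun _ _ _ => 0) (fun _ _ _ _ => 0).
Proof.
split=> [t x|i t x|i j t x|]; try exact: is_derive_cst.
- by apply: is_derive_affine => h; rewrite /GRing.scale/= mulr1; ring.
- split=> *; try exact: cst_continuous.
  apply: continuous_subr; last exact: cst_continuous.
  by move=> p; exact: cvg_fst.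
Qed.

Lemma smooth12_coord k (c : R) : smooth12 (fun _ x => x 0 k - c) (fun _ _ => 0)
  (fun i _ _ => (k == i)%:R) (fun _ _ _ _ => 0).
Proof.
split=> [t x|i t x|i j t x|]; try exact: is_derive_cst.
- by apply: is_derive_affine => h; rewrite !mxE eqxx/=; ring.
- split=> *; try exact: cst_continuous.
  apply: continuous_subr; last exact: cst_continuous.
  apply: (@continuous_compr _ _ _ snd (fun x : 'rV[R]_d => x 0 k)).
    by move=> p; exact: cvg_snd.
  exact: coord_continuous.
Qed.

(* [taylor12 t0 x0 f c a g H]: [f] is an admissible test function with value [c]
   at [(t0, x0)], time derivative [a], gradient [g] and Hessian [H] there. *)
Definition taylor12 t0 x0 f (c a : R) (g : 'I_d -> R)
    (H : 'I_d -> 'I_d -> R) :=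
  exists ft fi fij, [/\ smooth12 f ft fi fij, f t0 x0 = c, ft t0 x0 = a,
    forall i, fi i t0 x0 = g i & forall i j, fij i j t0 x0 = H i j].

Lemma taylor12_ext t0 x0 f (c a : R) g H c' a' g' H' :
  c = c' -> a = a' -> (forall i, g i = g' i) -> (forall i j, H i j = H' i j) ->
  taylor12 t0 x0 f c a g H -> taylor12 t0 x0 f c' a' g' H'.
Proof.
move=> <- <- gg HH [ft [fi [fij [s e1 e2 e3 e4]]]].
exists ft, fi, fij; split=> // i; first by rewrite -gg.
by move=> j; rewrite -HH.
Qed.

Lemma taylor12_cst t0 x0 c :
  taylor12 t0 x0 (fun _ _ => c) c 0 (fun=> 0) (fun _ _ => 0).
Proof. by do 3 eexists; split; first exact: smooth12_cst. Qed.

Lemma taylor12D t0 x0 f (c a : R) g H f' (c' a' : R) g' H' :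
  taylor12 t0 x0 f c a g H -> taylor12 t0 x0 f' c' a' g' H' ->
  taylor12 t0 x0 (fun t x => f t x + f' t x) (c + c') (a + a')
    (fun i => g i + g' i) (fun i j => H i j + H' i j).
Proof.
move=> [ft [fi [fij [s e1 e2 e3 e4]]]] [ft' [fi' [fij' [s' e1' e2' e3' e4']]]].
do 3 eexists; split; first exact: smooth12D s s'.
- by rewrite /= e1 e1'.
- by rewrite /= e2 e2'.
- by move=> i; rewrite /= e3 e3'.
- by move=> i j; rewrite /= e4 e4'.
Qed.

Lemma taylor12M t0 x0 f (c a : R) g H f' (c' a' : R) g' H' :
  taylor12 t0 x0 f c a g H -> taylor12 t0 x0 f' c' a' g' H' ->
  taylor12 t0 x0 (fun t x => f t x * f' t x) (c * c') (c * a' + c' * a)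
    (fun i => c * g' i + c' * g i)
    (fun i j => (c * H' i j + g' j * g i) + (c' * H i j + g j * g' i)).
Proof.
move=> [ft [fi [fij [s e1 e2 e3 e4]]]] [ft' [fi' [fij' [s' e1' e2' e3' e4']]]].
do 3 eexists; split; first exact: smooth12M s s'.
- by rewrite /= e1 e1'.
- by rewrite /= e1 e2 e1' e2'.
- by move=> i; rewrite /= e1 e3 e1' e3'.
- by move=> i j; rewrite /= e1 e4 e1' e4' !e3 !e3'.
Qed.

Lemma taylor12_sum t0 x0 (I : Type) (s : seq I) (F : I -> R -> 'rV[R]_d -> R)
    (c a : I -> R) (g : I -> 'I_d -> R) (H : I -> 'I_d -> 'I_d -> R) :
  (forall k, taylor12 t0 x0 (F k) (c k) (a k) (g k) (H k)) ->
  taylor12 t0 x0 (fun t x => \sum_(k <- s) F k t x) (\sum_(k <- s) c k)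
    (\sum_(k <- s) a k) (fun i => \sum_(k <- s) g k i)
    (fun i j => \sum_(k <- s) H k i j).
Proof.
move=> h; elim: s => [|k s IH].
  have E : (fun (t : R) (x : 'rV[R]_d) => \sum_(k <- [::]) F k t x) = (fun _ _ => 0).
    by apply/funext => t; apply/funext => x; rewrite big_nil.
  rewrite E; apply: taylor12_ext (taylor12_cst t0 x0 0) => *; by rewrite big_nil.
have E : (fun (t : R) (x : 'rV[R]_d) => \sum_(k <- k :: s) F k t x) =
    (fun t x => F k t x + \sum_(k <- s) F k t x).
  by apply/funext => t; apply/funext => x; rewrite big_cons.
by rewrite E; apply: taylor12_ext (taylor12D (h k) IH) => *; rewrite big_cons.
Qed.

End TestFunctions.

(** * Space-time formulation: from global test functions to superjets *)

Section ViscosityJets.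
Context {R : realType} {d : nat}.
Implicit Types (t : R) (x : 'rV[R]_d) (z : 'rV[R]_(1 + d)).

(** Time is the first coordinate; below, [spacetime_drift] has component 1 along it and
    [spatial_diffusion] vanishes there. *)
Definition spacetime t x : 'rV[R]_(1 + d) := row_mx (t%:M : 'M[R]_1) x.

Lemma taylor12_spacetime t0 x0 (k : 'I_(1 + d)) :
  taylor12 t0 x0 (fun t x => (spacetime t x - spacetime t0 x0) 0 k)
    0 (k == lshift d 0)%:R (fun i => (k == rshift 1 i)%:R) (fun _ _ => 0).
Proof.
have [j ->|j ->] := split_ordP k.
  have -> : (fun t x => (spacetime t x - spacetime t0 x0) 0 (lshift d j)) =
      (fun t _ => t - t0).
    apply/funext => t; apply/funext => x; rewrite mxE [X in _ + X]mxE.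
    by rewrite !row_mxEl (ord1 j) !mxE.
  exists (fun _ _ => 1), (fun _ _ _ => 0), (fun _ _ _ _ => 0).
  split=> [|||i|//]; first exact: smooth12_time.
  - by rewrite subrr.
  - by rewrite (ord1 j) eqxx.
  - by rewrite eq_lrshift.
have -> : (fun t x => (spacetime t x - spacetime t0 x0) 0 (rshift 1 j)) =
    (fun _ x => x 0 j - x0 0 j).
  apply/funext => t; apply/funext => x; rewrite mxE [X in _ + X]mxE.
  by rewrite !row_mxEr.
exists (fun _ _ => 0), (fun i _ _ => (j == i)%:R), (fun _ _ _ _ => 0).
split=> [|||i|//]; first exact: smooth12_coord.
- by rewrite subrr.
- by rewrite eq_rlshift.
- by rewrite eq_rshift.
Qed.

Lemma sum_pred1 (I : finType) (F : I -> R) (i : I) :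
  \sum_k F k * (k == i)%:R = F i.
Proof.
rewrite (bigD1 i)//= eqxx mulr1 big1 ?addr0// => k /negbTE ->.
by rewrite mulr0.
Qed.

(** The last term has order at least 4 in [w], so it leaves the 2-jet alone while dominating any
    prescribed polynomial growth. *)
Lemma taylor12_quadratic t0 x0 (p : 'rV[R]_(1 + d)) (Q : 'M[R]_(1 + d))
    (N : R) (n : nat) :
  taylor12 t0 x0 (fun t x => let w := spacetime t x - spacetime t0 x0 in
      dot p w + dot (w *m Q) w / 2 + N * dot w w ^+ n.+2)
    0 (p 0 (lshift d 0)) (fun i => p 0 (rshift 1 i))
    (fun i j => (Q (rshift 1 i) (rshift 1 j) + Q (rshift 1 j) (rshift 1 i)) / 2).
Proof.
have hw := taylor12_spacetime t0 x0.
have hp := taylor12_sum (index_enum 'I_(1 + d))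
  (fun k => taylor12M (taylor12_cst t0 x0 (p 0 k)) (hw k)).
have hQ1 l := taylor12_sum (index_enum 'I_(1 + d))
  (fun k => taylor12M (hw k) (taylor12_cst t0 x0 (Q k l))).
have hQ := taylor12_sum (index_enum 'I_(1 + d))
  (fun l => taylor12M (hQ1 l) (hw l)).
have hS := taylor12_sum (index_enum 'I_(1 + d))
  (fun l => taylor12M (hw l) (hw l)).
have hS2 : taylor12 t0 x0 (fun t x => dot (spacetime t x - spacetime t0 x0)
    (spacetime t x - spacetime t0 x0) ^+ 2) 0 0 (fun=> 0) (fun _ _ => 0).
  have := taylor12M hS hS; apply: taylor12_ext.
  - by rewrite big1 ?mul0r// => k _; rewrite mul0r.
  - by rewrite big1 ?mul0r ?addr0// => k _; rewrite mul0r.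
  - by move=> i; rewrite big1 ?mul0r ?addr0// => k _; rewrite mul0r.
  - move=> i j; rewrite big1 => [|k _]; last by rewrite mul0r.
    rewrite !mul0r !add0r [X in X * _]big1 => [|k _]; last by rewrite !mul0r addr0.
    by rewrite mul0r addr0.
have hSn m : taylor12 t0 x0 (fun t x => dot (spacetime t x - spacetime t0 x0)
    (spacetime t x - spacetime t0 x0) ^+ m.+2) 0 0 (fun=> 0) (fun _ _ => 0).
  elim: m => [|m IH]; first exact: hS2.
  have E : (fun t x => dot (spacetime t x - spacetime t0 x0)
     (spacetime t x - spacetime t0 x0) ^+ m.+3) =
     (fun t x => (\sum_i (spacetime t x - spacetime t0 x0) 0 i *
        (spacetime t x - spacetime t0 x0) 0 i) * dot (spacetime t x - spacetime t0 x0)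
     (spacetime t x - spacetime t0 x0) ^+ m.+2).
    by apply/funext => t; apply/funext => x; rewrite exprS.
  rewrite E; have := taylor12M hS IH; apply: taylor12_ext.
  - by rewrite mulr0.
  - by rewrite mulr0 mul0r addr0.
  - by move=> i; rewrite mulr0 mul0r addr0.
  - by move=> i j; rewrite !mulr0 !mul0r !addr0.
have zz l : \sum_(k < 1 + d) 0 * Q k l = 0 by rewrite big1 // => k _; rewrite mul0r.
have := taylor12D (taylor12D hp (taylor12M hQ (taylor12_cst t0 x0 2^-1)))
  (taylor12M (taylor12_cst t0 x0 N) (hSn n)).
have E : forall (f g : R -> 'rV[R]_d -> R) c a gr H, (forall t x, f t x = g t x) ->
    taylor12 t0 x0 f c a gr H -> taylor12 t0 x0 g c a gr H.
  by move=> f g c a gr H fg; rewrite (_ : f = g)//; apply/funext => t; apply/funext.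
move=> h; apply: (E _ _ _ _ _ _ _ (taylor12_ext _ _ _ _ h)).
- move=> t x /=; congr (_ + _ / 2 + _).
  by apply: eq_bigr => l _; congr (_ * _); rewrite [RHS]mxE.
- rewrite big1 => [|k _]; last by rewrite mulr0.
  rewrite big1 => [|k _]; last by rewrite mulr0.
  by rewrite !(mulr0, mul0r, addr0).
- rewrite (eq_bigr (fun k => p 0 k * (k == lshift d 0)%:R)) => [|k _]; last first.
    by rewrite mul0r addr0.
  rewrite sum_pred1 [X in 2^-1 * X]big1 => [|k _]; last by rewrite zz !mul0r addr0.
  by rewrite !(mulr0, mul0r, addr0).
- move=> i; rewrite (eq_bigr (fun k => p 0 k * (k == rshift 1 i)%:R)) => [|k _]; last first.
    by rewrite mul0r addr0.
  rewrite sum_pred1 [X in 2^-1 * X]big1 => [|k _]; last by rewrite zz !mul0r addr0.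
  by rewrite !(mulr0, mul0r, addr0).
- move=> i j; rewrite big1 => [|k _]; last by rewrite !(mulr0, mul0r, addr0).
  rewrite [X in 2^-1 * X](_ : _ = Q (rshift 1 i) (rshift 1 j) +
      Q (rshift 1 j) (rshift 1 i)).
    by rewrite !(mul0r, mulr0, add0r, addr0) mulrC.
  have Qs (k l : 'I_(1 + d)) :
      \sum_k0 (0 * 0 + Q k0 l * (k0 == k)%:R) = Q k l.
    by under eq_bigr do rewrite mul0r add0r; rewrite sum_pred1.
  rewrite (eq_bigr (fun l => Q (rshift 1 i) l * (l == rshift 1 j)%:R +
      Q (rshift 1 j) l * (l == rshift 1 i)%:R)) => [|l _]; last first.
    by rewrite zz !Qs !mul0r !add0r [in LHS]mulrC.
  by rewrite big_split/= !sum_pred1.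
Qed.

Definition spatial_diffusion l (lambda0 : R) (Sigma : 'rV[R]_d -> 'M[R]_(d, l)) z
    : 'M[R]_(1 + d) :=
  block_mx 0 0 0
    (lambda0%:M + Sigma (rsubmx z) *m (Sigma (rsubmx z))^T).

Definition spacetime_drift (b : R -> 'rV[R]_d -> 'rV[R]_d) z : 'rV[R]_(1 + d) :=
  spacetime 1 (b (z 0 (lshift d 0)) (rsubmx z)).

(** One notion suffices for both inequalities: the equation being linear, [u] and [-u] are
    subsolutions of the same equation. *)
Definition subsolution l (lambda0 : R) (Sigma : 'rV[R]_d -> 'M[R]_(d, l)) b T
    (v : R -> 'rV[R]_d -> R) :=
  forall chi ft fi fij, smooth12 chi ft fi fij -> forall t0 x0, 0 < t0 < T ->
    (forall t x, 0 < t < T -> v t x - chi t x <= v t0 x0 - chi t0 x0) ->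
    parabolic_op lambda0 Sigma b chi t0 x0 <= 0.

Lemma viscosity_subsolution l (lambda0 : R) (Sigma : 'rV[R]_d -> 'M[R]_(d, l)) b T u0 u :
  viscosity_solution lambda0 Sigma b T u0 u ->
  subsolution lambda0 Sigma b T u.
Proof.
move=> [_ _ H] chi ft fi fij s t0 x0 t0T hmax.
by have [+ _] := H chi (smooth12_C12 T s) t0 x0 t0T; exact.
Qed.

Lemma viscosity_supersolution l (lambda0 : R) (Sigma : 'rV[R]_d -> 'M[R]_(d, l)) b T u0 u :
  viscosity_solution lambda0 Sigma b T u0 u ->
  subsolution lambda0 Sigma b T (fun t x => - u t x).
Proof.
move=> [_ _ H] chi ft fi fij s t0 x0 t0T hmax.
have sN := smooth12M (smooth12_cst (-1)) s.
have [_ +] := H _ (smooth12_C12 T sN) t0 x0 t0T.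
rewrite (smooth12_op _ _ _ _ _ sN) (smooth12_op _ _ _ _ _ s) => Hop.
have : forall t x, 0 < t < T ->
    u t0 x0 - -1 * chi t0 x0 <= u t x - -1 * chi t x.
  by move=> t x tT; have := hmax t x tT; lra.
move=> /Hop.
have -> : \matrix_(i, j) (-1 * fij i j t0 x0 + fi j t0 x0 * 0 +
    (chi t0 x0 * 0 + 0 * fi i t0 x0)) = - \matrix_(i, j) fij i j t0 x0.
  by apply/matrixP => i j; rewrite !mxE; ring.
have -> : \row_i (-1 * fi i t0 x0 + chi t0 x0 * 0) = - \row_i fi i t0 x0.
  by apply/rowP => i; rewrite !mxE; ring.
have -> : \sum_i (-1 * fij i i t0 x0 + fi i t0 x0 * 0 +
    (chi t0 x0 * 0 + 0 * fi i t0 x0)) = - \sum_i fij i i t0 x0.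
  by rewrite -sumrN; apply: eq_bigr => i _; ring.
by rewrite mulmxN linearN/= dotNr; lra.
Qed.

Definition clip (T t : R) : R := Num.max 0 (Num.min t T).

Lemma clip_id T t : 0 < t < T -> clip T t = t.
Proof.
by move=> /andP[t0 tT]; rewrite /clip (min_idPl (ltW tT)) (max_idPr (ltW t0)).
Qed.

Lemma clip_itv T t : 0 < T -> 0 <= clip T t <= T.
Proof.
by move=> T0; rewrite /clip le_max lexx/= ge_max ge_min lexx orbT (ltW T0).
Qed.

(** Freezing time outside [[0, T]] gives a function continuous on all of [R^(1+d)], as
    sup-convolutions require. *)
Definition extend T (v : R -> 'rV[R]_d -> R) z := v (clip T (z 0 (lshift d 0))) (rsubmx z).

Lemma spacetimeE z : spacetime (z 0 (lshift d 0)) (rsubmx z) = z.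
Proof.
rewrite /spacetime -[RHS]hsubmxK; congr row_mx.
by apply/rowP => i; rewrite (ord1 i) !mxE; congr (z _ (lshift _ _)); apply/val_inj.
Qed.

Lemma spacetime_time t x : spacetime t x 0 (lshift d 0) = t.
Proof. by rewrite row_mxEl mxE. Qed.

Lemma spacetime_space t x : rsubmx (spacetime t x) = x.
Proof. exact: row_mxKr. Qed.

Lemma enorm_rsubmx z : enorm (rsubmx z) <= enorm z.
Proof.
rewrite -ler_sqr ?nnegrE ?enorm_ge0// !sqr_enorm -[in leRHS](hsubmxK z) dot_row_mx.
by rewrite lerDr dot_ge0.
Qed.

(** Test functions must touch globally, superjets are local. The polynomial growth of [v] allows a
    high even power of [|w|] to dominate away from [z] without changing the 2-jet. *)
Lemma subsolution_ujet l (lambda0 : R) (Sigma : 'rV[R]_d -> 'M[R]_(d, l)) b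
    (T C m : R) v :
  subsolution lambda0 Sigma b T v -> 0 < m -> 0 < C ->
  (forall t x, 0 <= t <= T -> `|v t x| <= C * (1 + enorm x) `^ m) ->
  forall z p Y, 0 < z 0 (lshift d 0) < T -> ujet (extend T v) z p Y ->
    dot (spacetime_drift b z) p <= \tr (spatial_diffusion lambda0 Sigma z *m Y).
Proof.
move=> sub m0 C0 growth z p Y; set t0 := z 0 _ => t0T [sY hY].
set x0 := rsubmx z; have zE : spacetime t0 x0 = z := spacetimeE z.
set A := spatial_diffusion _ _ _.
suff H e : 0 < e -> dot (spacetime_drift b z) p <= \tr (A *m (Y + (2 * e)%:M)).
  apply/ler_addgt0Pl => e e0; pose k := `|\tr A| + 1.
  have k0 : 0 < k by rewrite ltr_wpDl.
  apply: le_trans (H (e / (2 * k)) _) _; first by rewrite divr_gt0// mulr_gt0.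
  rewrite mulmxDr mxtraceD mul_mx_scalar mxtraceZ addrC lerD2r.
  have -> : 2 * (e / (2 * k)) * \tr A = e * (\tr A / k).
    by field; rewrite gt_eqF.
  rewrite ler_piMr ?(ltW e0)// ler_pdivrMr// mul1r.
  by rewrite /k; have := ler_norm (\tr A); lra.
move=> e0; have [de de0 hde] := hY e e0.
(* Half of [2 e |w|^2] is exactly the slack [e |w|^2] of the superjet; its trace vanishes with
   [e]. *)
have [Q QE] : exists Q, Q = Y + (2 * e)%:M by eexists.
have sQ : Q^T = Q by rewrite QE linearD/= sY tr_scalar_mx.
rewrite -QE.
pose n := Num.Def.trunc m.
pose K := (2 * n.+2)%N.
(* Ensures [B |w| >= 1 + |x0| + |w|] once [|w| >= de], so [(B |w|)^K], with [K] even and above [m],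
   dominates every term. *)
pose B := (1 + enorm x0) / de + 1.
have B1 : 1 <= B by rewrite lerDr divr_ge0 ?addr_ge0 ?enorm_ge0// ltW.
have B0 : 0 < B by lra.
have [q q0 hq] := quad_bounded Q.
pose V := `|v t0 x0|.
pose N := (C + V + enorm p + q) * B ^+ K.
pose chi t x := let w := spacetime t x - spacetime t0 x0 in
  dot p w + dot (w *m Q) w / 2 + N * dot w w ^+ n.+2.
have [ft [fi [fij [sm e1 e2 e3 e4]]]] :
    taylor12 t0 x0 chi 0 (p 0 (lshift d 0)) (fun i => p 0 (rshift 1 i))
      (fun i j => (Q (rshift 1 i) (rshift 1 j) + Q (rshift 1 j) (rshift 1 i)) / 2).
  exact: taylor12_quadratic.
have := sub _ _ _ _ sm t0 x0 t0T.
rewrite (smooth12_op _ _ _ _ _ sm) e1 e2 subr0.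
have -> : \row_i fi i t0 x0 = rsubmx p by apply/rowP => i; rewrite !mxE e3.
have -> : \matrix_(i, j) fij i j t0 x0 = drsubmx Q.
  apply/matrixP => i j; rewrite !mxE e4.
  have -> : Q (rshift 1 j) (rshift 1 i) = Q (rshift 1 i) (rshift 1 j).
    by rewrite -{1}sQ mxE.
  by field.
have -> : \sum_i fij i i t0 x0 = \tr (drsubmx Q).
  by apply: eq_bigr => i _; rewrite e4 !mxE; field.
have -> : \tr (A *m Q) = lambda0 * \tr (drsubmx Q) +
    \tr (Sigma x0 *m (Sigma x0)^T *m drsubmx Q).
  rewrite /A /spatial_diffusion -[in LHS](submxK Q) mulmx_block mxtrace_block.
  by rewrite !mul0mx !add0r mxtrace0 add0r mulmxDl mxtraceD mul_scalar_mx mxtraceZ.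
have -> : dot (spacetime_drift b z) p = p 0 (lshift d 0) + dot (b t0 x0) (rsubmx p).
  rewrite -[p in LHS]hsubmxK dot_row_mx; congr (_ + _).
  by rewrite /dot big_ord1 !mxE mul1r; congr (p _ (lshift _ _)); apply/val_inj.
move=> Hop; suff /Hop : forall t x, 0 < t < T -> v t x - chi t x <= v t0 x0 by lra.
move=> t x tT; rewrite /chi; cbv zeta.
have [w wE] : exists w, w = spacetime t x - spacetime t0 x0 by eexists.
rewrite -wE.
have xw : spacetime t x = z + w by rewrite wE zE addrC subrK.
have extx : extend T v (z + w) = v t x.
  by rewrite -xw /extend spacetime_time spacetime_space clip_id.
have ext0 : extend T v z = v t0 x0 by rewrite /extend clip_id.
have NK : N * dot w w ^+ n.+2 = (C + V + enorm p + q) * (B * enorm w) ^+ K.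
  by rewrite -sqr_enorm -exprM -mulrA -exprMn.
have [wde|wde] := leP (enorm w) de.
  have := hde _ wde; rewrite extx ext0 NK QE mulmxDr mul_mx_scalar dotDl dotZl.
  have : 0 <= (C + V + enorm p + q) * (B * enorm w) ^+ K.
    rewrite mulr_ge0 ?exprn_ge0 ?mulr_ge0 ?enorm_ge0 ?(ltW B0)//.
    by rewrite !addr_ge0 ?enorm_ge0 ?(ltW C0) ?(ltW q0) ?normr_ge0.
  lra.
have w0 := enorm_ge0 w.
pose W := B * enorm w.
have W1 : 1 + enorm x0 + enorm w <= W.
  rewrite /W /B mulrDl mul1r lerD2r mulrAC ler_pdivlMr//.
  by rewrite ler_wpM2l ?addr_ge0 ?enorm_ge0// ltW.
have x0ge := enorm_ge0 x0.
have W1' : 1 <= W by lra.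
have wW : enorm w <= W by lra.
have WK (j : nat) : (j <= K)%N -> W ^+ j <= W ^+ K by move=> jK; rewrite ler_weXn2l.
have xb : 1 + enorm x <= W.
  apply: le_trans W1; rewrite -addrA lerD2l.
  have -> : x = x0 + rsubmx w.
    by rewrite wE linearB/= zE spacetime_space addrC subrK.
  by rewrite (le_trans (enormD _ _))// lerD2l enorm_rsubmx.
have vb : v t x <= C * W ^+ K.
  have tT' : 0 <= t <= T by have /andP[/ltW -> /ltW ->] := tT.
  apply: le_trans (ler_norm _) _; apply: le_trans (growth t x tT') _.
  rewrite ler_wpM2l ?(ltW C0)//.
  have W0 : 0 <= W by lra.
  apply: (@le_trans _ _ (W `^ m)).
    by apply: ge0_ler_powR; rewrite ?nnegrE ?(ltW m0) ?addr_ge0 ?enorm_ge0.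
  rewrite -powR_mulrn//; apply: ler_powR => //.
  apply: le_trans (ltW (Num.Theory.truncnS_gt m)) _.
  rewrite ler_nat /K mul2n -addnn; exact: leq_trans (leqnSn _) (leq_addr _ _).
have WK1 : 1 <= W ^+ K by rewrite -(expr0 W) WK.
have v0b : - v t0 x0 <= V * W ^+ K.
  have : - v t0 x0 <= V by rewrite /V -normrN ler_norm.
  have V0 : 0 <= V := normr_ge0 _.
  have : V * 1 <= V * W ^+ K by rewrite ler_wpM2l.
  lra.
have pb : - dot p w <= enorm p * W ^+ K.
  have := dot_le_enorm p w; rewrite ler_norml => /andP[h _].
  have : enorm p * enorm w <= enorm p * W ^+ K.
    rewrite ler_wpM2l ?enorm_ge0// (le_trans wW)// -{1}(expr1 W) WK//.
  lra.
have qb : - dot (w *m Q) w <= q * W ^+ K.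
  have := hq w; rewrite ler_norml => /andP[h _].
  have : q * dot w w <= q * W ^+ K.
    rewrite ler_wpM2l ?(ltW q0)// -sqr_enorm (le_trans _ (WK 2%N _))//.
    by rewrite ler_sqr ?nnegrE//; lra.
  lra.
rewrite NK -/W.
have : 0 <= q * W ^+ K by rewrite mulr_ge0 ?(ltW q0)// (le_trans _ WK1).
move: qb vb v0b pb; move: (dot (w *m Q) w) (W ^+ K) => s1 s2.
lra.
Qed.

End ViscosityJets.

(** * The Lyapunov function and the barrier *)

Section Generator.
Context {R : realType} {D n : nat}.
Implicit Types (F H : 'rV[R]_D -> R) (B z : 'rV[R]_D) (G : 'M[R]_(n, D)).

(* [gen B G z F gam Gam]: at [z], the operator [tr (G D^2 F G^T) - B . DF]
   takes the value [gam] and its carre du champ [|DF G^T|^2] the value [Gam]. *)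
Definition gen B G z F (gam Gam : R) := exists p X, [/\ jet F z p X,
  \tr (G *m X *m G^T) - dot B p = gam & dot (p *m G^T) (p *m G^T) = Gam].

Lemma gen_ext B G z F H gam Gam : (forall y, F y = H y) ->
  gen B G z F gam Gam -> gen B G z H gam Gam.
Proof. by move=> FH [p [X [j e1 e2]]]; exists p, X; split=> //; exact: jet_ext j. Qed.

Lemma trace_congr_outer G (p q : 'rV[R]_D) :
  \tr (G *m (p^T *m q) *m G^T) = dot (p *m G^T) (q *m G^T).
Proof.
have -> : G *m (p^T *m q) *m G^T = (p *m G^T)^T *m (q *m G^T).
  by rewrite trmx_mul trmxK !mulmxA.
by rewrite trace_outer dotC.
Qed.

(** Ito's formula, without a factor 1/2 because the operator is [tr (G D^2 F G^T)]. The pair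
    [(gam, Gam)] is all that a function of [F] needs. *)
Lemma gen_comp B G z F gam Gam (g : R -> R) (g1 g2 : R) :
  gen B G z F gam Gam -> jet1 g (F z) g1 g2 ->
  gen B G z (fun y => g (F y)) (g1 * gam + g2 * Gam) (g1 ^+ 2 * Gam).
Proof.
move=> [p [X [j <- <-]]] jg; exists (g1 *: p), (g1 *: X + g2 *: (p^T *m p)).
split; first exact: jet_comp.
- rewrite mulmxDr mulmxDl mxtraceD -!scalemxAr -!scalemxAl !mxtraceZ.
  by rewrite trace_congr_outer dotZr; ring.
- by rewrite -scalemxAl dotZl dotZr mulrA -expr2.
Qed.

Lemma gen_affine B G z (a : 'rV[R]_D) (c : R) :
  gen B G z (fun y => dot a y + c) (- dot B a) (dot (a *m G^T) (a *m G^T)).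
Proof.
exists a, 0; split; [exact: jet_affine| |by []].
by rewrite mulmx0 mul0mx mxtrace0 sub0r.
Qed.

(** [L] selects a linear combination of the two positions: [x], [y] or [x - y]. *)
Lemma gen_sqnorm k B G z (L : 'M[R]_(D, k)) :
  gen B G z (fun y => dot (y *m L) (y *m L))
    (2 * \tr ((G *m L) *m (G *m L)^T) - 2 * dot (B *m L) (z *m L))
    (4 * dot ((z *m L) *m (G *m L)^T) ((z *m L) *m (G *m L)^T)).
Proof.
exists (2 *: (z *m (L *m L^T))), (2 *: (L *m L^T)); split.
- have := jetZ 2 (@jet_quad R D (L *m L^T) z _); rewrite trmx_mul trmxK => /(_ erefl).
  apply: jet_ext => y; rewrite mulmxA dot_mulmx trmxK.
  by rewrite mulrCA mulfV ?mulr1.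
- rewrite -scalemxAr -scalemxAl mxtraceZ dotZr trmx_mul !mulmxA.
  by rewrite [dot B _]dotC (dot_mulmx (z *m L)) trmxK (dotC (z *m L)).
- rewrite -scalemxAl dotZl dotZr mulrA trmx_mul !mulmxA; congr (_ * _).
  by ring.
Qed.

Lemma genD B G z F H gam Gam gam' Gam' :
  gen B G z F gam Gam -> gen B G z H gam' Gam' ->
  exists Gam2, gen B G z (fun y => F y + H y) (gam + gam') Gam2.
Proof.
move=> [p [X [j <- _]]] [q [Y [j' <- _]]]; eexists.
exists (p + q), (X + Y); split; [exact: jetD| |by []].
by rewrite mulmxDr mulmxDl mxtraceD dotDr; ring.
Qed.

Lemma genZ B G z F gam Gam (c : R) : gen B G z F gam Gam ->
  gen B G z (fun y => c * F y) (c * gam) (c ^+ 2 * Gam).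
Proof.
move=> h; have := gen_comp h (jet1_affine c 0 (F z)).
rewrite mul0r addr0; apply: gen_ext => y; exact: addr0.
Qed.

(* No cross term: [DF] is orthogonal to the noise. *)
Lemma genM B G z F H gam gam' Gam' :
  gen B G z F gam 0 -> gen B G z H gam' Gam' ->
  exists Gam2, gen B G z (fun y => F y * H y) (H z * gam + F z * gam') Gam2.
Proof.
move=> [p [X [j <- /dot_eq0 pG]]] [q [Y [j' <- _]]]; eexists.
exists (H z *: p + F z *: q), (H z *: X + F z *: Y + (p^T *m q + q^T *m p)).
split; [exact: jetM| |by []].
rewrite !(mulmxDr, mulmxDl) !mxtraceD -!scalemxAr -!scalemxAl !mxtraceZ.
by rewrite !trace_congr_outer pG dot0l dot0r dotDr !dotZr; ring.
Qed.

Lemma gen_ujet B G z F gam Gam : gen B G z F gam Gam ->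
  exists p X, ujet F z p X /\ \tr (G *m X *m G^T) = gam + dot B p.
Proof.
move=> [p [X [j <- _]]]; exists p, X; split; first exact: jet_ujet.
by rewrite subrK.
Qed.

End Generator.

Section Lyapunov.
Context {R : realType}.

(* Flat on the ball of radius [r], where the drift is not controlled. *)
Definition lyap (r k : R) (rho : R) : R :=
  (1 + Num.max (rho - r ^+ 2) 0 ^+ 3) `^ (k / 6).

Lemma lyap_base (r rho : R) : 1 <= 1 + Num.max (rho - r ^+ 2) 0 ^+ 3.
Proof. by rewrite lerDl exprn_ge0// le_max lexx orbT. Qed.

Lemma lyap_ge1 (r k rho : R) : 0 <= k -> 1 <= lyap r k rho.
Proof.
move=> k0; rewrite -[leLHS](powRr0 (1 + Num.max (rho - r ^+ 2) 0 ^+ 3)).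
by apply: ler_powR; [exact: lyap_base|rewrite divr_ge0].
Qed.

Lemma gen_lyap D n (B z : 'rV[R]_D) (G : 'M[R]_(n, D)) F gam Gam (r k : R) :
  gen B G z F gam Gam ->
  let s := Num.max (F z - r ^+ 2) 0 in let c := 1 + s ^+ 3 in let a := k / 6 in
  exists Gam', gen B G z (fun y => lyap r k (F y))
    (a * c `^ (a - 1) * (3 * s ^+ 2 * gam + 6 * s * Gam) +
     a * (a - 1) * c `^ (a - 2) * (9 * s ^+ 4 * Gam)) Gam'.
Proof.
move=> h s c a; eexists.
have h1 := gen_comp h (jet1_affine 1 (- r ^+ 2) (F z)).
have h2 := gen_comp h1 (jet1_cube_pos _).
have h3 := gen_comp h2 (jet1_affine 1 1 _).
have c0 : 0 < 1 * Num.max (1 * F z - r ^+ 2) 0 ^+ 3 + 1.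
  by rewrite !mul1r addrC; exact: lt_le_trans ltr01 (lyap_base _ _).
have := gen_comp h3 (jet1_powR (k / 6) c0).
rewrite !mul1r !mul0r !addr0 (addrC _ 1) -/s -/c -/a.
rewrite expr1n !mul1r.
have -> : (3 * s ^+ 2) ^+ 2 * Gam = 9 * s ^+ 4 * Gam by ring.
by apply: gen_ext => y; rewrite /lyap !mul1r addrC.
Qed.

(** Half of the cubic term absorbs the lower powers; the constant comes from the region
    [s < (A1 + A2) / al]. *)
Lemma cubic_bound (al A1 A2 s : R) : 0 < al -> 0 <= A1 -> 0 <= A2 -> 0 <= s ->
  - (6 * al * s ^+ 3) + A1 * s ^+ 2 + A2 * s <=
  - (3 * al * (1 + s ^+ 3)) + (A2 + 3 * al + (A1 + A2) * ((A1 + A2) / al) ^+ 2).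
Proof.
move=> al0 A10 A20 s0; set A := A1 + A2; have A0 : 0 <= A by rewrite addr_ge0.
have h1 : A * s ^+ 2 <= al * s ^+ 3 + A * (A / al) ^+ 2.
  have [sA|sA] := leP (A / al) s.
    have : A * s ^+ 2 <= al * s ^+ 3.
      by rewrite [s ^+ 3]exprS mulrA ler_wpM2r ?sqr_ge0// mulrC -ler_pdivrMr.
    have : 0 <= A * (A / al) ^+ 2 by rewrite mulr_ge0 ?sqr_ge0.
    lra.
  have : A * s ^+ 2 <= A * (A / al) ^+ 2.
    by rewrite ler_wpM2l// ler_sqr ?nnegrE ?divr_ge0 ?(ltW al0)// ltW.
  have : 0 <= al * s ^+ 3 by rewrite mulr_ge0 ?exprn_ge0 ?(ltW al0).
  lra.
have h2 : A2 * s <= A2 * (1 + s ^+ 2).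
  rewrite ler_wpM2l//; have := sqr_ge0 (s - 1); rewrite sqrrB1; lra.
have h3 : 0 <= al * s ^+ 3 by rewrite mulr_ge0 ?exprn_ge0 ?(ltW al0).
rewrite /A in h1 *; lra.
Qed.

(** Split at [c = C / be]. Below it, [c^(a-1) <= c^a] since [c >= 1], which covers [a < 1] as
    well. *)
Lemma powR_absorb (a be C c : R) : 0 < a -> 0 < be -> 0 <= C -> 1 <= c ->
  C * c `^ (a - 1) <= be * c `^ a + C * (C / be + 1) `^ a.
Proof.
move=> a0 be0 C0 c1; have c0 : 0 < c by lra.
have ca : c * c `^ (a - 1) = c `^ a by rewrite mulr_powRB1// ltW.
have p0 : 0 <= c `^ (a - 1) by exact: powR_ge0.
have S0 : 0 <= C / be + 1 by rewrite addr_ge0// divr_ge0// ltW.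
have [h|h] := leP (C / be) c.
  have : C * c `^ (a - 1) <= be * c `^ a.
    by rewrite -ca mulrA ler_wpM2r// mulrC -ler_pdivrMr.
  have : 0 <= C * (C / be + 1) `^ a by rewrite mulr_ge0 ?powR_ge0.
  lra.
have h1 : c `^ (a - 1) <= (C / be + 1) `^ a.
  apply: (@le_trans _ _ (c `^ a)); first by apply: ler_powR => //; lra.
  by apply: ge0_ler_powR; rewrite ?nnegrE ?(ltW a0) ?(ltW c0)//; lra.
have := ler_wpM2l C0 h1.
have : 0 <= be * c `^ a by rewrite mulr_ge0 ?powR_ge0 ?(ltW be0).
lra.
Qed.

(** With [s = (F - r^2)_+], the drift contributes order [s^3] and the diffusion at most [s^2]. The
    constants precede the dimension, the point and the coefficients, hence are uniform in them. *)
Lemma lyapunov_drift (r k al La : R) : 0 < r -> 0 < k -> 0 < al -> 0 <= La ->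
  exists om C : R, [/\ 0 < om, 0 < C &
    forall D n (B z : 'rV[R]_D) (G : 'M[R]_(n, D)) F (tr bx xAx : R),
      gen B G z F (2 * tr - 2 * bx) (4 * xAx) ->
      0 <= F z -> tr <= La -> 0 <= xAx -> xAx <= La * F z ->
      (r ^+ 2 <= F z -> al * F z <= bx) ->
      exists gam Gam, gen B G z (fun y => lyap r k (F y)) gam Gam /\
        gam <= C - om * lyap r k (F z)].
Proof.
move=> r0 k0 al0 La0; pose a := k / 6; have a0 : 0 < a by rewrite divr_gt0.
(* Coefficients of [s^2] and [s] once [xAx <= La (s + r^2)] is inserted. *)
pose A1 := 6 * La + 4 * La * (6 + 9 * a).
pose A2 := 4 * La * (6 + 9 * a) * r ^+ 2.
have A10 : 0 <= A1 by rewrite addr_ge0 ?mulr_ge0// addr_ge0// mulr_ge0// ltW.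
have A20 : 0 <= A2 by rewrite mulr_ge0 ?sqr_ge0// mulr_ge0 ?mulr_ge0// addr_ge0// mulr_ge0// ltW.
pose C3 := A2 + 3 * al + (A1 + A2) * ((A1 + A2) / al) ^+ 2.
have al3 : 0 <= 3 * al by rewrite mulr_ge0// ltW.
have C30 : 0 <= C3 :=
  addr_ge0 (addr_ge0 A20 al3) (mulr_ge0 (addr_ge0 A10 A20) (sqr_ge0 _)).
pose om := a * (3 * al / 2).
have om0 : 0 < om by rewrite mulr_gt0// divr_gt0// mulr_gt0.
(* The summand [om] pays for the flat ball, where the generator vanishes and [lyap] equals 1. *)
pose C5 := a * (C3 * (C3 / (3 * al / 2) + 1) `^ a) + om.
have C50 : 0 < C5.
  by rewrite /C5 ltr_wpDl// mulr_ge0 ?(ltW a0)// mulr_ge0// powR_ge0.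
exists om, C5; split=> // D n B z G F tr bx xAx h F0 trLa xA0 xALa bxal.
have [Gam' hl] := gen_lyap r k h; do 2 eexists; split; first exact: hl.
rewrite -/a /lyap -/a; set s := Num.max _ 0; set c := 1 + s ^+ 3.
have c1 : 1 <= c := lyap_base _ _.
have c0 : 0 < c by lra.
have ca : c * c `^ (a - 1) = c `^ a by rewrite mulr_powRB1// ltW.
have ca2 : c `^ (a - 2) = c `^ (a - 1) / c.
  rewrite -[in RHS](powR_inv1 (ltW c0)) -powRD; last by rewrite (gt_eqF c0) implybT.
  by congr (_ `^ _); lra.
have [s0|s0] := leP (F z - r ^+ 2) 0.
  have -> : s = 0 by rewrite /s (max_idPr s0).
  have -> : c `^ a = 1.
    by rewrite /c /s (max_idPr s0) expr0n/= addr0 powR1.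
  rewrite expr0n/= expr0n/= !mulr0 !mul0r addr0 !mulr0 addr0 mulr1 /C5 addrK.
  by rewrite mulr_ge0 ?(ltW a0)// mulr_ge0// powR_ge0.
have sE : s = F z - r ^+ 2 by rewrite /s (max_idPl (ltW s0)).
have s_ge0 : 0 <= s by rewrite sE ltW.
have FE : F z = s + r ^+ 2 by rewrite sE subrK.
have rF : r ^+ 2 <= F z by rewrite -subr_ge0 ltW.
have {}bxal := bxal rF.
pose q := c `^ (a - 1).
have q0 : 0 <= q := powR_ge0 _ _.
have E1 : a * q * (3 * s ^+ 2 * (2 * tr - 2 * bx) + 6 * s * (4 * xAx)) +
    a * (a - 1) * (q / c) * (9 * s ^+ 4 * (4 * xAx)) <=
    a * (q * (- (3 * al * c) + C3)).
  have -> : a * q * (3 * s ^+ 2 * (2 * tr - 2 * bx) + 6 * s * (4 * xAx)) +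
    a * (a - 1) * (q / c) * (9 * s ^+ 4 * (4 * xAx)) =
    a * (q * (3 * s ^+ 2 * (2 * tr - 2 * bx) + 6 * s * (4 * xAx) +
      (a - 1) * (9 * (s ^+ 4 / c) * (4 * xAx)))) by ring.
  rewrite ler_wpM2l ?(ltW a0)// ler_wpM2l//.
  have s4 : 0 <= s ^+ 4 / c by rewrite divr_ge0 ?exprn_ge0// ltW.
  have s4c : s ^+ 4 / c <= s.
    rewrite ler_pdivrMr// /c mulrDr mulr1 -exprS lerDr//.
  (* Replacing [a - 1] by [a] makes its sign irrelevant, and [s^4 / c <= s] because
     [c = 1 + s^3]. *)
  have t1 : (a - 1) * (9 * (s ^+ 4 / c) * (4 * xAx)) <= a * (9 * s * (4 * xAx)).
    apply: (@le_trans _ _ (a * (9 * (s ^+ 4 / c) * (4 * xAx)))).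
      have t0 : 0 <= 9 * (s ^+ 4 / c) * (4 * xAx) :=
        mulr_ge0 (mulr_ge0 (ler0n _ 9) s4) (mulr_ge0 (ler0n _ 4) xA0).
      by apply: ler_wpM2r t0 _ _ _; lra.
    by rewrite ler_wpM2l ?(ltW a0)// ler_wpM2r ?mulr_ge0// ler_wpM2l.
  have t2 : s ^+ 2 * (2 * tr - 2 * bx) <= s ^+ 2 * (2 * La - 2 * al * s).
    rewrite ler_wpM2l ?sqr_ge0//; move: bxal; rewrite FE.
    have : 0 <= al * r ^+ 2 by rewrite mulr_ge0 ?sqr_ge0 ?(ltW al0).
    lra.
  have t3 : (6 + 9 * a) * s * (4 * xAx) <= (6 + 9 * a) * s * (4 * (La * (s + r ^+ 2))).
    rewrite ler_wpM2l ?ler_wpM2l -?FE//.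
    by rewrite mulr_ge0// addr_ge0// mulr_ge0// ltW.
  have := cubic_bound al0 A10 A20 s_ge0; rewrite -/C3 -/c => t4.
  have e1 : s ^+ 2 * (2 * La - 2 * al * s) = 2 * La * s ^+ 2 - 2 * (al * s ^+ 3) by ring.
  have e2 : (6 + 9 * a) * s * (4 * (La * (s + r ^+ 2))) =
    4 * La * (6 + 9 * a) * s ^+ 2 + A2 * s by rewrite /A2; ring.
  rewrite e1 in t2; rewrite e2 in t3; rewrite /A1 in t4.
  clear -t1 t2 t3 t4; lra.
rewrite ca2 -/q; apply: le_trans E1 _.
have := powR_absorb a0 (be := 3 * al / 2) _ C30 c1; rewrite -/q -ca -/q.
have be0 : 0 < 3 * al / 2 by rewrite divr_gt0// mulr_gt0.
move=> /(_ be0)/(ler_wpM2l (ltW a0)); rewrite /om /C5.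
move=> t5.
have : 0 <= a * (3 * al / 2) by rewrite mulr_ge0 ?(ltW a0)// ltW.
lra.
Qed.

End Lyapunov.

(** * The concave barrier, and comparison of [lyap] with the Japanese bracket *)

Section Barrier.
Context {R : realType}.

Lemma powRB1 (c a : R) : 0 < c -> c `^ (a - 1) = c `^ a / c.
Proof.
move=> c0; rewrite -[in RHS](powR_inv1 (ltW c0)) -powRD //.
by rewrite (gt_eqF c0) implybT.
Qed.

(** [rho] is the squared distance, the variable in which [gen_sqnorm] computes. *)
Definition barrier (mu rho : R) : R := 1 - expR (- mu * rho `^ 2^-1).

Lemma barrier_ge0 (mu rho : R) : 0 <= mu -> 0 <= barrier mu rho.
Proof.
move=> mu0; rewrite subr_ge0 -expR0 ler_expR mulNr oppr_le0.
by rewrite mulr_ge0// powR_ge0.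
Qed.

Lemma barrier_le1 (mu rho : R) : barrier mu rho <= 1.
Proof. by rewrite lerBlDr lerDl expR_ge0. Qed.

(* The term [8 lam0] of order zero in the first-order part is what the second
   derivative of [sqrt] compensates. *)
Lemma gen_barrier D n (B z : 'rV[R]_D) (G : 'M[R]_(n, D)) F gam Gam
    (lam0 c1 : R) :
  gen B G z F gam Gam -> 0 < F z -> 0 < lam0 -> 0 < c1 ->
  16 * lam0 * F z <= Gam -> gam <= 8 * lam0 + 2 * c1 * (F z) `^ 2^-1 ->
  let mu := c1 / (2 * lam0) in
  exists gam' Gam', gen B G z (fun y => barrier mu (F y)) gam' Gam' /\
    gam' <= - (mu * c1 * expR (- mu * (F z) `^ 2^-1)).
Proof.
move=> h F0 lam00 c10 hGam hgam mu.
have mu0 : 0 < mu by rewrite divr_gt0// mulr_gt0.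
set nn := F z `^ 2^-1 in hgam *.
have nn0 : 0 < nn by exact: powR_gt0.
have nn2 : nn * nn = F z.
  rewrite /nn -powRD; last by rewrite (gt_eqF F0) implybT.
  by rewrite (_ : 2^-1 + 2^-1 = 1 :> R) ?powRr1 ?ltW//; lra.
have h1 := gen_comp h (jet1_powR 2^-1 F0).
have h2 := gen_comp h1 (jet1_expR (- mu) _).
have h3 := gen_comp h2 (jet1_affine (-1) 1 _).
do 2 eexists; split.
  apply: gen_ext h3 => y; by rewrite /barrier mulN1r addrC.
rewrite -/nn (_ : 2^-1 - 2 = 2^-1 - 1 - 1 :> R); last by lra.
rewrite (powRB1 (2^-1 - 1) F0) (powRB1 2^-1 F0) -/nn -nn2.
set e := expR _; have e0 : 0 < e := expR_gt0 _.
rewrite !mul0r addr0 mulN1r sqrrN.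
have gn : 2^-1 * (nn / (nn * nn)) * gam +
    2^-1 * (2^-1 - 1) * (nn / (nn * nn) / (nn * nn)) * Gam <= c1.
  have -> : 2^-1 * (nn / (nn * nn)) * gam +
    2^-1 * (2^-1 - 1) * (nn / (nn * nn) / (nn * nn)) * Gam =
    (gam - Gam / (2 * (nn * nn))) / (2 * nn).
    by field; rewrite gt_eqF.
  rewrite ler_pdivrMr ?mulr_gt0//.
  have : 8 * lam0 <= Gam / (2 * (nn * nn)).
    by rewrite ler_pdivlMr ?mulr_gt0// nn2; lra.
  lra.
have Gn : lam0 * 4 <= (2^-1 * (nn / (nn * nn))) ^+ 2 * Gam.
  have -> : (2^-1 * (nn / (nn * nn))) ^+ 2 * Gam = Gam / (4 * (nn * nn)).
    by field; rewrite gt_eqF.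
  by rewrite ler_pdivlMr ?mulr_gt0// nn2; lra.
set gn1 := _ + _ in gn *; set Gn1 := _ * Gam in Gn *.
have -> : - (- mu * e * gn1 + mu ^+ 2 * e * Gn1) = mu * e * (gn1 - mu * Gn1).
  by ring.
(* [mu] is chosen so that [4 lam0 mu = 2 c1]: the concavity gains twice what the drift can lose. *)
have -> : - (mu * c1 * e) = mu * e * (c1 - mu * (lam0 * 4)).
  by rewrite /mu; field; rewrite gt_eqF.
apply: ler_wpM2l; first exact: mulr_ge0 (ltW mu0) (ltW e0).
by apply: lerB => //; apply: ler_wpM2l => //; exact: ltW.
Qed.

Lemma japanese_powR d (k : R) (x : 'rV[R]_d) :
  japanese x `^ k = (1 + dot x x) `^ (k / 2).
Proof.
rewrite /japanese sqr_enorm -powR12_sqrt ?addr_ge0 ?dot_ge0//.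
by rewrite -powRrM mulrC.
Qed.

Lemma lyap_le_japanese d (r k : R) (x : 'rV[R]_d) : 0 < k ->
  lyap r k (dot x x) <= japanese x `^ k.
Proof.
move=> k0; rewrite japanese_powR /lyap.
have x0 := dot_ge0 x; have x1 : 0 <= 1 + dot x x by lra.
have -> : k / 2 = 3 * (k / 6) by field.
rewrite (powRrM (1 + dot x x)) powR_mulrn//; apply: ge0_ler_powR.
- by rewrite divr_ge0 ?ltW.
- by rewrite nnegrE (le_trans ler01)// lyap_base.
- by rewrite nnegrE exprn_ge0.
have s0 : 0 <= Num.max (dot x x - r ^+ 2) 0 by rewrite le_max lexx orbT.
have sx : Num.max (dot x x - r ^+ 2) 0 <= dot x x.
  by rewrite ge_max x0 andbT gerBl sqr_ge0.
have := lerXn2r 3 (x := Num.max (dot x x - r ^+ 2) 0) (y := dot x x).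
rewrite !nnegrE s0 x0 => /(_ isT isT sx) => h.
have -> : (1 + dot x x) ^+ 3 = 1 + dot x x ^+ 3 + 3 * dot x x * (1 + dot x x) by ring.
rewrite -addrA lerD2l (le_trans h)// lerDl mulr_ge0// mulr_ge0//.
Qed.

(** Convexity of the cube: with [A = 1 + r^2], [(A + s)^3 <= 4 (A^3 + s^3) <= 4 A^3 (1 + s^3)]. *)
Lemma japanese_le_lyap d (r k : R) (x : 'rV[R]_d) : 0 < k ->
  japanese x `^ k <= (4 * (1 + r ^+ 2) ^+ 3) `^ (k / 6) * lyap r k (dot x x).
Proof.
move=> k0; rewrite japanese_powR /lyap.
have x0 := dot_ge0 x; have x1 : 0 <= 1 + dot x x by lra.
have r0 := sqr_ge0 r.
have -> : k / 2 = 3 * (k / 6) by field.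
have A0 : 0 <= 1 + r ^+ 2 by lra.
have c0 : 0 <= 4 * (1 + r ^+ 2) ^+ 3 by rewrite mulr_ge0// exprn_ge0.
have l0 : 0 <= 1 + Num.max (dot x x - r ^+ 2) 0 ^+ 3.
  by rewrite (le_trans ler01)// lyap_base.
rewrite (powRrM (1 + dot x x)) powR_mulrn// -powRM//; apply: ge0_ler_powR.
- by rewrite divr_ge0 ?ltW.
- by rewrite nnegrE exprn_ge0.
- by rewrite nnegrE mulr_ge0.
set s := Num.max _ 0.
have s0 : 0 <= s by rewrite le_max lexx orbT.
have xs : 1 + dot x x <= (1 + r ^+ 2) + s.
  by have : dot x x - r ^+ 2 <= s; [rewrite le_max lexx|lra].
have As : 0 <= (1 + r ^+ 2) + s by lra.
have := lerXn2r 3 (x := 1 + dot x x) (y := (1 + r ^+ 2) + s).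
rewrite !nnegrE x1 As => /(_ isT isT xs) => h; apply: le_trans h _.
have A1 : 1 <= (1 + r ^+ 2) ^+ 3 by rewrite exprn_ege1//; lra.
move: (1 + r ^+ 2) A0 A1 {As xs l0 c0} => A A0 A1.
have : 4 * (A ^+ 3 + s ^+ 3) - (A + s) ^+ 3 = 3 * ((A + s) * (A - s) ^+ 2) by ring.
have : 0 <= (A + s) * (A - s) ^+ 2 by rewrite mulr_ge0 ?sqr_ge0 ?addr_ge0.
have : 0 <= (A ^+ 3 - 1) * s ^+ 3 by rewrite mulr_ge0 ?exprn_ge0 ?subr_ge0.
lra.
Qed.

End Barrier.

(** * The coupling *)

Section Coupling.
Context {R : realType}.

Lemma opnorm_has_sup d l (A : 'M[R]_(d, l)) :
  has_sup [set enorm (v *m A^T) | v in [set v : 'rV[R]_l | enorm v <= 1]].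
Proof.
split; first by exists (enorm (0 *m A^T)), 0; rewrite //= enorm0.
have [C C0 hC] := mulmx_bounded A^T; exists C => _ [v /= v1 <-].
by rewrite (le_trans (hC v))// ler_piMr// ltW.
Qed.

Lemma opnorm_trmx_le d l (A : 'M[R]_(d, l)) v :
  enorm (v *m A^T) <= opnorm A * enorm v.
Proof.
have [v0|v0] := eqVneq (enorm v) 0.
  by rewrite v0 (enorm_eq0 v0) mul0mx enorm0 mulr0.
have vp : 0 < enorm v by rewrite lt_neqAle eq_sym v0 enorm_ge0.
rewrite -ler_pdivrMr//.
have -> : enorm (v *m A^T) / enorm v = enorm (((enorm v)^-1 *: v) *m A^T).
  by rewrite -scalemxAl enormZ ger0_norm ?invr_ge0 ?enorm_ge0// mulrC.
apply: sup_upper_bound; first exact: opnorm_has_sup.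
exists ((enorm v)^-1 *: v) => //=.
by rewrite enormZ ger0_norm ?invr_ge0 ?enorm_ge0// mulVf.
Qed.

(** By duality: [|w A|^2] is the product of [w] with the image of [w A], and [opnorm] bounds that
    image. *)
Lemma opnorm_le d l (A : 'M[R]_(d, l)) w :
  enorm (w *m A) <= opnorm A * enorm w.
Proof.
have [w0|w0] := eqVneq (enorm (w *m A)) 0.
  rewrite w0 mulr_ge0 ?enorm_ge0//.
  apply: sup_upper_bound; first exact: opnorm_has_sup.
  by exists 0; rewrite /= ?enorm0// mul0mx enorm0.
have wp : 0 < enorm (w *m A) by rewrite lt_neqAle eq_sym w0 enorm_ge0.
rewrite -(ler_pM2r wp) -expr2 sqr_enorm dot_mulmx (le_trans (dot_le _ _))//.
rewrite mulrAC mulrC ler_wpM2r ?enorm_ge0//.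
exact: opnorm_trmx_le.
Qed.

Lemma enorm_row_le_opnorm d l (A : 'M[R]_(d, l)) i : enorm (row i A) <= opnorm A.
Proof.
rewrite rowE (le_trans (opnorm_le _ _))//.
by rewrite /enorm -[X in dot X _]mulmx1 dot_delta mxE eqxx sqrtr1 mulr1.
Qed.

Lemma trace_gram_le d l (A : 'M[R]_(d, l)) (c : R) :
  (forall i, enorm (row i A) ^+ 2 <= c) -> \tr (A *m A^T) <= d%:R * c.
Proof.
move=> h; have -> : A *m A^T = A *m 1%:M *m A^T by rewrite mulmx1.
rewrite trace_congr; apply: (@le_trans _ _ (\sum_(i < d) c)).
  by apply: ler_sum => i _; rewrite mulmx1 -sqr_enorm.
by rewrite sumr_const card_ord mulr_natl.
Qed.

Lemma trmx_scale m n (a : R) (A : 'M[R]_(m, n)) : (a *: A)^T = a *: A^T.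
Proof. by apply/matrixP => i j; rewrite !mxE. Qed.

(* Reflection across the hyperplane orthogonal to [x - y] for the isotropic
   noise, synchronous coupling for the noise of [Sigma]. *)
Lemma reflection_coupling d l (lam0 : R) (x y : 'rV[R]_d) (Sx Sy : 'M[R]_(d, l)) :
  0 <= lam0 -> x != y -> exists S1 S2 : 'M[R]_(d + l, d),
  [/\ S1^T *m S1 = lam0%:M + Sx *m Sx^T, S2^T *m S2 = lam0%:M + Sy *m Sy^T,
      \tr ((S1 - S2) *m (S1 - S2)^T) = 4 * lam0 + \tr ((Sx - Sy) *m (Sx - Sy)^T) &
      4 * lam0 * dot (x - y) (x - y) <=
        dot ((x - y) *m (S1 - S2)^T) ((x - y) *m (S1 - S2)^T)].
Proof.
move=> l0 xy; have [v vE] : exists v, v = x - y by eexists.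
rewrite -vE.
have v0 : enorm v != 0.
  by apply: contra xy => /eqP/enorm_eq0/eqP; rewrite vE subr_eq0.
pose sl := Num.sqrt lam0; have sl2 : sl * sl = lam0 by rewrite -expr2 sqr_sqrtr.
have [nn nnE] : exists nn, nn = (enorm v)^-1 *: v by eexists.
have nn1 : nn *m nn^T = 1%:M.
  apply/matrixP => i j; rewrite !ord1 -dotE nnE dotZl dotZr -sqr_enorm [RHS]mxE eqxx.
  by rewrite expr2 mulKf// mulVf.
have [N NE] : exists N, N = nn^T *m nn by eexists.
have NN : N *m N = N by rewrite NE mulmxA -(mulmxA nn^T) nn1 mulmx1.
have sN : N^T = N by rewrite NE trmx_mul trmxK.
(* The Householder reflection. The difference of the isotropic noises is then [2 sqrt lam0] times
   the projection [N] on the line of [x - y], which yields both [4 lam0] terms. *)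
have [Hh HhE] : exists Hh, Hh = 1%:M - 2 *: N by eexists.
have sH : Hh^T = Hh by rewrite HhE linearB/= linearZ/= trmx1 sN.
have HH : Hh *m Hh = 1%:M.
  rewrite HhE mulmxBr mulmx1 mulmxBl mul1mx -scalemxAl -!scalemxAr NN.
  by apply/matrixP => i j; rewrite !mxE; ring.
pose S1 := col_mx (sl%:M : 'M[R]_d) Sx^T; pose S2 := col_mx (sl *: Hh) Sy^T.
have S12 : S1 - S2 = col_mx ((2 * sl) *: N) (Sx - Sy)^T.
  rewrite /S1 /S2 HhE opp_col_mx add_col_mx [in RHS]linearB/=; congr col_mx.
  by apply/matrixP => i j; rewrite !mxE -mulr_natr; ring.
have SS : (S1 - S2)^T *m (S1 - S2) = (4 * lam0) *: N + (Sx - Sy) *m (Sx - Sy)^T.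
  rewrite S12 tr_col_mx mul_row_col trmxK trmx_scale sN -scalemxAl -scalemxAr NN.
  by rewrite scalerA -sl2; congr (_ *: _ + _); ring.
exists S1, S2; split.
- by rewrite /S1 tr_col_mx mul_row_col tr_scalar_mx trmxK -scalar_mxM sl2.
- rewrite /S2 tr_col_mx mul_row_col trmxK trmx_scale sH -scalemxAl -scalemxAr HH.
  by rewrite scalerA sl2 scalemx1.
- by rewrite mxtrace_mulC SS mxtraceD mxtraceZ NE (mxtrace_mulC nn^T) nn1 mxtrace1 mulr1.
- rewrite dot_mulmx trmxK -mulmxA SS mulmxDr dotDr -scalemxAr dotZr.
  have -> : v *m N = v.
    have -> : v = enorm v *: nn by rewrite nnE scalerA mulfV// scale1r.
    by rewrite -scalemxAl NE mulmxA nn1 mul1mx.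
  by rewrite lerDl mulmxA dotC dot_mulmx trmxK dot_ge0.
Qed.

End Coupling.

Section CoupledDecay.
Context {R : realType}.

Lemma lyap_sublevel (r k rho Lb : R) : 0 < k -> lyap r k rho <= Lb ->
  rho <= r ^+ 2 + Lb `^ (6 / k).
Proof.
move=> k0; rewrite /lyap; set s := Num.max _ 0 => h.
have s0 : 0 <= s by rewrite le_max lexx orbT.
have c1 : 1 <= 1 + s ^+ 3 := lyap_base r rho.
have c0 : 0 <= 1 + s ^+ 3 by lra.
have : 1 + s ^+ 3 <= Lb `^ (6 / k).
  have -> : 1 + s ^+ 3 = ((1 + s ^+ 3) `^ (k / 6)) `^ (6 / k).
    by rewrite -powRrM (_ : k / 6 * (6 / k) = 1) ?powRr1//; field; rewrite gt_eqF.
  apply: ge0_ler_powR => //; first by rewrite divr_ge0 ?ltW.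
    by rewrite nnegrE powR_ge0.
  by rewrite nnegrE (le_trans _ h)// powR_ge0.
have : s <= 1 + s ^+ 3.
  have [s1|s1] := leP s 1; first by have := exprn_ge0 3 s0; lra.
  have : s <= s ^+ 3 by rewrite -{1}(expr1 s) ler_weXn2l// ltW.
  lra.
have : rho - r ^+ 2 <= s by rewrite le_max lexx.
lra.
Qed.

(** Two regimes: above the level [Lb] the Lyapunov terms beat the constant [2 C] by themselves;
    below it [|x-y|^2 <= R0], where the barrier is strictly dissipative. *)
Lemma coupled_decay (r k al La lam0 c1 : R) :
  0 < r -> 0 < k -> 0 < al -> 0 <= La -> 0 < lam0 -> 0 < c1 ->
  let mu := c1 / (2 * lam0) in
  exists Bc om : R, [/\ 0 < Bc, 0 < om &
    forall D n (B z : 'rV[R]_D) (G : 'M[R]_(n, D)) F1 F2 F3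
      (tr1 bx1 q1 tr2 bx2 q2 gam3 Gam3 : R),
      gen B G z F1 (2 * tr1 - 2 * bx1) (4 * q1) ->
      0 <= F1 z -> tr1 <= La -> 0 <= q1 -> q1 <= La * F1 z ->
      (r ^+ 2 <= F1 z -> al * F1 z <= bx1) ->
      gen B G z F2 (2 * tr2 - 2 * bx2) (4 * q2) ->
      0 <= F2 z -> tr2 <= La -> 0 <= q2 -> q2 <= La * F2 z ->
      (r ^+ 2 <= F2 z -> al * F2 z <= bx2) ->
      gen B G z F3 gam3 Gam3 -> 0 < F3 z -> 16 * lam0 * F3 z <= Gam3 ->
      gam3 <= 8 * lam0 + 2 * c1 * (F3 z) `^ 2^-1 ->
      F3 z <= 2 * F1 z + 2 * F2 z ->
      exists gam Gam, gen B G z (fun y => Bc * barrier mu (F3 y) +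
          (lyap r k (F1 y) + lyap r k (F2 y))) gam Gam /\
        gam <= - (om * (Bc * barrier mu (F3 z) +
          (lyap r k (F1 z) + lyap r k (F2 z))))].
Proof.
move=> r0 k0 al0 La0 lam00 c10 mu.
have mu0 : 0 < mu by rewrite divr_gt0// mulr_gt0.
have [om1 [C [om10 C0 hL]]] := lyapunov_drift r0 k0 al0 La0.
pose Lb := 4 * C / om1.
pose R0 := 4 * (r ^+ 2 + Lb `^ (6 / k)).
pose nu := mu * c1 * expR (- mu * R0 `^ 2^-1).
have nu0 : 0 < nu by rewrite mulr_gt0 ?expR_gt0// mulr_gt0.
(* In the second regime the barrier yields at least [Bc nu = 2 C], the sum of the constants left by
   the two Lyapunov functions. *)
pose Bc := 2 * C / nu.
have Bc0 : 0 < Bc by rewrite divr_gt0// mulr_gt0.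
(* The barrier is at most 1, hence at most the sum of the two Lyapunov functions; so the whole
   energy is at most [Bc + 1] times that sum. *)
pose om := om1 / 2 / (Bc + 1).
have Bc1 : 0 < Bc + 1 by lra.
have om0 : 0 < om by rewrite divr_gt0// divr_gt0.
exists Bc, om; split=> // D n B z G F1 F2 F3 tr1 bx1 q1 tr2 bx2 q2 gam3 Gam3.
move=> g1 F10 t1 q10 q1le b1 g2 F20 t2 q20 q2le b2 g3 F30 hG hg F3le.
have [ga1 [Ga1 [l1 l1le]]] := hL _ _ _ _ _ _ _ _ _ g1 F10 t1 q10 q1le b1.
have [ga2 [Ga2 [l2 l2le]]] := hL _ _ _ _ _ _ _ _ _ g2 F20 t2 q20 q2le b2.
have [ga3 [Ga3 [l3 l3le]]] := gen_barrier g3 F30 lam00 c10 hG hg.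
have [Gam12 l12] := genD l1 l2.
have [Gam l] := genD (genZ Bc l3) l12.
exists (Bc * ga3 + (ga1 + ga2)), Gam; split; first exact: l.
have L1 := lyap_ge1 r (F1 z) (ltW k0); have L2 := lyap_ge1 r (F2 z) (ltW k0).
set S1 := lyap r k (F1 z) in l1le L1 *; set S2 := lyap r k (F2 z) in l2le L2 *.
have omS : om * (Bc * barrier mu (F3 z) + (S1 + S2)) <= om1 / 2 * (S1 + S2).
  have -> : om1 / 2 * (S1 + S2) = om * ((Bc + 1) * (S1 + S2)).
    by rewrite /om; field; rewrite gt_eqF.
  rewrite ler_wpM2l ?(ltW om0)//.
  have h1 : Bc * barrier mu (F3 z) <= Bc * 1 by rewrite ler_wpM2l ?barrier_le1 ?(ltW Bc0).
  have h2 : Bc * 1 <= Bc * (S1 + S2) by rewrite ler_wpM2l ?(ltW Bc0)//; lra.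
  lra.
have e3 : Bc * ga3 <= 0.
  rewrite pmulr_rle0// (le_trans l3le)// oppr_le0.
  have h0 : 0 <= mu * c1 by apply: mulr_ge0; exact: ltW.
  by apply: mulr_ge0 => //; exact: expR_ge0.
have [SL|SL] := leP (S1 + S2) Lb; last first.
  have : 4 * C < om1 * (S1 + S2) by move: SL; rewrite ltr_pdivrMr// [_ * om1]mulrC.
  clear -omS e3 l1le l2le; lra.
have h1 : F1 z <= r ^+ 2 + Lb `^ (6 / k) by apply: lyap_sublevel => //; rewrite -/S1;
  clear -SL L2; lra.
have h2 : F2 z <= r ^+ 2 + Lb `^ (6 / k) by apply: lyap_sublevel => //; rewrite -/S2;
  clear -SL L1; lra.
have F3R : F3 z <= R0 by rewrite /R0; clear -F3le h1 h2; lra.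
have : Bc * ga3 <= Bc * - nu.
  apply: ler_wpM2l; first exact: ltW.
  apply: le_trans l3le _; rewrite lerN2 /nu; apply: ler_wpM2l; first by apply: mulr_ge0; exact: ltW.
  rewrite ler_expR !mulNr lerN2; apply: ler_wpM2l; first exact: ltW.
  apply: ge0_ler_powR => //; rewrite nnegrE; first exact: ltW.
  exact: le_trans (ltW F30) F3R.
have -> : Bc * - nu = - (2 * C) by rewrite /Bc; field; rewrite gt_eqF.
have : 0 <= om1 * (S1 + S2) by rewrite mulr_ge0 ?(ltW om10)//; clear -L1 L2; lra.
clear -omS l1le l2le; lra.
Qed.

End CoupledDecay.

Section CoupledQuantities.
Context {R : realType} {d : nat}.
Local Notation D := (1 + d)%N.
Implicit Types (z : 'rV[R]_(D + D)) (e : R).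

Definition coupled (t : R) (x : 'rV[R]_d) (s : R) (y : 'rV[R]_d) : 'rV[R]_(D + D) :=
  row_mx (spacetime t x) (spacetime s y).

(** One formula for [|x|^2], [|y|^2] and [|x-y|^2], with weights (1,0), (0,1) and (1,-1). *)
Definition coupled_sqnorm e1 e2 z : R :=
  let v := e1 *: rsubmx (lsubmx z) + e2 *: rsubmx (rsubmx z) in dot v v.

Definition coupled_time e1 e2 z : R :=
  e1 * lsubmx z 0 (lshift d 0) + e2 * rsubmx z 0 (lshift d 0).

Lemma coupled_sqnormE e1 e2 t x s y :
  coupled_sqnorm e1 e2 (coupled t x s y) =
    dot (e1 *: x + e2 *: y) (e1 *: x + e2 *: y).
Proof. by rewrite /coupled_sqnorm /coupled row_mxKl !row_mxKr. Qed.

Lemma coupled_timeE e1 e2 t x s y :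
  coupled_time e1 e2 (coupled t x s y) = e1 * t + e2 * s.
Proof. by rewrite /coupled_time /coupled row_mxKl row_mxKr !spacetime_time. Qed.

Lemma coupled_spaceE e1 e2 z :
  z *m col_mx (col_mx 0 e1%:M) (col_mx 0 e2%:M) =
    e1 *: rsubmx (lsubmx z) + e2 *: rsubmx (rsubmx z).
Proof.
rewrite -[in LHS](hsubmxK z) mul_row_col -[in LHS](hsubmxK (lsubmx z)).
rewrite -[in LHS](hsubmxK (rsubmx z)) !mul_row_col !mulmx0 !add0r.
by rewrite !mul_mx_scalar.
Qed.

Lemma coupled_timeM e1 e2 z : coupled_time e1 e2 z =
  dot (row_mx (spacetime e1 0) (spacetime e2 0)) z.
Proof.
rewrite -[in RHS](hsubmxK z) dot_row_mx -[in RHS](hsubmxK (lsubmx z)).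
rewrite -[in RHS](hsubmxK (rsubmx z)) !dot_row_mx !dot0l !addr0.
rewrite /coupled_time /dot !big_ord1 !mxE eqxx !mulr1n.
by congr (_ * z _ _ + _ * z _ _);
  (congr (lshift _ (lshift _ _)) || congr (rshift _ (lshift _ _))); apply/val_inj.
Qed.

Lemma continuous_coupled_space e1 e2 : continuous (fun z : 'rV[R]_(D + D) =>
  e1 *: rsubmx (lsubmx z) + e2 *: rsubmx (rsubmx z)).
Proof.
rewrite (_ : (fun z => _) = fun z : 'rV[R]_(D + D) =>
  z *m col_mx (col_mx 0 e1%:M) (col_mx 0 e2%:M)); first exact: continuous_mulmx.
by apply/funext => z; rewrite coupled_spaceE.
Qed.

Lemma continuous_coupled_sqnorm e1 e2 : continuous (coupled_sqnorm e1 e2).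
Proof.
pose v (z : 'rV[R]_(D + D)) := e1 *: rsubmx (lsubmx z) + e2 *: rsubmx (rsubmx z).
have cv : continuous v := @continuous_coupled_space e1 e2.
exact: (@continuous_sqnorm _ _ _ v cv).
Qed.

Lemma continuous_coupled_time e1 e2 : continuous (coupled_time e1 e2).
Proof.
have -> : coupled_time e1 e2 = fun z => dot (row_mx (spacetime e1 0) (spacetime e2 0)) z.
  by apply/funext => z; exact: coupled_timeM.
by apply: continuous_dot => z; [exact: cst_continuous|exact: cvg_id].
Qed.

Lemma gen_coupled_sqnorm n e1 e2 (B1 B2 z1 z2 : 'rV[R]_D) (S1 S2 : 'M[R]_(n, d)) :
  gen (row_mx B1 B2) (row_mx (row_mx 0 S1) (row_mx 0 S2)) (row_mx z1 z2)
    (coupled_sqnorm e1 e2)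
    (2 * \tr ((e1 *: S1 + e2 *: S2) *m (e1 *: S1 + e2 *: S2)^T) -
     2 * dot (e1 *: rsubmx B1 + e2 *: rsubmx B2) (e1 *: rsubmx z1 + e2 *: rsubmx z2))
    (4 * dot ((e1 *: rsubmx z1 + e2 *: rsubmx z2) *m (e1 *: S1 + e2 *: S2)^T)
             ((e1 *: rsubmx z1 + e2 *: rsubmx z2) *m (e1 *: S1 + e2 *: S2)^T)).
Proof.
have GL : row_mx (row_mx (0 : 'M[R]_(n, 1)) S1) (row_mx (0 : 'M[R]_(n, 1)) S2) *m
    col_mx (col_mx 0 e1%:M) (col_mx 0 e2%:M) = e1 *: S1 + e2 *: S2.
  by rewrite !mul_row_col !mulmx0 !add0r !mul_mx_scalar.
have := gen_sqnorm (row_mx B1 B2) (row_mx (row_mx 0 S1) (row_mx 0 S2))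
  (row_mx z1 z2) (col_mx (col_mx 0 e1%:M) (col_mx 0 e2%:M)).
rewrite GL !coupled_spaceE !row_mxKl !row_mxKr; apply: gen_ext => y.
by rewrite coupled_spaceE.
Qed.

Lemma gen_coupled_time n e1 e2 (B1 B2 z1 z2 : 'rV[R]_D) (S1 S2 : 'M[R]_(n, d)) :
  gen (row_mx B1 B2) (row_mx (row_mx 0 S1) (row_mx 0 S2)) (row_mx z1 z2)
    (coupled_time e1 e2) (- coupled_time e1 e2 (row_mx B1 B2)) 0.
Proof.
have := gen_affine (row_mx B1 B2) (row_mx (row_mx 0 S1) (row_mx 0 S2))
  (row_mx z1 z2) (row_mx (spacetime e1 0) (spacetime e2 0)) 0.
rewrite !tr_row_mx !mul_row_col trmx0 !mulmx0 !mul0mx !addr0 dot0l.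
rewrite dotC -coupled_timeM; apply: gen_ext => y; by rewrite coupled_timeM addr0.
Qed.

End CoupledQuantities.

Section CouplingEstimates.
Context {R : realType} {d l : nat}.
Context (lambda0 sigma0 sigma1 : R) (Sigma : 'rV[R]_d -> 'M[R]_(d, l))
  (d_gt0 : (0 < d)%N) (lambda0_gt0 : 0 < lambda0)
  (Sigma_bounded : forall x, opnorm (Sigma x) <= sigma0)
  (Sigma_lip : forall x y, opnorm (Sigma x - Sigma y) <= sigma1 * enorm (x - y)).

Let La := d%:R * (lambda0 + sigma0 ^+ 2).

Lemma row_Sigma_le x i : enorm (row i (Sigma x)) <= sigma0.
Proof. exact: le_trans (enorm_row_le_opnorm _ _) (Sigma_bounded x). Qed.

Lemma sigma0_ge0 : 0 <= sigma0.
Proof. exact: le_trans (enorm_ge0 _) (row_Sigma_le 0 (Ordinal d_gt0)). Qed.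

Lemma trace_diffusion_le n (S : 'M[R]_(n, d)) x :
  S^T *m S = lambda0%:M + Sigma x *m (Sigma x)^T -> \tr (S *m S^T) <= La.
Proof.
move=> E; rewrite mxtrace_mulC E mxtraceD mxtrace_scalar /La mulrDr mulr_natl.
rewrite lerD2l; apply: trace_gram_le => i.
by rewrite ler_sqr ?nnegrE ?enorm_ge0 ?sigma0_ge0// row_Sigma_le.
Qed.

Lemma quad_diffusion_le n (S : 'M[R]_(n, d)) x v :
  S^T *m S = lambda0%:M + Sigma x *m (Sigma x)^T ->
  dot (v *m S^T) (v *m S^T) <= La * dot v v.
Proof.
move=> E; rewrite dot_mulmx trmxK -mulmxA E mulmxDr mul_mx_scalar dotDr dotZr.
rewrite mulmxA -[Sigma x in X in _ + X]trmxK -dot_mulmx trmxK.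
have h : dot (v *m Sigma x) (v *m Sigma x) <= sigma0 ^+ 2 * dot v v.
  rewrite -!sqr_enorm -exprMn ler_sqr ?nnegrE ?enorm_ge0 ?mulr_ge0 ?enorm_ge0 ?sigma0_ge0//.
  apply: le_trans (opnorm_le _ _) _.
  by rewrite ler_wpM2r ?enorm_ge0.
apply: (@le_trans _ _ ((lambda0 + sigma0 ^+ 2) * dot v v)).
  by rewrite mulrDl lerD2l.
rewrite ler_wpM2r ?dot_ge0// /La ler_peMl ?ler1n//.
by rewrite addr_ge0 ?sqr_ge0// ltW.
Qed.

(** Of the two factors in [|row|^2] one is bounded by [2 sigma0], the other by [sigma1 |x-y|]; the
    linear rate lets the term be treated like the drift at all distances. *)
Lemma trace_increment_le x y :
  \tr ((Sigma x - Sigma y) *m (Sigma x - Sigma y)^T) <=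
    2 * d%:R * `|sigma0 * sigma1| * enorm (x - y).
Proof.
have n0 := enorm_ge0 (x - y).
have -> : 2 * d%:R * `|sigma0 * sigma1| * enorm (x - y) =
  d%:R * (2 * `|sigma0 * sigma1| * enorm (x - y)) by ring.
apply: trace_gram_le => i.
have h1 : enorm (row i (Sigma x - Sigma y)) <= sigma1 * enorm (x - y).
  exact: le_trans (enorm_row_le_opnorm _ _) (Sigma_lip x y).
have h2 : enorm (row i (Sigma x - Sigma y)) <= 2 * sigma0.
  rewrite linearB/=; apply: le_trans (enormD _ _) _; rewrite enormN.
  by have := row_Sigma_le x i; have := row_Sigma_le y i; lra.
apply: (@le_trans _ _ ((2 * sigma0) * (sigma1 * enorm (x - y)))).
  by rewrite expr2; apply: ler_pM => //; exact: enorm_ge0.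
have -> : 2 * sigma0 * (sigma1 * enorm (x - y)) =
  2 * (sigma0 * sigma1 * enorm (x - y)) by ring.
by rewrite -[leRHS]mulrA ler_wpM2l// ler_wpM2r// ler_norm.
Qed.

(** [b1], [b2], [b3] stand for [b t x], [b t y], [b s y]; the mismatch of times costs the [1] in the
    coefficient of [|x-y|]. *)
Lemma coupling_estimates c0 (b1 b2 b3 : 'rV[R]_d) x y : x != y ->
  - c0 * enorm (x - y) <= dot (b1 - b2) (x - y) -> enorm (b2 - b3) <= 1 ->
  exists S1 S2 : 'M[R]_(d + l, d),
  [/\ S1^T *m S1 = lambda0%:M + Sigma x *m (Sigma x)^T,
      S2^T *m S2 = lambda0%:M + Sigma y *m (Sigma y)^T,
      2 * \tr ((S1 - S2) *m (S1 - S2)^T) - 2 * dot (b1 - b3) (x - y) <=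
        8 * lambda0 + 2 * (c0 + 1 + 2 * d%:R * `|sigma0 * sigma1|) * enorm (x - y) &
      16 * lambda0 * dot (x - y) (x - y) <=
        4 * dot ((x - y) *m (S1 - S2)^T) ((x - y) *m (S1 - S2)^T)].
Proof.
move=> xy hb h1.
have [S1 [S2 [E1 E2 E3 E4]]] :=
  reflection_coupling (Sigma x) (Sigma y) (ltW lambda0_gt0) xy.
exists S1, S2; split=> //; last by lra.
rewrite E3; have := trace_increment_le x y.
have -> : dot (b1 - b3) (x - y) = dot (b1 - b2) (x - y) + dot (b2 - b3) (x - y).
  by rewrite -dotDl addrA subrK.
have : - enorm (x - y) <= dot (b2 - b3) (x - y).
  have := dot_le (- (b2 - b3)) (x - y); rewrite dotNl enormN.
  have : enorm (b2 - b3) * enorm (x - y) <= 1 * enorm (x - y).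
    by rewrite ler_wpM2r ?enorm_ge0.
  lra.
have -> : 2 * (c0 + 1 + 2 * d%:R * `|sigma0 * sigma1|) * enorm (x - y) =
  2 * (c0 * enorm (x - y)) + 2 * enorm (x - y) +
  2 * (2 * d%:R * `|sigma0 * sigma1| * enorm (x - y)) by ring.
move: hb; rewrite mulNr; lra.
Qed.

End CouplingEstimates.

(** * Doubling of variables *)

Section Majorant.
Context {R : realType} {D n : nat}.
Implicit Types (B z : 'rV[R]_D) (G : 'M[R]_(n, D)).

(** [tau] is time, with generator -1: differentiating the exponential gives [om Phi], which the
    decay of [Phi] offsets; [eps (2 C2 + 1) tau] offsets the penalties and leaves [- eps]. The
    difference of times [de] is annihilated by the generator, and so is [de^2]. *)
Lemma gen_majorant B z G (Phi F1 F2 tau de : 'rV[R]_D -> R)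
    (gPhi GPhi g1 Ga1 g2 Ga2 M om eps C2 N t1 kap : R) :
  0 <= M -> 0 <= eps -> 0 <= N ->
  gen B G z Phi gPhi GPhi -> gPhi <= - (om * Phi z) ->
  gen B G z F1 g1 Ga1 -> g1 <= C2 -> gen B G z F2 g2 Ga2 -> g2 <= C2 ->
  gen B G z tau (- 1) 0 -> gen B G z de 0 0 ->
  exists gam Gam, gen B G z (fun y => M * expR (- om * tau y) * Phi y +
      eps * (F1 y + F2 y) + (eps * (2 * C2 + 1) * tau y +
      N * Num.max (tau y - t1) 0 ^+ 3) + kap * de y ^+ 2) gam Gam /\
    gam <= - eps.
Proof.
move=> M0 eps0 N0 hPhi hPhi_le h1 h1le h2 h2le htau hde.
have htauE (g : R -> R) c1 c2 : jet1 g (tau z) c1 c2 ->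
    gen B G z (fun y => g (tau y)) (- c1) 0.
  by move=> /(gen_comp htau); rewrite !mulr0 addr0 mulrN1.
have e3 := genZ M (htauE _ _ _ (jet1_expR (- om) (tau z))); rewrite mulr0 in e3.
have [Ga3 h3] := genM e3 hPhi.
have [Ga4 h4] := genD h1 h2.
have e5 := gen_comp htau (jet1_affine 1 (- t1) (tau z)).
rewrite !(mul0r, mulr0, mul1r, addr0) in e5.
have e6 := gen_comp e5 (jet1_cube_pos _); rewrite !(mulr0, addr0) in e6.
have [Ga7 h7] := genD (genZ (eps * (2 * C2 + 1)) htau) (genZ N e6).
have h8 := gen_comp hde (jet1_sqr (de z)).
rewrite !(mulr0, addr0) in h8.
have [Ga9 h9] := genD h3 (genZ eps h4).
have [Ga10 h10] := genD h9 h7.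
have [Ga11 h11] := genD h10 (genZ kap h8).
eexists; exists Ga11; split.
  apply: gen_ext h11 => y; rewrite mul1r //.
set E := expR (- om * tau z); have E0 : 0 <= E := expR_ge0 _.
have a1 : M * E * (om * Phi z + gPhi) <= 0.
  by apply: mulr_ge0_le0; [exact: mulr_ge0|lra].
have a2 : eps * (g1 + g2) <= eps * (2 * C2) by rewrite ler_wpM2l//; lra.
have a3 : 0 <= N * (3 * Num.max (1 * tau z - t1) 0 ^+ 2).
  by rewrite mulr_ge0// mulr_ge0// sqr_ge0.
have -> : Phi z * (M * - (- om * E)) + M * E * gPhi = M * E * (om * Phi z + gPhi) by ring.
rewrite mul1r in a3 *; rewrite !mulrN1 mulr0 addr0.
move: a1 a2 a3; clear; rewrite mulrN; lra.
Qed.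

End Majorant.

Section WithinContinuity.
Context {R : realType}.

Lemma continuous_within_range (T U V : topologicalType) (q : T -> U) (A : set U)
    (f : U -> V) :
  {within A, continuous f} -> continuous q -> (forall x, A (q x)) ->
  continuous (fun x => f (q x)).
Proof.
move=> /subspace_continuousP hf cq hq x W /(hf _ (hq x)) h.
have {}h : \forall y \near x, A (q y) -> W (f (q y)) := cq x _ h.
by apply: (filterS _ h) => y; apply.
Qed.

Lemma continuous_pair (T U V : topologicalType) (f : T -> U) (g : T -> V) :
  continuous f -> continuous g -> continuous (fun x => (f x, g x)).
Proof.
move=> cf cg x W [[P Q] /= [hP hQ] hW].
have hf : \forall y \near x, P (f y) := cf x _ hP.
have hg : \forall y \near x, Q (g y) := cg x _ hQ.
suff : \forall y \near x, W (f y, g y) by [].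
by apply: filterS2 hf hg => y Py Qy; exact: (hW (f y, g y)).
Qed.

Lemma continuous_rsubmx m n : continuous (fun z : 'rV[R]_(m + n) => rsubmx z).
Proof.
apply: continuous_rV => i z.
have -> : (fun z : 'rV[R]_(m + n) => rsubmx z 0 i) = fun z => z 0 (rshift m i).
  by apply/funext => y; rewrite mxE.
exact: coord_continuous.
Qed.

Lemma continuous_lsubmx m n : continuous (fun z : 'rV[R]_(m + n) => lsubmx z).
Proof.
apply: continuous_rV => i z.
have -> : (fun z : 'rV[R]_(m + n) => lsubmx z 0 i) = fun z => z 0 (lshift n i).
  by apply/funext => y; rewrite mxE.
exact: coord_continuous.
Qed.

Lemma continuous_maxl (T : topologicalType) (f : T -> R) (a : R) :
  continuous f -> continuous (fun x => Num.max a (f x)).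
Proof.
by move=> cf x; apply: (@continuous_max R T (fun=> a)); [exact: cst_continuous|exact: cf].
Qed.

Lemma continuous_clip T : continuous (clip T : R -> R).
Proof.
apply: continuous_maxl => x.
by apply: (@continuous_min R R id (fun=> T)); [exact: cvg_id|exact: cst_continuous].
Qed.

Lemma continuous_extend d T (u : R -> 'rV[R]_d -> R) : 0 < T ->
  {within `[0, T]%classic `*` [set: 'rV[R]_d],
     continuous (fun p : R * 'rV[R]_d => u p.1 p.2)} ->
  continuous (extend T u).
Proof.
move=> T0 cu.
pose q (z : 'rV[R]_(1 + d)) := (clip T (z 0 (lshift d 0)), rsubmx z).
have cq : continuous q.
  apply: continuous_pair; last exact: continuous_rsubmx.
  by move=> z; apply: continuous_comp; [exact: coord_continuous|exact: continuous_clip].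
apply: (continuous_within_range cu cq) => z; split=> //=.
by rewrite in_itv/= clip_itv.
Qed.

(** [b] is continuous only for positive times; the cut-off at [tau] makes it continuous
    everywhere. *)
Lemma continuous_drift d (b : R -> 'rV[R]_d -> 'rV[R]_d) tau : 0 < tau ->
  {within [set p : R * 'rV[R]_d | 0 < p.1],
     continuous (fun p : R * 'rV[R]_d => b p.1 p.2)} ->
  continuous (fun z : 'rV[R]_(1 + d) => b (Num.max tau (z 0 (lshift d 0))) (rsubmx z)).
Proof.
move=> tau0 cb.
pose q (z : 'rV[R]_(1 + d)) := (Num.max tau (z 0 (lshift d 0)), rsubmx z).
have cq : continuous q.
  apply: continuous_pair; last exact: continuous_rsubmx.
  by apply: continuous_maxl => z; exact: coord_continuous.
by apply: (continuous_within_range cb cq) => z /=; rewrite lt_max tau0.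
Qed.

Lemma spacetime_drift_continuous_at d (b : R -> 'rV[R]_d -> 'rV[R]_d)
    (z1 : 'rV[R]_(1 + d)) :
  {within [set p : R * 'rV[R]_d | 0 < p.1],
     continuous (fun p : R * 'rV[R]_d => b p.1 p.2)} ->
  0 < z1 0 (lshift d 0) ->
  forall e : R, 0 < e -> exists2 de : R, 0 < de &
    forall z, enorm (z - z1) <= de ->
      enorm (spacetime_drift b z - spacetime_drift b z1) <= e.
Proof.
move=> cb t0 e e0; have t20 : 0 < z1 0 (lshift d 0) / 2 by rewrite divr_gt0.
set tau := _ / 2 in t20.
pose bt (z : 'rV[R]_(1 + d)) := b (Num.max tau (z 0 (lshift d 0))) (rsubmx z).
have cbt : continuous (fun z => bt z - bt z1).
  move=> z; apply: continuousB; first exact: continuous_drift.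
  exact: cst_continuous.
have cs : continuous (fun z => dot (bt z - bt z1) (bt z - bt z1)).
  exact: continuous_sqnorm.
have /continuous_enormP/(_ (e ^+ 2))[|de de0 h] := cs z1.
  by rewrite exprn_gt0.
exists (Num.min de tau) => [|z]; first by rewrite lt_min de0.
rewrite le_min => /andP[zd zt].
have btE y : enorm (y - z1) <= tau -> spacetime_drift b y = spacetime 1 (bt y).
  move=> yt; congr (spacetime 1 (b _ _)); rewrite (max_idPr _)//.
  have := coord_le_enorm (y - z1) (lshift d 0).
  by rewrite !mxE ler_norml => /andP[+ _]; rewrite /tau in yt *; lra.
rewrite !btE ?subrr ?enorm0 ?(ltW t20)//.
rewrite /spacetime opp_row_mx add_row_mx subrr.
rewrite -ler_sqr ?nnegrE ?enorm_ge0 ?(ltW e0)// sqr_enorm dot_row_mx dot0l add0r.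
have := h _ zd; rewrite subrr dot0l subr0 ger0_norm ?dot_ge0//.
Qed.

End WithinContinuity.

Section CoefficientRegularity.
Context {R : realType}.

Lemma spatial_diffusion_gram d l n lambda0 (Sigma : 'rV[R]_d -> 'M[R]_(d, l)) z
    (S : 'M[R]_(n, d)) :
  S^T *m S = lambda0%:M + Sigma (rsubmx z) *m (Sigma (rsubmx z))^T ->
  spatial_diffusion lambda0 Sigma z = (row_mx (0 : 'M[R]_(n, 1)) S)^T *m row_mx 0 S.
Proof.
move=> E; rewrite tr_row_mx mul_col_row trmx0 !mul0mx mulmx0 E.
by [].
Qed.

Lemma spatial_diffusion_continuous_at d l (lambda0 sigma0 sigma1 : R)
    (Sigma : 'rV[R]_d -> 'M[R]_(d, l)) (z1 : 'rV[R]_(1 + d)) :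
  (0 < d)%N -> (forall x, opnorm (Sigma x) <= sigma0) ->
  (forall x y, opnorm (Sigma x - Sigma y) <= sigma1 * enorm (x - y)) ->
  forall e : R, 0 < e -> exists2 de : R, 0 < de &
    forall z, enorm (z - z1) <= de -> forall i j,
      `|spatial_diffusion lambda0 Sigma z i j - spatial_diffusion lambda0 Sigma z1 i j|
        <= e.
Proof.
move=> d0 Sb Sl e e0; have s0 := sigma0_ge0 d0 Sb.
have c0 : 0 < 2 * sigma0 * `|sigma1| + 1 by rewrite ltr_wpDl// !mulr_ge0.
exists (e / (2 * sigma0 * `|sigma1| + 1)) => [|z zd i j]; first by rewrite divr_gt0.
set x := rsubmx z; set y := rsubmx z1.
have xy : enorm (x - y) <= enorm (z - z1) by rewrite /x /y -linearB enorm_rsubmx.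
have rowB k : enorm (row k (Sigma x) - row k (Sigma y)) <= `|sigma1| * enorm (x - y).
  rewrite -linearB/=; apply: le_trans (enorm_row_le_opnorm _ _) _.
  by apply: le_trans (Sl _ _) _; rewrite ler_wpM2r ?enorm_ge0// ler_norm.
have [i' ->|i' ->] := split_ordP i.
  have [j' ->|j' ->] := split_ordP j.
    by rewrite !block_mxEul subrr normr0 ltW.
  by rewrite !block_mxEur subrr normr0 ltW.
have [j' ->|j' ->] := split_ordP j.
  by rewrite !block_mxEdl subrr normr0 ltW.
have AE w : spatial_diffusion lambda0 Sigma w (rshift 1 i') (rshift 1 j') =
    (lambda0%:M : 'M[R]_d) i' j' +
    dot (row i' (Sigma (rsubmx w))) (row j' (Sigma (rsubmx w))).
  rewrite block_mxEdr [LHS]mxE; congr (_ + _).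
  by rewrite mxE; apply: eq_bigr => k _; rewrite !mxE.
rewrite !AE -/x -/y.
set a1 := row i' (Sigma x); set a2 := row j' (Sigma x).
set b1 := row i' (Sigma y); set b2 := row j' (Sigma y).
have -> : (lambda0%:M : 'M[R]_d) i' j' + dot a1 a2 -
    ((lambda0%:M : 'M[R]_d) i' j' + dot b1 b2) = dot (a1 - b1) a2 + dot b1 (a2 - b2).
  by rewrite dotBl dotBr; ring.
apply: le_trans (ler_normD _ _) _.
have h1 : `|dot (a1 - b1) a2| <= `|sigma1| * enorm (x - y) * sigma0.
  apply: le_trans (dot_le_enorm _ _) _; apply: ler_pM; rewrite ?enorm_ge0//.
    exact: rowB.
  exact: (row_Sigma_le Sb).
have h2 : `|dot b1 (a2 - b2)| <= sigma0 * (`|sigma1| * enorm (x - y)).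
  apply: le_trans (dot_le_enorm _ _) _; apply: ler_pM; rewrite ?enorm_ge0//.
    exact: (row_Sigma_le Sb).
  exact: rowB.
move: zd; rewrite ler_pdivlMr// => zd; apply: le_trans zd.
apply: (@le_trans _ _ (enorm (x - y) * (2 * sigma0 * `|sigma1| + 1))).
  have := enorm_ge0 (x - y); lra.
by rewrite ler_wpM2r// ltW.
Qed.

Lemma continuous_lyap_sqnorm (T : topologicalType) n (v : T -> 'rV[R]_n) r k :
  continuous v -> continuous (fun y => lyap r k (dot (v y) (v y))).
Proof.
move=> cv; apply: (@continuous_compr _ _ _ v (fun x => lyap r k (dot x x))) => //.
apply: jet_continuous => x.
have [Ga [p [X [j _ _]]]] := gen_lyap r k (gen_sqnorm (0 : 'rV[R]_n) (0 : 'M[R]_(n, n)) x 1%:M).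
exists p, X; apply: jet_ext j => y; by rewrite mulmx1.
Qed.

Lemma continuous_barrier_sqnorm (T : topologicalType) n (v : T -> 'rV[R]_n) mu :
  continuous v -> continuous (fun y => barrier mu (dot (v y) (v y))).
Proof.
move=> cv.
have -> : (fun y => barrier mu (dot (v y) (v y))) =
    fun y => 1 - expR (- mu * Num.sqrt (dot (v y) (v y))).
  by apply/funext => y; rewrite /barrier powR12_sqrt ?dot_ge0.
apply: continuous_subr => [y|]; first exact: cst_continuous.
apply: continuous_compr; last exact: continuous_expR.
apply: continuous_scaler; apply: continuous_compr; last exact: sqrt_continuous.
exact: continuous_sqnorm.
Qed.

Lemma continuous_exprn (T : topologicalType) (f : T -> R) n :
  continuous f -> continuous (fun y => f y ^+ n).
Proof.
move=> cf; elim: n => [|n IH].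
  by move=> y; under [X in continuous_at _ X]eq_fun do rewrite expr0; exact: cst_continuous.
have -> : (fun y => f y ^+ n.+1) = fun y => f y * f y ^+ n.
  by apply/funext => y; rewrite exprS.
exact: continuous_mulr.
Qed.

End CoefficientRegularity.

Section Doubling.
Context {R : realType}.

(** Comparison with [zs] gives [kap g z <= max f - f zs], so a finite [kap] depending on [e]
    suffices; the [+ 1] keeps it positive. *)
Lemma penalized_max n (S : set 'rV[R]_n) (M : R) (f g : 'rV[R]_n -> R) zs e :
  closed S -> (forall x, S x -> enorm x <= M) -> continuous f -> continuous g ->
  S zs -> g zs = 0 -> (forall z, 0 <= g z) -> 0 < e ->
  exists kap z, [/\ S z, g z <= e, f zs <= f z &
    forall y, S y -> f y - kap * g y <= f z - kap * g z].
Proof.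
move=> cS bS cf cg Szs gzs g0 e0.
have [c Sc hc] := max_closed_bounded cS bS (ex_intro _ zs Szs) cf.
pose kap := (f c - f zs + 1) / e.
have k0 : 0 < kap by rewrite divr_gt0//; have := hc _ Szs; lra.
have [||z Sz hz] := @max_closed_bounded R n S M (fun y => f y - kap * g y) cS bS.
- by exists zs.
- by apply: continuous_subr => //; exact: continuous_scaler.
have h := hz _ Szs; rewrite gzs mulr0 subr0 in h.
have kg : 0 <= kap * g z by rewrite mulr_ge0// ltW.
exists kap, z; split=> //; last by lra.
rewrite -(ler_pM2l k0) {2}/kap divfK ?gt_eqF//; have := hc _ Sz; lra.
Qed.

Context {d : nat}.
Local Notation D := (1 + d)%N.
Implicit Types (t s : R) (x y : 'rV[R]_d) (z : 'rV[R]_(D + D)).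

Lemma coupledP z : exists t x s y, z = coupled t x s y.
Proof.
exists (lsubmx z 0 (lshift d 0)), (rsubmx (lsubmx z)).
exists (rsubmx z 0 (lshift d 0)), (rsubmx (rsubmx z)).
by rewrite /coupled !spacetimeE hsubmxK.
Qed.

Lemma spacetimeD t x (w : 'rV[R]_D) :
  spacetime t x + w = spacetime (t + w 0 (lshift d 0)) (x + rsubmx w).
Proof.
by rewrite -{1}(spacetimeE w) /spacetime add_row_mx raddfD.
Qed.

Lemma spacetimeB t x s y :
  spacetime t x - spacetime s y = spacetime (t - s) (x - y) :> 'rV[R]_D.
Proof. by rewrite /spacetime opp_row_mx add_row_mx raddfB. Qed.

Lemma enorm_spacetime t (x : 'rV[R]_d) : enorm (spacetime t x) <= `|t| + enorm x.
Proof.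
apply: le_trans (enorm_row_mx _ _) _; rewrite lerD2r.
by rewrite /enorm /dot big_ord1 !mxE mulr1n -expr2 sqrtr_sqr.
Qed.

Lemma enorm_coupled t x s y :
  enorm (coupled t x s y) <= `|t| + enorm x + (`|s| + enorm y).
Proof.
by apply: le_trans (enorm_row_mx _ _) _; rewrite lerD ?enorm_spacetime.
Qed.

Lemma coupledB t x s y t' x' s' y' :
  coupled t x s y - coupled t' x' s' y' = coupled (t - t') (x - x') (s - s') (y - y').
Proof. by rewrite /coupled opp_row_mx add_row_mx !spacetimeB. Qed.

Definition cylinder T Rb : set 'rV[R]_(D + D) := [set z | forall t x s y,
  z = coupled t x s y -> [/\ 0 <= t <= T, 0 <= s <= T, enorm x <= Rb & enorm y <= Rb]].

Lemma coupled_inj t x s y t' x' s' y' :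
  coupled t x s y = coupled t' x' s' y' -> [/\ t = t', x = x', s = s' & y = y'].
Proof.
move=> /eq_row_mx[h1 h2]; split.
- by have := spacetime_time t x; rewrite h1 spacetime_time.
- by have := spacetime_space t x; rewrite h1 spacetime_space.
- by have := spacetime_time s y; rewrite h2 spacetime_time.
- by have := spacetime_space s y; rewrite h2 spacetime_space.
Qed.

Lemma cylinderE T Rb t x s y : cylinder T Rb (coupled t x s y) <->
  [/\ 0 <= t <= T, 0 <= s <= T, enorm x <= Rb & enorm y <= Rb].
Proof.
split=> [|h t' x' s' y' /coupled_inj[<- <- <- <-]//]; exact.
Qed.

Lemma closed_cylinder T Rb : 0 <= Rb -> closed (cylinder T Rb).
Proof.
move=> Rb0.
have -> : cylinder T Rb = [set z | - coupled_time 1 0 z <= 0] `&`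
    [set z | coupled_time 1 0 z <= T] `&` ([set z | - coupled_time 0 1 z <= 0] `&`
    [set z | coupled_time 0 1 z <= T]) `&` ([set z | coupled_sqnorm 1 0 z <= Rb ^+ 2] `&`
    [set z | coupled_sqnorm 0 1 z <= Rb ^+ 2]).
  apply/seteqP; split=> z /=; have [t [x [s [y ->]]]] := coupledP z;
    rewrite !coupled_timeE !coupled_sqnormE !(mul1r, mul0r, scale1r, scale0r, add0r, addr0)
      !oppr_le0 !dot_le_sqr//.
    by move=> /cylinderE[/andP[-> ->] /andP[-> ->] -> ->].
  by move=> [[[t0 tT] [s0 sT]] [xR yR]]; apply/cylinderE; rewrite t0 s0.
by repeat apply: closedI; apply: closed_sublevel; try apply: continuous_oppr;
  (exact: continuous_coupled_time || exact: continuous_coupled_sqnorm).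
Qed.

Lemma coupled_gap t x s y : coupled_time 1 (-1) (coupled t x s y) = t - s.
Proof. by rewrite coupled_timeE mul1r mulN1r. Qed.

(* The times are doubled and then tied together by the penalty; uniform
   continuity transfers the information on [W] from equal times to the maximum. *)
Lemma doubling_time (W : 'rV[R]_(D + D) -> R) (T t2 Rb ts : R) xs ys :
  t2 < T -> 0 < Rb -> continuous W ->
  (forall t x y, 0 <= t <= T -> enorm x <= Rb -> enorm y <= Rb ->
     0 < W (coupled t x t y) ->
     [/\ 0 < t < t2, enorm x < Rb, enorm y < Rb & x != y]) ->
  0 <= ts <= T -> enorm xs <= Rb -> enorm ys <= Rb -> 0 < W (coupled ts xs ts ys) ->
  exists2 tau : R, 0 < tau & forall eta, 0 < eta ->
  exists kap t x s y r0,
    [/\ [/\ tau < t < T, tau < s < T & `|t - s| <= eta],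
        [/\ enorm x < Rb, enorm y < Rb & x != y], 0 < r0 <= tau &
      forall w1 w2, enorm w1 <= r0 -> enorm w2 <= r0 ->
        let g z := W z - kap * coupled_time 1 (-1) z ^+ 2 in
        g (row_mx (spacetime t x + w1) (spacetime s y + w2)) <= g (coupled t x s y)].
Proof.
move=> t2T Rb0 cW hW /[dup] tsT /andP[ts0 tsT'] xsR ysR Ws.
set w0 := W _ in Ws.
have T0 : 0 <= T := le_trans ts0 tsT'.
pose M0 := 2 * (T + Rb) + 1.
have M00 : 0 < M0 by rewrite /M0; lra.
have bS z : cylinder T Rb z -> enorm z <= M0.
  have [t [x [s [y ->]]]] := coupledP z.
  move=> /cylinderE[/andP[t0 tT] /andP[s0 sT] xR yR].
  apply: le_trans (enorm_coupled _ _ _ _) _.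
  by rewrite !ger0_norm// /M0; lra.
have w20 : 0 < w0 / 2 by rewrite divr_gt0.
have [de de0 hde] := uniform_continuity M00 w20 cW.
have tau0 : 0 < de / 4 by rewrite divr_gt0.
exists (de / 4) => // eta eta0.
(* [de / 8] stays within the modulus of [W] and keeps [s] away from 0, while [(T - t2) / 2] keeps
   [s] below [T]. The bound [tau] is fixed before [eta], since the modulus of the drift depends on
   it. *)
pose eta1 := Num.min eta (Num.min (de / 8) ((T - t2) / 2)).
have eta10 : 0 < eta1 by rewrite !lt_min eta0 !divr_gt0//= subr_gt0.
have [eta1a eta1b eta1c] : [/\ eta1 <= eta, eta1 <= de / 8 & eta1 <= (T - t2) / 2].
  by split; rewrite /eta1 !ge_min lexx ?orbT.
have cS := @closed_cylinder T Rb (ltW Rb0).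
have cg : continuous (fun z : 'rV[R]_(D + D) => coupled_time 1 (-1) z ^+ 2).
  by apply: continuous_exprn; exact: continuous_coupled_time.
have [||||kap [z [Sz gz Wz hz]]] := @penalized_max _ _ _ W _ (coupled ts xs ts ys)
  (eta1 ^+ 2) cS bS cW cg.
- exact/cylinderE.
- by rewrite coupled_gap subrr expr0n.
- by move=> z; exact: sqr_ge0.
- by rewrite exprn_gt0.
have [t [x [s [y zE]]]] := coupledP z; rewrite {}zE in Sz gz Wz hz.
have /cylinderE[/andP[t0 tT] /andP[s0 sT] xR yR] := Sz.
have ts_le : `|t - s| <= eta1.
  by rewrite -ler_sqr ?nnegrE ?(ltW eta10)// real_normK ?num_real// -(coupled_gap t x s y).
have Sdiag : cylinder T Rb (coupled t x t y) by apply/cylinderE; rewrite t0.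
have hdiag : w0 / 2 < W (coupled t x t y).
  have hh : enorm (coupled t x s y - coupled t x t y) < de.
    rewrite coupledB !subrr; apply: le_lt_trans (enorm_coupled _ _ _ _) _.
    by rewrite !enorm0 normr0 distrC; clear -ts_le eta1b de0; lra.
  have := hde _ _ (bS _ Sz) (bS _ Sdiag) hh.
  by rewrite ltr_norml => /andP[_]; clear -Wz; rewrite -/w0 in Wz *; lra.
have [/andP[t00 tt2] xR' yR' xy] := hW t x y (introT andP (conj t0 tT)) xR yR (lt_trans w20 hdiag).
(* Otherwise uniform continuity would make [W] positive at time 0, which the hypothesis forbids. *)
have tde : de / 2 <= t.
  rewrite leNgt; apply/negP => tde.
  have Szero : cylinder T Rb (coupled 0 x 0 y) by apply/cylinderE; rewrite T0 lexx.
  have hh : enorm (coupled t x t y - coupled 0 x 0 y) < de.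
    rewrite coupledB !subrr !subr0; apply: le_lt_trans (enorm_coupled _ _ _ _) _.
    by rewrite !enorm0 ger0_norm//; clear -tde; lra.
  have := hde _ _ (bS _ Sdiag) (bS _ Szero) hh.
  rewrite ltr_norml => /andP[_ h].
  have : 0 < W (coupled 0 x 0 y) by clear -h hdiag; lra.
  have T00 : 0 <= (0 : R) <= T by rewrite lexx T0.
  by move=> /(hW _ _ _ T00 xR yR)[]; rewrite ltxx.
have [ts1 ts2] : t - s <= eta1 /\ s - t <= eta1.
  by move: ts_le; rewrite ler_norml => /andP[h1 h2]; split; clear -h1 h2; lra.
have sde : 3 * de / 8 <= s by clear -ts1 tde eta1b; lra.
have sT1 : s < T by clear -ts2 eta1c tt2 t2T; lra.
have tT1 : t < T by clear -tt2 t2T; lra.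
pose r0 := Num.min (de / 8)
  (Num.min (Num.min (T - t) (T - s)) (Num.min (Rb - enorm x) (Rb - enorm y))).
have r00 : 0 < r0 by rewrite !lt_min !subr_gt0 tT1 sT1 xR' yR' divr_gt0.
have r0_le : [/\ r0 <= de / 8, r0 <= T - t, r0 <= T - s, r0 <= Rb - enorm x & r0 <= Rb - enorm y].
  by split; rewrite /r0 !ge_min lexx ?orbT.
have [r1 r2 r3 r4 r5] := r0_le.
exists kap, t, x, s, y, r0; split.
- split; last exact: le_trans eta1a.
  + by rewrite tT1 andbT; clear -tde de0; lra.
  + by rewrite sT1 andbT; clear -sde de0; lra.
- by [].
- by rewrite r00/=; clear -r1 de0; lra.
move=> w1 w2 w1r w2r /=; apply: hz.
rewrite !spacetimeD; apply/cylinderE.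
have h1 := coord_le_enorm w1 (lshift d 0); have h2 := coord_le_enorm w2 (lshift d 0).
have h3 := enorm_rsubmx w1; have h4 := enorm_rsubmx w2.
have h5 := enormD x (rsubmx w1); have h6 := enormD y (rsubmx w2).
move: h1 h2; rewrite !ler_norml => /andP[a1 a2] /andP[a3 a4].
split; [apply/andP; split|apply/andP; split| |];
  clear -a1 a2 a3 a4 h3 h4 h5 h6 w1r w2r r1 r2 r3 r4 r5 tde sde de0; lra.
Qed.

End Doubling.

Section DoubledMajorant.
Context {R : realType} {d : nat}.
Local Notation D := (1 + d)%N.

Definition energy (mu Bc r k : R) (z : 'rV[R]_(D + D)) : R :=
  Bc * barrier mu (coupled_sqnorm 1 (- 1) z) +
  (lyap r k (coupled_sqnorm 1 0 z) + lyap r k (coupled_sqnorm 0 1 z)).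

(** The decaying energy, a penalty at infinity, a linear term in time for strictness, and a cubic
    term that keeps the maximum away from the final time. *)
Definition majorant (mu Bc r k M om eps q C2 N t1 : R) (z : 'rV[R]_(D + D)) : R :=
  M * expR (- om * coupled_time 1 0 z) * energy mu Bc r k z +
  eps * (lyap r q (coupled_sqnorm 1 0 z) + lyap r q (coupled_sqnorm 0 1 z)) +
  (eps * (2 * C2 + 1) * coupled_time 1 0 z +
   N * Num.max (coupled_time 1 0 z - t1) 0 ^+ 3).

Lemma energyE mu Bc r k t x s y : energy mu Bc r k (coupled t x s y) =
  Bc * barrier mu (dot (x - y) (x - y)) + (lyap r k (dot x x) + lyap r k (dot y y)).
Proof.
by rewrite /energy !coupled_sqnormE !scale1r !scale0r addr0 add0r scaleN1r.
Qed.

Lemma majorantE mu Bc r k M om eps q C2 N t1 t x s y :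
  majorant mu Bc r k M om eps q C2 N t1 (coupled t x s y) =
  M * expR (- om * t) *
    (Bc * barrier mu (dot (x - y) (x - y)) + (lyap r k (dot x x) + lyap r k (dot y y))) +
  eps * (lyap r q (dot x x) + lyap r q (dot y y)) +
  (eps * (2 * C2 + 1) * t + N * Num.max (t - t1) 0 ^+ 3).
Proof.
rewrite /majorant energyE !coupled_sqnormE !coupled_timeE.
by rewrite !scale1r !scale0r addr0 add0r mul1r mul0r addr0.
Qed.

Lemma continuous_lyap_coupled e1 e2 r k :
  continuous (fun z : 'rV[R]_(D + D) => lyap r k (coupled_sqnorm e1 e2 z)).
Proof.
exact: (@continuous_lyap_sqnorm _ _ _ _ r k (@continuous_coupled_space R d e1 e2)).
Qed.

Lemma continuous_energy mu Bc r k : continuous (energy mu Bc r k).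
Proof.
apply: continuous_addr; last by apply: continuous_addr; exact: continuous_lyap_coupled.
apply: continuous_scaler.
exact: (@continuous_barrier_sqnorm _ _ _ _ mu (@continuous_coupled_space R d 1 (- 1))).
Qed.

Lemma continuous_majorant mu Bc r k M om eps q C2 N t1 :
  continuous (majorant mu Bc r k M om eps q C2 N t1).
Proof.
have ct (c : R) : continuous (fun z : 'rV[R]_(D + D) => c * coupled_time 1 0 z).
  by apply: continuous_scaler; exact: continuous_coupled_time.
apply: continuous_addr.
  apply: continuous_addr.
    apply: continuous_mulr; last exact: continuous_energy.
    apply: continuous_scaler; apply: continuous_compr; first exact: ct.
    exact: continuous_expR.
  apply: continuous_scaler.
  by apply: continuous_addr; exact: continuous_lyap_coupled.
apply: continuous_addr; first exact: ct.
apply: continuous_scaler; apply: continuous_exprn.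
have -> : (fun z : 'rV[R]_(D + D) => Num.max (coupled_time 1 0 z - t1) 0) =
    fun z => Num.max 0 (coupled_time 1 0 z - t1).
  by apply/funext => z; rewrite maxC.
apply: continuous_maxl; apply: continuous_subr; first exact: continuous_coupled_time.
by move=> z; exact: cst_continuous.
Qed.

(** Outside the ball, [|x|^gamma >= r^(gamma-2) |x|^2] since [gamma >= 2]. *)
Lemma drift_coercive (alpha gamma r : R) (v x : 'rV[R]_d) :
  0 < alpha -> 2 <= gamma -> 0 < r ->
  (r <= enorm x -> alpha * enorm x `^ gamma <= dot v x) ->
  r ^+ 2 <= dot x x -> alpha * r `^ (gamma - 2) * dot x x <= dot v x.
Proof.
move=> a0 g2 r0 h rx.
have rx' : r <= enorm x by rewrite -ler_sqr ?nnegrE ?enorm_ge0 ?(ltW r0)// sqr_enorm.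
have x0 : 0 < enorm x := lt_le_trans r0 rx'.
apply: le_trans (h rx'); rewrite -mulrA ler_wpM2l ?(ltW a0)//.
have -> : enorm x `^ gamma = enorm x `^ (gamma - 2) * enorm x ^+ 2.
  by rewrite -powR_mulrn ?(ltW x0)// -powRD ?(gt_eqF x0) ?implybT// subrK.
rewrite -sqr_enorm.
rewrite ler_wpM2r ?sqr_ge0//; apply: ge0_ler_powR => //; first by lra.
- by rewrite nnegrE ltW.
- by rewrite nnegrE ltW.
Qed.

End DoubledMajorant.

Section CoupledMajorant.
Context {R : realType}.

(** The order of quantifiers matters: the rate and the energy come before the penalty exponent [q],
    and only [C2] depends on [q]. *)
Lemma coupled_majorant d (lambda0 sigma0 sigma1 gamma alpha r c0 k : R) :
  (0 < d)%N -> 0 < lambda0 -> 2 <= gamma -> 0 < alpha -> 0 < r -> 0 < c0 -> 0 < k ->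
  exists mu Bc om : R, [/\ 0 < mu, 0 < Bc, 0 < om & forall q : R, 0 < q ->
  exists2 C2 : R, 0 < C2 &
  forall l (Sigma : 'rV[R]_d -> 'M[R]_(d, l)) (b : R -> 'rV[R]_d -> 'rV[R]_d)
    (M eps N t1 kap t s : R) (x y : 'rV[R]_d),
  (forall x, opnorm (Sigma x) <= sigma0) ->
  (forall x y, opnorm (Sigma x - Sigma y) <= sigma1 * enorm (x - y)) ->
  (forall t x, 0 < t -> r <= enorm x ->
     alpha * enorm x `^ gamma <= dot (b t x) x) ->
  (forall t x y, 0 < t ->
     - c0 * enorm (x - y) <= dot (b t x - b t y) (x - y)) ->
  0 <= M -> 0 <= eps -> 0 <= N -> 0 < t -> 0 < s -> x != y ->
  enorm (b t y - b s y) <= 1 ->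
  exists (S1 S2 : 'M[R]_(d + l, d)) gam Gam,
  [/\ S1^T *m S1 = lambda0%:M + Sigma x *m (Sigma x)^T,
      S2^T *m S2 = lambda0%:M + Sigma y *m (Sigma y)^T,
      gen (row_mx (spacetime 1 (b t x)) (spacetime 1 (b s y)))
        (row_mx (row_mx 0 S1) (row_mx 0 S2)) (coupled t x s y)
        (fun z => majorant mu Bc r k M om eps q C2 N t1 z +
                  kap * coupled_time 1 (- 1) z ^+ 2) gam Gam &
      gam <= - eps]].
Proof.
move=> d0 l0 g2 a0 r0 c00 k0.
set al := alpha * r `^ (gamma - 2).
have al0 : 0 < al by rewrite mulr_gt0// powR_gt0.
set La := d%:R * (lambda0 + sigma0 ^+ 2).
have La0 : 0 <= La by rewrite mulr_ge0// addr_ge0 ?sqr_ge0// ltW.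
set c1 := c0 + 1 + 2 * d%:R * `|sigma0 * sigma1|.
have c10 : 0 < c1 by rewrite ltr_wpDr ?mulr_ge0// addr_gt0.
have [Bc [om [Bc0 om0 H]]] := coupled_decay r0 k0 al0 La0 l0 c10.
exists (c1 / (2 * lambda0)), Bc, om; split=> //; first by rewrite divr_gt0// mulr_gt0.
move=> q q0; have [om2 [C2 [om20 C20 H2]]] := lyapunov_drift r0 q0 al0 La0.
exists C2 => // l Sigma b M eps N t1 kap t s x y Sb Sl bco bos M0 eps0 N0 t0 s0 xy h1.
have [S1 [S2 [E1 E2 E3 E4]]] :=
  coupling_estimates l0 Sb Sl xy (bos t x y t0) h1.
exists S1, S2.
have ge0 e1 e2 : 0 <= coupled_sqnorm e1 e2 (coupled t x s y) by exact: dot_ge0.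
have g e1 e2 := gen_coupled_sqnorm e1 e2 (spacetime 1 (b t x)) (spacetime 1 (b s y))
  (spacetime t x) (spacetime s y) S1 S2.
have gA := g 1 0; have gB := g 0 1; have gC := g 1 (-1).
rewrite !spacetime_space !scale1r !scale0r !addr0 in gA.
rewrite !spacetime_space !scale1r !scale0r !add0r in gB.
rewrite !spacetime_space !scale1r !scaleN1r in gC.
have cA : coupled_sqnorm 1 0 (coupled t x s y) = dot x x.
  by rewrite coupled_sqnormE scale1r scale0r addr0.
have cB : coupled_sqnorm 0 1 (coupled t x s y) = dot y y.
  by rewrite coupled_sqnormE scale1r scale0r add0r.
have cC : coupled_sqnorm 1 (-1) (coupled t x s y) = dot (x - y) (x - y).
  by rewrite coupled_sqnormE scale1r scaleN1r.
have trA := trace_diffusion_le d0 Sb E1.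
have trB := trace_diffusion_le d0 Sb E2.
have qA : dot (x *m S1^T) (x *m S1^T) <= La * coupled_sqnorm 1 0 (coupled t x s y).
  by rewrite cA; exact: (quad_diffusion_le d0 l0 Sb _ E1).
have qB : dot (y *m S2^T) (y *m S2^T) <= La * coupled_sqnorm 0 1 (coupled t x s y).
  by rewrite cB; exact: (quad_diffusion_le d0 l0 Sb _ E2).
have bA : r ^+ 2 <= coupled_sqnorm 1 0 (coupled t x s y) ->
    al * coupled_sqnorm 1 0 (coupled t x s y) <= dot (b t x) x.
  by rewrite cA; apply: drift_coercive => //; exact: bco.
have bB : r ^+ 2 <= coupled_sqnorm 0 1 (coupled t x s y) ->
    al * coupled_sqnorm 0 1 (coupled t x s y) <= dot (b s y) y.
  by rewrite cB; apply: drift_coercive => //; exact: bco.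
have pos : 0 < coupled_sqnorm 1 (-1) (coupled t x s y).
  rewrite cC lt_neqAle dot_ge0 andbT eq_sym; apply: contra_neq xy.
  by move=> /dot_eq0/eqP; rewrite subr_eq0 => /eqP.
have hC : 16 * lambda0 * coupled_sqnorm 1 (-1) (coupled t x s y) <=
    4 * dot ((x - y) *m (S1 - S2)^T) ((x - y) *m (S1 - S2)^T) by rewrite cC.
have hg : 2 * \tr ((S1 - S2) *m (S1 - S2)^T) - 2 * dot (b t x - b s y) (x - y) <=
    8 * lambda0 + 2 * c1 * coupled_sqnorm 1 (-1) (coupled t x s y) `^ 2^-1.
  by rewrite cC powR12_sqrt ?dot_ge0.
have par : coupled_sqnorm 1 (-1) (coupled t x s y) <=
    2 * coupled_sqnorm 1 0 (coupled t x s y) + 2 * coupled_sqnorm 0 1 (coupled t x s y).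
  rewrite cA cB cC dot_sqrB; have := dot_ge0 (x + y).
  by rewrite dotDl !dotDr (dotC y x); lra.
have [gP [GP [hP hPle]]] := H _ _ _ _ _ _ _ _ _ _ _ _ _ _ _ _
  gA (ge0 _ _) trA (dot_ge0 _) qA bA gB (ge0 _ _) trB (dot_ge0 _) qB bB gC pos hC hg par.
have [gA' [GA' [hA hAle]]] := H2 _ _ _ _ _ _ _ _ _ gA (ge0 _ _) trA (dot_ge0 _) qA bA.
have [gB' [GB' [hB hBle]]] := H2 _ _ _ _ _ _ _ _ _ gB (ge0 _ _) trB (dot_ge0 _) qB bB.
have hAle' : gA' <= C2.
  apply: le_trans hAle _; rewrite gerBl mulr_ge0 ?(ltW om20)//.
  exact: le_trans ler01 (lyap_ge1 _ _ (ltW q0)).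
have hBle' : gB' <= C2.
  apply: le_trans hBle _; rewrite gerBl mulr_ge0 ?(ltW om20)//.
  exact: le_trans ler01 (lyap_ge1 _ _ (ltW q0)).
have gt e1 e2 := gen_coupled_time e1 e2 (spacetime 1 (b t x)) (spacetime 1 (b s y))
  (spacetime t x) (spacetime s y) S1 S2.
have gt1 := gt 1 0; rewrite coupled_timeE mulr1 mul0r addr0 in gt1.
have gt2 := gt 1 (-1); rewrite coupled_timeE !mulr1 subrr oppr0 in gt2.
have [gam [Gam [hgam hgamle]]] :=
  gen_majorant t1 kap M0 eps0 N0 hP hPle hA hAle' hB hBle' gt1 gt2.
by exists gam, Gam.
Qed.

End CoupledMajorant.

Section GrowthPenalty.
Context {R : realType}.

(** The exponent [m + 1] exceeds the growth of [u]. Beyond [Rb] the penalty of one particle also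
    covers the loss [B1] of the other. *)
Lemma growth_penalty d (r m C eps : R) : 0 < m -> 0 < C -> 0 < eps ->
  exists B1 Rb : R, [/\ 0 < B1, 0 < Rb,
    forall x : 'rV[R]_d, C * (1 + enorm x) `^ m <= eps * lyap r (m + 1) (dot x x) + B1 &
    forall x : 'rV[R]_d, Rb <= enorm x ->
      C * (1 + enorm x) `^ m + B1 <= eps * lyap r (m + 1) (dot x x)].
Proof.
move=> m0 C0 eps0; have q0 : 0 < m + 1 by rewrite addr_gt0.
set K1 := (4 * (1 + r ^+ 2) ^+ 3) `^ ((m + 1) / 6).
have K10 : 0 < K1.
  by rewrite powR_gt0// mulr_gt0// exprn_gt0// ltr_wpDr ?sqr_ge0.
have K20 : 0 < (2 : R) `^ (m + 1) by rewrite powR_gt0.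
pose c := eps / (2 `^ (m + 1) * K1).
have c0 : 0 < c by rewrite divr_gt0// mulr_gt0.
have key (x : 'rV[R]_d) : c * ((1 + enorm x) `^ m * (1 + enorm x)) <=
    eps * lyap r (m + 1) (dot x x).
  have x0 := enorm_ge0 x.
  have a0 : 0 < 1 + enorm x by rewrite ltr_pwDl.
  have jx : 1 + enorm x <= 2 * japanese x.
    have h1 : 1 <= japanese x.
      by rewrite -[leLHS]sqrtr1 /japanese ler_wsqrtr// lerDl sqr_ge0.
    have h2 : enorm x <= japanese x.
      by rewrite /japanese -[leLHS](ger0_norm x0) -sqrtr_sqr ler_wsqrtr// lerDr.
    lra.
  have -> : (1 + enorm x) `^ m * (1 + enorm x) = (1 + enorm x) `^ (m + 1).
    by rewrite powRD ?(gt_eqF a0) ?implybT// powRr1// ltW.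
  have h : (1 + enorm x) `^ (m + 1) <= 2 `^ (m + 1) * (K1 * lyap r (m + 1) (dot x x)).
    apply: (@le_trans _ _ ((2 * japanese x) `^ (m + 1))).
      apply: ge0_ler_powR => //; rewrite ?nnegrE ?(ltW q0) ?(ltW a0)//.
      by rewrite mulr_ge0// sqrtr_ge0.
    rewrite powRM ?sqrtr_ge0// ler_wpM2l ?(ltW K20)//.
    exact: japanese_le_lyap.
  have -> : eps * lyap r (m + 1) (dot x x) =
      c * (2 `^ (m + 1) * (K1 * lyap r (m + 1) (dot x x))).
    by rewrite /c; field; rewrite !gt_eqF.
  by rewrite ler_wpM2l// ltW.
have Cc0 : 0 < C / c by rewrite divr_gt0.
pose B1 := C * (C / c + 1) `^ m.
have B10 : 0 < B1 by rewrite mulr_gt0// powR_gt0// addr_gt0.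
exists B1, ((C + B1) / c); split=> //; first by rewrite divr_gt0// addr_gt0.
  move=> x; have x0 := enorm_ge0 x; have h := key x.
  set a := 1 + enorm x in h *; have a0 : 0 < a by rewrite ltr_pwDl.
  have am : 0 <= a `^ m by exact: powR_ge0.
  have [aC|aC] := leP a (C / c).
    have : C * a `^ m <= B1.
      rewrite ler_wpM2l ?(ltW C0)//; apply: ge0_ler_powR => //; first exact: ltW.
      - by rewrite nnegrE ltW.
      - by rewrite nnegrE addr_ge0// ltW.
      - by apply: le_trans aC _; rewrite lerDl.
    have : 0 <= c * (a `^ m * a).
      by apply: mulr_ge0; [exact: ltW|apply: mulr_ge0 => //; exact: ltW].
    by clear -h; lra.
  have : C * a `^ m <= c * (a `^ m * a).
    have -> : c * (a `^ m * a) = c * a * a `^ m by ring.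
    by rewrite ler_wpM2r//; move: aC; rewrite ltr_pdivrMr// [_ * c]mulrC => /ltW.
  by clear -h B10; lra.
move=> x Rx; have x0 := enorm_ge0 x; apply: le_trans (key x).
set a := 1 + enorm x; have a1 : 1 <= a by rewrite lerDl.
have am : 1 <= a `^ m by rewrite -[leLHS](powRr0 a); apply: ler_powR => //; exact: ltW.
have ac : C + B1 <= c * a.
  move: Rx; rewrite ler_pdivrMr// => Rx; apply: le_trans Rx _.
  by rewrite [leLHS]mulrC ler_wpM2l ?(ltW c0)// lerDr.
have -> : c * (a `^ m * a) = c * a * a `^ m by ring.
apply: (@le_trans _ _ ((C + B1) * a `^ m)); last first.
  by rewrite ler_wpM2r// (le_trans _ am).
by rewrite mulrDl lerD2l ler_peMr// ltW.
Qed.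

End GrowthPenalty.

Section OneSided.
Context {R : realType}.

Lemma drift_time_modulus d (b : R -> 'rV[R]_d -> 'rV[R]_d) (tau T Rb : R) :
  0 < tau -> 0 < T -> 0 < Rb ->
  {within [set p : R * 'rV[R]_d | 0 < p.1],
     continuous (fun p : R * 'rV[R]_d => b p.1 p.2)} ->
  exists2 eta : R, 0 < eta & forall t s y, tau < t < T -> tau < s < T ->
    enorm y < Rb -> `|t - s| <= eta -> enorm (b t y - b s y) <= 1.
Proof.
move=> tau0 T0 Rb0 cb.
pose q e1 e2 (z : 'rV[R]_((1 + d) + (1 + d))) :=
  (Num.max tau (coupled_time e1 e2 z), rsubmx (rsubmx z)).
have cq e1 e2 : continuous (q e1 e2).
  apply: continuous_pair.
    by apply: continuous_maxl; exact: continuous_coupled_time.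
  by move=> z; apply: continuous_comp; exact: continuous_rsubmx.
have rq e1 e2 z : [set p : R * 'rV[R]_d | 0 < p.1] (q e1 e2 z).
  by rewrite /= lt_max tau0.
have cbq e1 e2 := continuous_within_range cb (cq e1 e2) (rq e1 e2).
(* Both drifts are taken at the second position, at the first and at the second time; uniform
   continuity is then applied to the squared norm of [v]. *)
pose v z := b (q 1 0 z).1 (q 1 0 z).2 - b (q 0 1 z).1 (q 0 1 z).2.
have cv : continuous v by move=> z; apply: continuousB; exact: cbq.
have M00 : 0 < 2 * T + Rb by lra.
have [de de0 hde] := uniform_continuity M00 ltr01 (continuous_sqnorm cv).
exists (de / 2) => [|t s y]; first by rewrite divr_gt0.
move=> /andP[taut tT] /andP[taus sT] yR ts.
have s0 : 0 < s by lra.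
have t0 : 0 < t by lra.
have vE t' : tau < t' -> v (coupled t' 0 s y) = b t' y - b s y.
  move=> h; rewrite /v /q /= !coupled_timeE !row_mxKr.
  rewrite !(mul1r, mul0r, addr0, add0r).
  by rewrite (max_idPr (ltW h)) (max_idPr (ltW taus)).
have bd t' : 0 < t' -> t' < T -> enorm (coupled t' 0 s y) <= 2 * T + Rb.
  move=> h1 h2; apply: le_trans (enorm_coupled _ _ _ _) _.
  by rewrite enorm0 (gtr0_norm h1) (gtr0_norm s0); lra.
have hh : enorm (coupled t 0 s y - coupled s 0 s y) < de.
  rewrite coupledB !subrr; apply: le_lt_trans (enorm_coupled _ _ _ _) _.
  by rewrite !enorm0 normr0; lra.
have := hde _ _ (bd t t0 tT) (bd s s0 sT) hh.
rewrite !vE// subrr dot0l subr0 ger0_norm ?dot_ge0// => /ltW h.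
by rewrite -ler_sqr ?nnegrE ?enorm_ge0// sqr_enorm expr1n.
Qed.

(* The maximum of the doubled difference is incompatible with [coupled_majorant]
   by the theorem on sums. *)
Lemma one_sided_estimate d (lambda0 sigma0 sigma1 gamma alpha r c0 k : R) :
  (0 < d)%N -> 0 < lambda0 -> 2 <= gamma -> 0 < alpha -> 0 < r -> 0 < c0 -> 0 < k ->
  exists mu Bc om : R, [/\ 0 < mu, 0 < Bc, 0 < om &
  forall l (Sigma : 'rV[R]_d -> 'M[R]_(d, l))
    (b : R -> 'rV[R]_d -> 'rV[R]_d) (T : R)
    (u0 : 'rV[R]_d -> R) (u : R -> 'rV[R]_d -> R) (m C M : R),
  (forall x, opnorm (Sigma x) <= sigma0) ->
  (forall x y, opnorm (Sigma x - Sigma y) <= sigma1 * enorm (x - y)) ->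
  {within [set p : R * 'rV[R]_d | 0 < p.1],
     continuous (fun p : R * 'rV[R]_d => b p.1 p.2)} ->
  (forall t x, 0 < t -> r <= enorm x ->
     alpha * enorm x `^ gamma <= dot (b t x) x) ->
  (forall t x y, 0 < t ->
     - c0 * enorm (x - y) <= dot (b t x - b t y) (x - y)) ->
  0 < T ->
  viscosity_solution lambda0 Sigma b T u0 u ->
  0 < m -> 0 < C ->
  (forall t x, 0 <= t <= T -> `|u t x| <= C * (1 + enorm x) `^ m) ->
  0 <= M ->
  (forall x y, u0 x - u0 y <= M * (lyap r k (dot x x) + lyap r k (dot y y))) ->
  forall t x y, 0 < t < T ->
    u t x - u t y <= M * expR (- om * t) *
      (Bc * barrier mu (dot (x - y) (x - y)) +
       (lyap r k (dot x x) + lyap r k (dot y y)))].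
Proof.
move=> d0 l0 g2 a0 r0 c00 k0.
have [mu [Bc [om [mu0 Bc0 om0 H]]]] :=
  coupled_majorant sigma0 sigma1 d0 l0 g2 a0 r0 c00 k0.
exists mu, Bc, om; split=> // l Sigma b T u0 u m C M Sb Sl cb bco bos T0 vis m0 C0 gr M0 hM.
move=> ts xs ys /[dup] tsT /andP[ts0 tsT'].
have q0 : 0 < m + 1 by rewrite addr_gt0.
have [C2 C20 {}H] := H _ q0.
have Fk (x : 'rV[R]_d) : 1 <= lyap r k (dot x x) by rewrite lyap_ge1 ?(ltW k0).
have Fq (x : 'rV[R]_d) : 1 <= lyap r (m + 1) (dot x x) by rewrite lyap_ge1 ?(ltW q0).
rewrite leNgt; apply/negP => hw.
set w := u ts xs - u ts ys - M * expR (- om * ts) *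
      (Bc * barrier mu (dot (xs - ys) (xs - ys)) +
       (lyap r k (dot xs xs) + lyap r k (dot ys ys))).
have w0 : 0 < w by rewrite subr_gt0.
set S := lyap r (m + 1) (dot xs xs) + lyap r (m + 1) (dot ys ys) + (2 * C2 + 1) * ts.
have S0 : 0 < S.
  rewrite addr_gt0 ?mulr_gt0//; last by lra.
  by have := Fq xs; have := Fq ys; lra.
(* At the point to be contradicted the penalties cost [eps S = w / 2], half of the excess. *)
pose eps := w / (2 * S).
have eps0 : 0 < eps by rewrite divr_gt0// mulr_gt0.
have epsS : eps * S = w / 2 by rewrite /eps; field; rewrite gt_eqF.
have [B1 [Rb [B10 Rb0 gr1 gr2]]] := growth_penalty d r m0 C0 eps0.
pose h := (T - ts) / 2.
have h0 : 0 < h by rewrite divr_gt0// subr_gt0.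
(* From time [ts + h] on the cubic term is at least [2 B1], the loss of the two particles; at [ts]
   it vanishes. *)
pose N := 2 * B1 / h ^+ 3.
have N0 : 0 < N by apply: divr_gt0; [exact: mulr_gt0|exact: exprn_gt0].
have [cu u0E _] := vis.
pose Psi := majorant mu Bc r k M om eps (m + 1) C2 N ts : 'rV[R]_((1 + d) + (1 + d)) -> R.
pose u1 : 'rV[R]_(1 + d) -> R := extend T u.
pose u2 : 'rV[R]_(1 + d) -> R := extend T (fun t x => - u t x).
have cu1 : continuous u1 by exact: continuous_extend.
have cu2 : continuous u2.
  by have := continuous_oppr cu1.
pose W z := u1 (lsubmx z) + u2 (rsubmx z) - Psi z.
have cW : continuous W.
  apply: continuous_subr; last exact: continuous_majorant.
  apply: continuous_addr; apply: continuous_compr => //.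
    exact: continuous_lsubmx.
  exact: continuous_rsubmx.
have clipE t : 0 <= t <= T -> clip T t = t.
  by move=> /andP[t0 tT]; rewrite /clip (min_idPl tT) (max_idPr t0).
have WE t x y : 0 <= t <= T -> W (coupled t x t y) = u t x - u t y - Psi (coupled t x t y).
  move=> tT; rewrite /W row_mxKl row_mxKr /u1 /u2 /extend !spacetime_time !spacetime_space.
  by rewrite clipE.
have PsiE t x y : Psi (coupled t x t y) = _ := majorantE _ _ _ _ _ _ _ _ _ _ _ _ _ _ _.
have tsT1 : 0 <= ts <= T by rewrite !ltW.
have Ws : 0 < W (coupled ts xs ts ys).
  rewrite WE// PsiE subrr maxxx expr0n/= mulr0 addr0.
  have -> : u ts xs - u ts ys -
    (M * expR (- om * ts) * (Bc * barrier mu (dot (xs - ys) (xs - ys)) +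
       (lyap r k (dot xs xs) + lyap r k (dot ys ys))) +
     eps * (lyap r (m + 1) (dot xs xs) + lyap r (m + 1) (dot ys ys)) +
     eps * (2 * C2 + 1) * ts) = w - eps * S by rewrite /w /S; ring.
  by rewrite epsS; lra.
have E0 t : 0 <= M * expR (- om * t) by rewrite mulr_ge0// expR_ge0.
have bar0 (x y : 'rV[R]_d) : 0 <= Bc * barrier mu (dot (x - y) (x - y)).
  by rewrite mulr_ge0 ?(ltW Bc0)// barrier_ge0// ltW.
have Phi0 t (x y : 'rV[R]_d) : 0 <= M * expR (- om * t) *
    (Bc * barrier mu (dot (x - y) (x - y)) + (lyap r k (dot x x) + lyap r k (dot y y))).
  by rewrite mulr_ge0// addr_ge0// addr_ge0//; apply: le_trans (Fk _).
have cube0 t : 0 <= N * Num.max (t - ts) 0 ^+ 3.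
  by rewrite mulr_ge0 ?(ltW N0)// exprn_ge0// le_max lexx orbT.
have lin0 t : 0 <= t -> 0 <= eps * (2 * C2 + 1) * t.
  by move=> t0; rewrite mulr_ge0// mulr_ge0 ?(ltW eps0)//; lra.
have eF (x : 'rV[R]_d) : 0 <= eps * lyap r (m + 1) (dot x x).
  by rewrite mulr_ge0 ?(ltW eps0)//; apply: le_trans (Fq _).
have ug t x y : 0 <= t <= T ->
    u t x <= C * (1 + enorm x) `^ m /\ - u t y <= C * (1 + enorm y) `^ m.
  move=> tT; split; first exact: le_trans (ler_norm _) (gr _ _ tT).
  by rewrite (le_trans _ (gr _ y tT))// -normrN ler_norm.
(* Positivity is excluded at [t = 0] by the initial bound, from [ts + h] on by the cubic term,
   beyond [Rb] by the growth penalty, and on the diagonal because [u t x - u t y] vanishes. *)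
have hW t x y : 0 <= t <= T -> enorm x <= Rb -> enorm y <= Rb ->
     0 < W (coupled t x t y) ->
     [/\ 0 < t < ts + h, enorm x < Rb, enorm y < Rb & x != y].
  move=> /[dup] tT /andP[t0 tT'] xR yR; rewrite WE// PsiE.
  have [ux uy] := ug t x y tT.
  have P := Phi0 t x y; have Q := cube0 t; have L := lin0 _ t0.
  have ex := eF x; have ey := eF y.
  have gx := gr1 x; have gy := gr1 y.
  set Ph := M * expR _ * _ in P *; set Cu := N * _ in Q *; set Li := eps * _ * t in L *.
  move=> hp; split.
  - apply/andP; split.
      rewrite lt_neqAle t0 andbT; apply/negP => /eqP tE.
      have := hM x y; have : M * (lyap r k (dot x x) + lyap r k (dot y y)) <= Ph.
        rewrite /Ph -tE mulr0 expR0 mulr1 ler_wpM2l// lerDr; exact: bar0.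
      by move: hp; rewrite -tE !u0E; clear -ex ey Q L; lra.
    rewrite ltNge; apply/negP => tE.
    have : 2 * B1 <= Cu.
      have -> : 2 * B1 = N * h ^+ 3 by rewrite /N; field; rewrite gt_eqF// exprn_gt0.
      rewrite /Cu ler_wpM2l ?(ltW N0)// ler_pXn2r// ?nnegrE ?(ltW h0)//.
        by rewrite le_max; apply/orP; left; rewrite lerBrDl.
      by rewrite le_max lexx orbT.
    by clear -hp ux uy gx gy P L; lra.
  - rewrite ltNge; apply/negP => /gr2 xg.
    by clear -hp ux uy gy xg P L Q; lra.
  - rewrite ltNge; apply/negP => /gr2 yg.
    by clear -hp ux uy gx yg P L Q; lra.
  - by apply/eqP => xy; move: hp; rewrite xy subrr; clear -P L Q ey; lra.
have xsR : enorm xs <= Rb.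
  rewrite leNgt; apply/negP => /ltW/gr2 xg.
  have := Ws; rewrite WE// PsiE.
  have [ux uy] := ug ts xs ys tsT1.
  have := Phi0 ts xs ys; have := cube0 ts; have := lin0 _ (ltW ts0); have := gr1 ys.
  by clear -ux uy xg; lra.
have ysR : enorm ys <= Rb.
  rewrite leNgt; apply/negP => /ltW/gr2 yg.
  have := Ws; rewrite WE// PsiE.
  have [ux uy] := ug ts xs ys tsT1.
  have := Phi0 ts xs ys; have := cube0 ts; have := lin0 _ (ltW ts0); have := gr1 xs.
  by clear -ux uy yg; lra.
have t2T : ts + h < T by rewrite /h; lra.
have [tau tau0 {}hW] := doubling_time t2T Rb0 cW hW tsT1 xsR ysR Ws.
have [eta eta0 heta] := drift_time_modulus tau0 T0 Rb0 cb.
have {hW} [kap [t [x [s [y [r1 [[tT sT tse] [xR yR xy] /andP[r10 r1tau] hmax]]]]]]] := hW _ eta0.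
have b1 := heta _ _ _ tT sT yR tse.
have [/andP[t0 tT'] /andP[s0 sT']] := conj tT sT.
have t00 : 0 < t := lt_trans tau0 t0.
have s00 : 0 < s := lt_trans tau0 s0.
have [S1 [S2 [gam [Gam [E1 E2 hgen hgam]]]]] :=
  H l Sigma b M eps N ts kap t s x y Sb Sl bco bos M0 (ltW eps0) (ltW N0) t00 s00 xy b1.
have [p [X [hu htr]]] := gen_ujet hgen.
pose r2 := Num.min r1 (Num.min (T - t) (T - s)).
have r20 : 0 < r2 by rewrite !lt_min r10 !subr_gt0 tT'.
have [r21 r22 r23] : [/\ r2 <= r1, r2 <= T - t & r2 <= T - s].
  by split; rewrite /r2 !ge_min lexx ?orbT.
have near_time (z z1 : 'rV[R]_(1 + d)) : enorm (z - z1) < r2 -> tau < z1 0 (lshift d 0) ->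
    r2 <= T - z1 0 (lshift d 0) -> 0 < z 0 (lshift d 0) < T.
  move=> zr h1 h2; have := coord_le_enorm (z - z1) (lshift d 0).
  rewrite !mxE ler_norml => /andP[h3 h4]; apply/andP; split.
    by clear -h3 zr h1 r21 r1tau; lra.
  by clear -h4 zr h2; lra.
have vis1 := subsolution_ujet (viscosity_subsolution vis) m0 C0 gr.
have gr' t' x' : 0 <= t' <= T -> `|- u t' x'| <= C * (1 + enorm x') `^ m.
  by rewrite normrN; exact: gr.
have vis2 := subsolution_ujet (viscosity_supersolution vis) m0 C0 gr'.
have := @theorem_on_sums R (1 + d) (d + l) u1 u2 (spacetime_drift b) (spacetime_drift b)
  (spatial_diffusion lambda0 Sigma) (spatial_diffusion lambda0 Sigma)
  (spacetime t x) (spacetime s y) (lsubmx p) (rsubmx p) (row_mx 0 S1) (row_mx 0 S2) X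
  (fun z => Psi z + kap * coupled_time 1 (- 1) z ^+ 2) r2 isT r20 cu1 cu2.
rewrite hsubmxK => /(_ hu) THM.
have {}THM : dot (spacetime_drift b (spacetime t x)) (lsubmx p) +
    dot (spacetime_drift b (spacetime s y)) (rsubmx p) <=
    \tr (row_mx (row_mx 0 S1) (row_mx 0 S2) *m X *m (row_mx (row_mx 0 S1) (row_mx 0 S2))^T).
  apply: THM.
  - move=> w1 w2 w1r w2r; have := hmax w1 w2 (le_trans w1r r21) (le_trans w2r r21).
    by rewrite /W /coupled !row_mxKl !row_mxKr; clear; lra.
  - move=> z p' Y zr; apply: vis1.
    by apply: near_time zr _ _; rewrite spacetime_time.
  - move=> z p' Y zr; apply: vis2.
    by apply: near_time zr _ _; rewrite spacetime_time.
  - by apply: spacetime_drift_continuous_at => //; rewrite spacetime_time.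
  - by apply: spacetime_drift_continuous_at => //; rewrite spacetime_time.
  - exact: (spatial_diffusion_continuous_at lambda0 _ d0 Sb Sl).
  - exact: (spatial_diffusion_continuous_at lambda0 _ d0 Sb Sl).
  - by apply: spatial_diffusion_gram; rewrite spacetime_space.
  - by apply: spatial_diffusion_gram; rewrite spacetime_space.
have pE : dot (row_mx (spacetime 1 (b t x)) (spacetime 1 (b s y))) p =
    dot (spacetime 1 (b t x)) (lsubmx p) + dot (spacetime 1 (b s y)) (rsubmx p).
  by rewrite -{1}(hsubmxK p) dot_row_mx.
(* The trace is [gam] plus the same drift terms, so what remains is [0 <= gam <= - eps]. *)
move: THM; rewrite htr pE /spacetime_drift !spacetime_time !spacetime_space.
by clear -eps0 hgam; lra.
Qed.

End OneSided.

(** * Decay of the weighted oscillation *)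

Unset Implicit Arguments.

Theorem theorem3p5 (R : realType) (d : nat)
    (lambda0 sigma0 sigma1 gamma alpha r c0 k : R) :
  (0 < d)%N -> 0 < lambda0 -> 2 <= gamma -> 0 < alpha -> 0 < r -> 0 < c0 ->
  0 < k ->
  exists K omega : R, 0 < K /\ 0 < omega /\
  forall (l : nat) (Sigma : 'rV[R]_d -> 'M[R]_(d, l))
    (b : R -> 'rV[R]_d -> 'rV[R]_d) (T : R)
    (u0 : 'rV[R]_d -> R) (u : R -> 'rV[R]_d -> R) (m C : R),
  (forall x, opnorm (Sigma x) <= sigma0) ->
  (forall x y, opnorm (Sigma x - Sigma y) <= sigma1 * enorm (x - y)) ->
  {within [set p : R * 'rV[R]_d | 0 < p.1],
     continuous (fun p : R * 'rV[R]_d => b p.1 p.2)} ->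
  (forall t x, 0 < t -> r <= enorm x ->
     alpha * enorm x `^ gamma <= dot (b t x) x) ->
  (forall t x y, 0 < t ->
     - c0 * enorm (x - y) <= dot (b t x - b t y) (x - y)) ->
  0 < T ->
  continuous u0 ->
  viscosity_solution lambda0 Sigma b T u0 u ->
  0 < m -> 0 < C ->
  (forall t x, 0 <= t <= T -> `|u t x| <= C * (1 + enorm x) `^ m) ->
  Linfty_weighted k u0 ->
  forall t, 0 < t < T ->
    (wosc k (u t) <= (K * expR (- omega * t))%:E * wosc k u0)%E.
Proof.
move=> d0 l0 g2 a0 r0 c00 k0.
have [mu [Bc [om [mu0 Bc0 om0 H]]]] :=
  one_sided_estimate sigma0 sigma1 d0 l0 g2 a0 r0 c00 k0.
have [c cp japanese_le] : exists2 c, 0 < c &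
    forall x : 'rV[R]_d, japanese x `^ k <= c * lyap r k (dot x x).
  exists ((4 * (1 + r ^+ 2) ^+ 3) `^ (k / 6)) => [|x]; last exact: japanese_le_lyap.
  by rewrite powR_gt0// mulr_gt0// exprn_gt0// ltr_wpDr ?sqr_ge0.
have Bc1 : 0 < Bc + 1 by rewrite addr_gt0.
exists (c * (Bc + 1)), om; split; first exact: mulr_gt0.
split=> // l Sigma b T u0 u m C Sb Sl cb bco bos T0 _ vis m0 C0 gr _ t tT.
have Ke : 0 < c * (Bc + 1) * expR (- om * t).
  by apply: mulr_gt0; [exact: mulr_gt0|exact: expR_gt0].
have j0 (x : 'rV[R]_d) : 0 < japanese x `^ k.
  by rewrite powR_gt0// sqrtr_gt0 ltr_wpDr ?sqr_ge0.
have jj (x y : 'rV[R]_d) : 0 < japanese x `^ k + japanese y `^ k by exact: addr_gt0.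
have sup_ge (x y : 'rV[R]_d) :
    ((`|u0 x - u0 y| / (japanese x `^ k + japanese y `^ k))%:E <= wosc k u0)%E.
  by apply: ereal_sup_ubound; exists x, y.
(* An infinite oscillation makes the bound trivial; the value [-oo] is excluded because the supremum
   runs over a nonempty set. *)
case E : (wosc k u0) => [w| |]; last 2 first.
- by rewrite gt0_muley ?lte_fin// leey.
- by have := sup_ge 0 0; rewrite E leeNy_eq.
have w0 : 0 <= w.
  by have := sup_ge 0 0; rewrite E lee_fin; apply: le_trans; rewrite divr_ge0// ltW.
have hM x y : u0 x - u0 y <= w * c * (lyap r k (dot x x) + lyap r k (dot y y)).
  apply: le_trans (ler_norm _) _.
  have := sup_ge x y; rewrite E lee_fin ler_pdivrMr// => /le_trans; apply.
  rewrite -mulrA ler_wpM2l// mulrDr; apply: lerD; exact: japanese_le.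
have wc0 : 0 <= w * c by rewrite mulr_ge0// ltW.
have one_sided x y : u t x - u t y <=
    c * (Bc + 1) * expR (- om * t) * w * (japanese x `^ k + japanese y `^ k).
  apply: le_trans (H _ _ _ _ _ _ _ _ _ Sb Sl cb bco bos T0 vis m0 C0 gr wc0 hM _ x y tT) _.
  have Lx := lyap_ge1 r (dot x x) (ltW k0); have Ly := lyap_ge1 r (dot y y) (ltW k0).
  have Jx := lyap_le_japanese r x k0; have Jy := lyap_le_japanese r y k0.
  (* The barrier is at most 1 and each [lyap] at least 1: this gives the factor [Bc + 1] of the
     constant, [c] coming from the comparison of the weights. *)
  have bar : Bc * barrier mu (dot (x - y) (x - y)) <=
      Bc * (lyap r k (dot x x) + lyap r k (dot y y)).
    rewrite ler_wpM2l ?(ltW Bc0)// (le_trans (barrier_le1 _ _))//; clear -Lx Ly; lra.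
  have mulE (a1 a2 a3 a4 a5 : R) : a1 * a2 * a3 * a4 * a5 = a4 * a1 * a3 * (a2 * a5).
    by ring.
  rewrite mulE.
  apply: ler_wpM2l; first by rewrite mulr_ge0 ?expR_ge0.
  apply: (@le_trans _ _ ((Bc + 1) * (lyap r k (dot x x) + lyap r k (dot y y)))).
    by clear -bar; lra.
  exact: ler_wpM2l (ltW Bc1) _ _ (lerD Jx Jy).
rewrite -EFinM; apply: ge_ereal_sup => _ [x [y ->]].
rewrite lee_fin ler_pdivrMr// ler_norml one_sided andbT.
by rewrite lerNl opprB (addrC (japanese x `^ k)) one_sided.
Qed.
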